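(* Let $\omega\in\widehat{\mathcal D}$ and $1<p,q<\infty$. Then the maximal Bergman projection $P^+_\omega$ is bounded from $L^{p,q}_\omega$ to $L^{p,q}_\omega$ if and only if $\omega\in\check{\mathcal D}$ (equivalently, $\omega\in\mathcal D=\widehat{\mathcal D}\cap\check{\mathcal D}$).
   Context: A radial weight is a nonnegative $\omega\in L^1([0,1))$, extended by $\omega(z)=\omega(|z|)$; $\widehat\omega(r)=\int_r^1\omega(s)ds>0$ for all $r\in[0,1)$. $\omega\in\widehat{\mathcal D}$ means $\widehat\omega(r)\le C\widehat\omega(\frac{1+r}2)$ for some $C>0$ and all $0\le r<1$. $\omega\in\check{\mathcal D}$ means there exist $K>1$, $C>1$ with $\widehat\omega(r)\ge C\widehat\omega(1-\frac{1-r}K)$ for all $0\le r<1$. $\omega_x=\int_0^1r^x\omega(r)dr$. $L^{p,q}_\omega$ consists of measurable $f$ on $\mathbb D$ with $\|f\|^q_{L^{p,q}_\omega}=\int_0^1\big(\frac1{2\pi}\int_0^{2\pi}|f(re^{i\theta})|^pd\theta\big)^{q/p}r\omega(r)\,dr<\infty$. $B^\omega_z(\zeta)=\sum_{n\ge0}\frac{(\overline z\zeta)^n}{2\omega_{2n+1}}$ and $P^+_\omega f(z)=\int_{\mathbb D}f(\zeta)|B^\omega_z(\zeta)|\omega(\zeta)\,dA(\zeta)$, with $dA$ normalized area measure. *)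

(* Defs.v *)
From HB Require Import structures.
From mathcomp Require Import all_boot all_order all_algebra.
From mathcomp Require Import all_classical all_reals all_analysis.
From mathcomp Require Import complex.

Set Implicit Arguments.
Unset Strict Implicit.
Unset Printing Implicit Defensive.

Import Order.TTheory GRing.Theory Num.Theory.
Import numFieldTopology.Exports numFieldNormedType.Exports.

Local Open Scope classical_set_scope.
Local Open Scope ring_scope.

Section Defs.
Context {R : realType}.

Definition leb2 := (@lebesgue_measure R \x @lebesgue_measure R)%E.

Definition toC (xy : R * R) : R[i] := (xy.1 +i* xy.2)%C.

Definition disc : set (R * R) := [set xy | xy.1 ^+ 2 + xy.2 ^+ 2 < 1].

Definition dA_int (g : R * R -> R) : R := pi^-1 * \int[leb2]_(xy in disc) g xy.

Definition cint_disc (g : R[i] -> R[i]) : R[i] :=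
  (dA_int (fun xy => complex.Re (g (toC xy))) +i* dA_int (fun xy => complex.Im (g (toC xy))))%C.

Definition cintegrable_disc (g : R[i] -> R[i]) : Prop :=
  leb2.-integrable disc (fun xy => (complex.Re (g (toC xy)))%:E) /\
  leb2.-integrable disc (fun xy => (complex.Im (g (toC xy)))%:E).

Definition cmeasurable_disc (f : R[i] -> R[i]) : Prop :=
  measurable_fun disc (fun xy => complex.Re (f (toC xy))) /\
  measurable_fun disc (fun xy => complex.Im (f (toC xy))).

(* radial weights: omega is given on [0,1) and extended by omega(z) = omega(|z|) *)
Definition omega_hat (w : R -> R) (r : R) : R :=
  \int[@lebesgue_measure R]_(s in `[r, 1%R[) w s.

Definition radial_weight (w : R -> R) : Prop :=
  (forall r, 0 <= r < 1 -> 0 <= w r) /\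
  (@lebesgue_measure R).-integrable `[0%R, 1%R[ (fun s => (w s)%:E) /\
  (forall r, 0 <= r < 1 -> 0 < omega_hat w r).

Definition Dhat (w : R -> R) : Prop :=
  exists C : R, 0 < C /\
    forall r, 0 <= r < 1 -> omega_hat w r <= C * omega_hat w ((1 + r) / 2).

Definition Dcheck (w : R -> R) : Prop :=
  exists K C : R, 1 < K /\ 1 < C /\
    forall r, 0 <= r < 1 -> C * omega_hat w (1 - (1 - r) / K) <= omega_hat w r.

Definition moment (w : R -> R) (n : nat) : R :=
  \int[@lebesgue_measure R]_(s in `[0%R, 1%R[) (s ^+ n * w s).

Definition Bker (w : R -> R) (z zeta : R[i]) : R[i] :=
  (* the limit is taken in R[i] with its usual (modulus) topology; R[i]^o is
     R[i] viewed as a normed space over itself *)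
  limn (series (fun n : nat =>
    (((conjc z * zeta) ^+ n / ((2 * moment w (2 * n + 1)%N)%:C)%C) : R[i]^o))).

Definition Pplus (w : R -> R) (f : R[i] -> R[i]) (z : R[i]) : R[i] :=
  cint_disc (fun zeta =>
    f zeta * ((ComplexField.Normc.normc (Bker w z zeta))%:C)%C * ((w (ComplexField.Normc.normc zeta))%:C)%C).

Definition Mp_pow (p : R) (f : R[i] -> R[i]) (r : R) : \bar R :=
  (((2 * pi)^-1)%:E *
   \int[@lebesgue_measure R]_(t in `[0%R, (2 * pi)%R]) 
      ((ComplexField.Normc.normc (f ((r * cos t) +i* (r * sin t))%C)) `^ p)%:E)%E.

Definition norm_pq (w : R -> R) (p q : R) (f : R[i] -> R[i]) : \bar R :=
  ((\int[@lebesgue_measure R]_(r in `[0%R, 1%R[)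
      (poweR (Mp_pow p f r) (q / p) * (r * w r)%:E)) `^ q^-1)%E.

Definition in_Lpq (w : R -> R) (p q : R) (f : R[i] -> R[i]) : Prop :=
  cmeasurable_disc f /\ (norm_pq w p q f < +oo)%E.

Definition Pplus_bounded (w : R -> R) (p q : R) : Prop :=
  exists C : R, forall f : R[i] -> R[i], in_Lpq w p q f ->
    (forall z : R[i], ComplexField.Normc.normc z < 1 ->
       cintegrable_disc (fun zeta =>
         f zeta * ((ComplexField.Normc.normc (Bker w z zeta))%:C)%C * ((w (ComplexField.Normc.normc zeta))%:C)%C)) /\
    in_Lpq w p q (Pplus w f) /\
    (norm_pq w p q (Pplus w f) <= C%:E * norm_pq w p q f)%E.

End Defs.

(* Main.v *)
(** Let [H] be the tail integral of [w] and [k r] the integral of [|B_1(r e^{it})|]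
    over a period; the statement is about the size of [k].  The doubling
    condition makes the coefficients [1 / (2 w_{2n+1})] of the kernel slowly varying
    and comparable to [1 / H(1 - 1/n)].  By summation by parts, Parseval and
    Cauchy-Schwarz, [k s - k t <= C / H s] whenever [s - t <= L (1 - s)]; under the
    reverse doubling condition these increments grow geometrically along
    [1 - r = K^{-j}], so [k <= D / H].  Two Schur tests then bound the projection:
    one in the disc with exponent [p] and a radial test function slightly larger
    than the means [M_p(f, s)], and one in the radius with exponent [q] and test
    function [H^{-1/q}].

    Conversely, Hardy's inequality gives [k r >= 2 sum_n a_n r^n / n] for the
    coefficients [a_n] of the kernel.  Testing boundedness on the indicator function
    of the ring [a <= |z|] yields [(sum_n a_n a^{2n} / n) H a <= C].  If
    [1 - a = (1 - r) / 2^{j+3}] and [N] is about [1 / (1 - r)], the block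
    [N <= n < 2^j N] contributes a multiple of [j / H r] to this sum, so
    [H a <= H r / 2] once [j] is large. *)

Require Import Defs.
From HB Require Import structures.
From mathcomp Require Import all_boot all_order all_algebra.
From mathcomp Require Import all_classical all_reals all_analysis.
From mathcomp Require Import complex.
From mathcomp Require Import measurable_realfun ring lra.

Set Implicit Arguments.
Unset Strict Implicit.
Unset Printing Implicit Defensive.

Import Order.TTheory GRing.Theory Num.Theory.
Import numFieldTopology.Exports numFieldNormedType.Exports.

Local Open Scope classical_set_scope.
Local Open Scope ring_scope.

(** The weight may vanish on whole intervals, so nothing is compared with [w] pointwise: every
    estimate goes through [H], the moments, or the sets where [H] lies below a level.

    Increments of [k] are used because their coefficients have the right shape: after multiplication
    by [1 - s e^{it}], the difference of the kernels at radii [r <= s] has coefficients carrying a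
    factor [s - r], exactly the smallness that pays for the [L^2] norm of [1 / (1 - s e^{it})].
    Under doubling alone these increments may add up to much more than [1 / H].

    As [p] and [q] may differ, one Schur test cannot serve both variables. A radial test function in
    the disc makes the angle enter only through [k (r s) <= D / max (H r, H s)], which leaves an
    operator on [[0, 1[]. There [H^{-1/q}] leads to the exponents [1/q] and [1 - 1/q], both inside
    []0, 1[], so that sums over dyadic levels of [H] converge in both directions.

    In the converse the test function takes only the values 0 and 1, so its norm does not see [p],
    and the power [1/q] of the mass of the ring cancels. *)

Lemma sum_geometric_le (R : realFieldType) (x : R) n :
  0 <= x < 1 -> \sum_(k < n) x ^+ k <= (1 - x)^-1.
Proof.
move=> /andP[x0 x1]; rewrite -[leRHS]mul1r ler_pdivlMr ?subr_gt0// mulrC.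
have := subrX1 x n; rewrite -opprB -[1 - x]opprB mulNr => <-.
by rewrite opprK gerBl exprn_ge0.
Qed.

Lemma measurable_fun_invr d (T : measurableType d) (R : realType) (f : T -> R) :
    measurable_fun setT f -> (forall x, 0 < f x) ->
  measurable_fun setT (fun x => (f x)^-1).
Proof.
move=> mf f0; rewrite (_ : (fun x => _) = fun x => f x `^ -1).
  exact: (measurableT_comp (measurable_powR _)).
by apply/funext => x; rewrite powR_inv1// ltW.
Qed.

(** * Integration in polar coordinates *)

Section density.
Local Open Scope ereal_scope.
Context d (T : measurableType d) (R : realType).
Variables (mu : {measure set T -> \bar R}) (h : T -> R).

(** Measurability and nonnegativity of [h] are arguments so that the measure structure can be
    attached to this term. *)
Definition mdensity of measurable_fun setT h & (forall x, 0 <= h x)%R :=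
  fun A : set T => \int[mu]_(x in A) (h x)%:E.
Hypothesis (mh : measurable_fun setT h) (h0 : forall x, (0 <= h x)%R).
Local Notation nu := (mdensity mh h0).

Let density0 : nu set0 = 0. Proof. exact: integral_set0. Qed.
Let density_ge0 A : 0 <= nu A.
Proof. by apply: integral_ge0 => x _; rewrite lee_fin. Qed.
Let density_sigma_additive : semi_sigma_additive nu.
Proof.
move=> /= F mF tF mUF; apply: cvg_toP.
  apply: ereal_nondecreasing_is_cvgn => m n mn.
  by apply: lee_sum_nneg_natr => // k _ _; exact: density_ge0.
rewrite /mdensity ge0_integral_bigcup//; first exact/measurable_EFinP/measurable_funTS.
by move=> x _; rewrite lee_fin.
Qed.

HB.instance Definition _ := isMeasure.Build _ _ _ nu
  density0 density_ge0 density_sigma_additive.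

Import HBNNSimple.

(** For a simple function the identity is linearity together with the definition of [nu] on level
    sets; monotone convergence along simple approximations of [f] handles both sides. *)
Lemma ge0_integral_density (f : T -> \bar R) :
  measurable_fun setT f -> (forall x, 0 <= f x) ->
  \int[nu]_x f x = \int[mu]_x (f x * (h x)%:E).
Proof.
move=> mf f0; pose g := nnsfun_approx measurableT mf.
have cg x : EFin \o (g ^~ x) @ \oo --> f x by exact: cvg_nnsfun_approx.
have mEh : measurable_fun setT (EFin \o h) by exact/measurable_EFinP.
transitivity (limn (fun n => \int[nu]_x (g n x)%:E)).
  rewrite -monotone_convergence//.
  - by apply: eq_integral => y _; apply/esym/cvg_lim => //; exact: cg.
  - by move=> n; exact/measurable_EFinP/measurable_funP.
  - by move=> n y _; rewrite lee_fin.
  - by move=> y _ m n mn; rewrite lee_fin; exact/lefP/nd_nnsfun_approx.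
transitivity (limn (fun n => \int[mu]_x ((g n x)%:E * (h x)%:E))); last first.
  rewrite -monotone_convergence//.
  - by apply: eq_integral => y _; apply/cvg_lim => //; apply: cvgeZr => //; exact: cg.
  - by move=> n; apply: emeasurable_funM => //; exact/measurable_EFinP/measurable_funP.
  - by move=> n y _; rewrite mule_ge0 ?lee_fin.
  - by move=> y _ m n mn; rewrite lee_wpmul2r ?lee_fin//; exact/lefP/nd_nnsfun_approx.
congr (limn _); apply/funext => n.
under [LHS]eq_integral do rewrite fimfunE -fsumEFin//.
rewrite [LHS]ge0_integral_fsum//; last 2 first.
  - by move=> r; exact/measurable_EFinP/measurableT_comp.
  - by move=> r x _; rewrite nnfun_muleindic_ge0.
under [RHS]eq_integral.
  move=> x xD; rewrite fimfunE -fsumEFin// ge0_mule_fsuml; last first.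
    by move=> r; rewrite EFinM nnfun_muleindic_ge0.
  over.
rewrite [RHS]ge0_integral_fsum//; last 2 first.
  - by move=> r; apply: emeasurable_funM => //; apply/measurable_EFinP; exact/measurableT_comp.
  - move=> r x _; apply: mule_ge0; last by rewrite lee_fin.
    by rewrite EFinM nnfun_muleindic_ge0.
apply: eq_fsbigr => r rg.
have r0 : (0 <= r)%R by move: rg; rewrite inE => -[t _ <-].
rewrite integralZl_indic_nnsfun// integral_indic//=.
under [RHS]eq_integral do rewrite EFinM -muleA.
rewrite ge0_integralZl//; last 2 first.
  - apply: emeasurable_funM => //; exact/measurable_EFinP/measurable_indic.
  - by move=> x _; rewrite mule_ge0 ?lee_fin.
congr (_ * _); rewrite setIT /mdensity integral_mkcond; apply: eq_integral => x _.
by rewrite muleC epatch_indic.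
Qed.
End density.

(** * Substitutions on the real line *)

Section change_of_variables_line.
Local Open Scope ereal_scope.
Context {R : realType}.
Local Notation mu := (@lebesgue_measure R).

Lemma integral_cst_EFin (D : set R) (c : R) : measurable D ->
  \int[mu]_(x in D) (cst c x)%:E = c%:E * mu D.
Proof. by move=> mD; rewrite -integral_cst. Qed.

(** The interval hypothesis says that the image under [phi] of the measure with density [h] agrees
    with Lebesgue measure on half-open intervals, hence everywhere. Since [h] may vanish, [phi] can
    encode a substitution that lives on an interval only. *)
Lemma ge0_integral_cov (phi h : R -> R) (f : R -> \bar R) :
    measurable_fun setT phi -> measurable_fun setT h -> (forall x, 0 <= h x)%R ->
    (forall a b : R, (a < b)%R ->
       \int[mu]_(x in phi @^-1` `]a, b]) (h x)%:E = (b - a)%:E) ->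
    measurable_fun setT f -> (forall x, 0 <= f x) ->
  \int[mu]_x f x = \int[mu]_x (f (phi x) * (h x)%:E).
Proof.
move=> mphi mh h0 hab mf f0.
have mphi' : measurable_fun setT (phi : R -> measurableTypeR R) by [].
pose nu := pushforward (mdensity mu mh h0) (phi : R -> measurableTypeR R).
transitivity (\int[nu]_x f x).
  apply: eq_measure_integral => A mA _ /=.
  apply: lebesgue_measure_unique => // _ [[a b]] /= _ <-.
  rewrite lebesgue_measure_itv/= lte_fin; case: ltP => [ab|ba].
    by rewrite /nu /pushforward/= /mdensity hab.
  by rewrite set_itv_ge ?measure0// -leNgt.
rewrite /nu ge0_integral_pushforward//=.
by rewrite preimage_setT ge0_integral_density//; exact: measurableT_comp.
Qed.

Lemma ge0_integral_shift (c : R) (f : R -> \bar R) :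
    measurable_fun setT f -> (forall x, 0 <= f x) ->
  \int[mu]_x f x = \int[mu]_x f (x + c)%R.
Proof.
move=> mf f0.
rewrite (@ge0_integral_cov (fun x => x + c)%R (cst 1%R))//.
- by apply: eq_integral => x _; rewrite mule1.
- exact: measurable_funD.
- move=> a b ab.
  rewrite (_ : _ @^-1` _ = `]a - c, b - c]%classic)%R.
    rewrite integral_cst_EFin// mul1e; rewrite lebesgue_measure_itv/= lte_fin ltrD2r ab.
    by rewrite -EFinB; congr (_%:E); ring.
  by apply/seteqP; split => x /=; rewrite !in_itv/= ltrBlDr lerBrDr.
Qed.

Lemma ge0_integral_scale (c : R) (f : R -> \bar R) : (0 < c)%R ->
    measurable_fun setT f -> (forall x, 0 <= f x) ->
  \int[mu]_x f x = \int[mu]_x (f (x * c)%R * c%:E).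
Proof.
move=> c0 mf f0.
rewrite (@ge0_integral_cov (fun x => x * c)%R (cst c))//.
- exact: measurable_funM.
- by move=> x; rewrite ltW.
- move=> a b ab.
  rewrite (_ : _ @^-1` _ = `]a / c, b / c]%classic)%R.
    rewrite integral_cst_EFin// lebesgue_measure_itv/= lte_fin ltr_pM2r ?invr_gt0// ab.
    by rewrite -EFinB -EFinM; congr (_%:E); field; rewrite gt_eqF.
  by apply/seteqP; split => x /=; rewrite !in_itv/= ltr_pdivrMr// ler_pdivlMr.
Qed.

Lemma ge0_integral_opp (f : R -> \bar R) :
    measurable_fun setT f -> (forall x, 0 <= f x) ->
  \int[mu]_x f x = \int[mu]_x f (- x)%R.
Proof.
move=> mf f0.
rewrite (@ge0_integral_cov -%R (cst 1%R))//.
- by apply: eq_integral => x _; rewrite mule1.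
- move=> a b ab; rewrite opp_preimage_itvbndbnd/= integral_cst_EFin// mul1e.
  by rewrite lebesgue_measure_itv/= lte_fin ltrN2 ab -EFinB opprK addrC.
Qed.
End change_of_variables_line.

Section periodic.
Local Open Scope ereal_scope.
Context {R : realType}.
Local Notation mu := (@lebesgue_measure R).

Lemma ge0_integral_itv_shift (a b c : R) (f : R -> \bar R) :
    measurable_fun setT f -> (forall x, 0 <= f x) ->
  \int[mu]_(x in `[a, b[) f (x + c)%R = \int[mu]_(x in `[(a + c)%R, (b + c)%R[) f x.
Proof.
move=> mf f0; rewrite [RHS]integral_mkcond (ge0_integral_shift c)//.
- rewrite [LHS]integral_mkcond; apply: eq_integral => x _.
  by rewrite !patchE !mem_setE !in_itv/= lerD2r ltrD2r.
- by apply/(measurable_restrictT _ _).1 => //; exact: measurable_funS mf.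
- by move=> x; rewrite patchE; case: ifP.
Qed.

Lemma ge0_integral_itv_splitU (x y z : itv_bound R) (f : R -> \bar R) :
    (x <= y)%O -> (y <= z)%O -> measurable_fun setT f -> (forall x, 0 <= f x) ->
  \int[mu]_(t in [set` Interval x z]) f t =
  \int[mu]_(t in [set` Interval x y]) f t + \int[mu]_(t in [set` Interval y z]) f t.
Proof.
move=> xy yz mf f0; rewrite (itv_bndbnd_setU xy yz) ge0_integral_setU//.
  exact: measurable_funS mf.
apply/disj_setPS => t [] /=; rewrite !itv_boundlr => /andP[_ ty] /andP[yt _].
by have := le_trans ty yt; rewrite bnd_simp ltxx.
Qed.

(** The window [[a, a + T[] is cut at [T] and its second piece is moved back by one period. *)
Lemma ge0_integral_periodic (T a : R) (f : R -> \bar R) :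
    (0 <= a <= T)%R -> measurable_fun setT f -> (forall x, 0 <= f x) ->
    (forall x, f (x + T)%R = f x) ->
  \int[mu]_(x in `[0%R, T[) f (x + a)%R = \int[mu]_(x in `[0%R, T[) f x.
Proof.
move=> /andP[a0 aT] mf f0 fT.
rewrite ge0_integral_itv_shift// add0r.
rewrite (@ge0_integral_itv_splitU (BLeft a) (BLeft T))// ?bnd_simp ?lerDl//.
rewrite [RHS](@ge0_integral_itv_splitU _ (BLeft a))// ?bnd_simp//; rewrite [RHS]addeC; congr (_ + _).
rewrite (_ : `[T, (T + a)%R[ = `[(0 + T)%R, (a + T)%R[)%classic; last first.
  by rewrite add0r (addrC a).
rewrite -ge0_integral_itv_shift//.
by apply: eq_integral => x _; rewrite fT.
Qed.
End periodic.

Section polar.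
Local Open Scope ereal_scope.
Context {R : realType}.
Local Notation mu := (@lebesgue_measure R).
Implicit Types (a b x t : R).

Lemma integral_is_derive (F f : R -> R) a b : (a <= b)%R ->
    (forall x, (a <= x <= b)%R -> is_derive x 1%R F (f x)) ->
    (forall x, (a <= x <= b)%R -> {for x, continuous f}) ->
  \int[mu]_(x in `[a, b]) (f x)%:E = (F b - F a)%:E.
Proof.
rewrite le_eqVlt => /predU1P[<- _ _|ab dF cf].
  by rewrite set_itv1 integral_set1 subrr.
have cF x : (a <= x <= b)%R -> {for x, continuous F}.
  by move=> /dF dFx; apply: differentiable_continuous; apply/derivable1_diffP; exact: ex_derive.
rewrite EFinB; apply: continuous_FTC2 => //.
- apply: continuous_in_subspaceT => x; rewrite inE/= in_itv/= => xab; exact: cf.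
- split.
  + by move=> x; rewrite in_itv/= => /andP[ax xb]; apply: (@ex_derive _ _ _ _ _ _ (f x)); apply: dF; rewrite !ltW.
  + by apply: cvg_at_right_filter; apply: cF; rewrite lexx ltW.
  + by apply: cvg_at_left_filter; apply: cF; rewrite lexx ltW.
- move=> x; rewrite in_itv/= => /andP[ax xb]; rewrite derive1E.
  by apply: (@derive_val _ _ _ _ _ _ _ (dF _ _)); rewrite !ltW.
Qed.

Local Notation I := (`](- (pi / 2))%R, (pi / 2)%R[%classic : set R).

Lemma cos_gt0_itv t : I t -> (0 < cos t)%R.
Proof. by rewrite /= => tI; exact: cos_gt0_pihalf. Qed.

Lemma atan_itv y : I (atan y).
Proof. by rewrite /= in_itv/= atan_gtNpi2 atan_ltpi2. Qed.

Lemma lt_tan_atan y t : I t -> (y < tan t)%R = (atan y < t)%R.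
Proof.
by move=> tI; rewrite -{1}(atanK y) ltr_tan//; exact: (atan_itv y).
Qed.

(** Set to 0 off [I] to be measurable on the whole line, as the substitution lemma requires. *)
Definition tanI : R -> R := (@tan R) \_ I.

Lemma measurable_tanI : measurable_fun setT tanI.
Proof.
apply/(measurable_restrictT _ _).1 => //.
apply: open_continuous_measurable_fun; first exact: interval_open.
move=> t /[!inE] tI; apply: continuous_tan; rewrite gt_eqF//.
exact: cos_gt0_itv.
Qed.

(** On [I] the density is the derivative of [x * tan t], and the preimage of []a, b]] runs from
    [atan (a / x)] to [atan (b / x)]. Off [I] the value 0 of [tanI] may fall in []a, b]], but the
    density vanishes there. *)
Lemma ge0_integral_tan x (f : R -> \bar R) : (0 < x)%R ->
    measurable_fun setT f -> (forall y, 0 <= f y) ->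
  \int[mu]_y f y =
  \int[mu]_t (f (x * tanI t)%R * (\1_I t * (x * (1 + tanI t ^+ 2)))%:E).
Proof.
move=> x0 mf f0.
have mh : measurable_fun setT (fun t => \1_I t * (x * (1 + tanI t ^+ 2)))%R.
  apply: measurable_funM; first exact: measurable_indic.
  apply: measurable_funM => //; apply: measurable_funD => //.
  by apply: measurable_funX; exact: measurable_tanI.
rewrite (@ge0_integral_cov _ (fun t => x * tanI t)%R (fun t => \1_I t * (x * (1 + tanI t ^+ 2)))%R)//.
- by apply: measurable_funM => //; exact: measurable_tanI.
- by move=> t; rewrite mulr_ge0 ?indicE// mulr_ge0 ?ltW// ltr_wpDr ?sqr_ge0.
move=> a b ab.
transitivity (\int[mu]_(t in `]atan (a / x)%R, atan (b / x)%R]) (x * (1 + tanI t ^+ 2))%:E).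
  rewrite integral_mkcond [RHS]integral_mkcond; apply: eq_integral => t _.
  rewrite !patchE; case: (pselect (I t)) => tI; last first.
    have -> : (\1_I (t : R) = 0 :> R)%R by rewrite indicE memNset.
    rewrite mul0r if_same ifN//.
    apply/negP; rewrite inE/= in_itv/= => /andP[h1 h2]; apply: tI.
    rewrite /= in_itv/= (lt_trans (atan_gtNpi2 _) h1)/=.
    exact: le_lt_trans h2 (atan_ltpi2 _).
  have ct := cos_gt0_itv tI.
  have -> : (\1_I (t : R) = 1 :> R)%R by rewrite indicE mem_set.
  rewrite mul1r.
  have -> : (t \in (fun t0 => (x * tanI t0)%R) @^-1` `]a, b]) =
      (x * tanI t \in `]a, b]%R)%R.
    by apply/idP/idP => [/set_mem//|h]; exact/mem_set.
  have -> : tanI (t : R) = tan (t : R) by rewrite /tanI patchE mem_set.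
  rewrite [in RHS]mem_setE !in_itv/=.
  rewrite mulrC -ltr_pdivrMr// -ler_pdivlMr//.
  by rewrite !(lt_tan_atan _ tI) leNgt (lt_tan_atan _ tI) -leNgt.
rewrite integral_itv_obnd_cbnd; last first.
  apply/measurable_EFinP/measurable_funTS; apply: measurable_funM => //.
  by apply: measurable_funD => //; apply: measurable_funX; exact: measurable_tanI.
have II t : (atan (a / x) <= t <= atan (b / x))%R -> I t.
  move=> /andP[h1 h2]; rewrite /= in_itv/= (lt_le_trans (atan_gtNpi2 _) h1)/=.
  exact: le_lt_trans h2 (atan_ltpi2 _).
have cI t : (atan (a / x) <= t <= atan (b / x))%R -> (cos t != 0)%R.
  by move=> /II/cos_gt0_itv ?; rewrite gt_eqF.
transitivity (\int[mu]_(t in `[atan (a / x)%R, atan (b / x)%R]) (x * (cos t) ^- 2)%:E).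
  apply: eq_integral => t; rewrite inE/= in_itv/= => tab.
  by rewrite /tanI patchE mem_set ?cos2_tan2 ?cI//; exact: II.
transitivity (x * tan (atan (b / x)) - x * tan (atan (a / x)))%:E; last first.
  by rewrite !atanK; congr (_%:E); field; rewrite gt_eqF.
apply: (integral_is_derive (F := fun t => x * tan t)%R).
- by rewrite ltW// lt_atan// ltr_pM2r ?invr_gt0.
- move=> t /cI ct; have dt := is_derive_tan ct.
  exact: (@is_deriveZ R R R tan x t 1%R _ dt).
- move=> t /cI ct; apply: cvgM; first exact: cvg_cst.
  apply: cvgV; first by rewrite expf_neq0.
  by apply: (@continuous_comp _ _ _ cos (fun u => u ^+ 2)%R); [exact: continuous_cos|exact: exprn_continuous].
Qed.

Lemma tonelli_lebesgue (F : R * R -> \bar R) :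
    measurable_fun setT F -> (forall z, 0 <= F z) ->
  \int[mu]_x \int[mu]_y F (x, y) = \int[mu]_y \int[mu]_x F (x, y).
Proof. by move=> mF F0; exact: (fubini_tonelli (m1 := mu) (m2 := mu)). Qed.

Local Notation pos := (`]0%R, +oo[%classic : set R).

(* Substituting [y = x tan t] for fixed [x], then [x = r cos t] for fixed [t], keeps
   every change of variables one-dimensional. *)
Lemma ge0_polar_right (g : R * R -> \bar R) :
    measurable_fun setT g -> (forall z, 0 <= g z) ->
  \int[mu]_(x in pos) \int[mu]_y g (x, y) =
  \int[mu]_(r in pos) \int[mu]_(t in I) (g (r * cos t, r * sin t)%R * r%:E).
Proof.
move=> mg g0.
pose F (z : R * R) := g (z.1, z.1 * tanI z.2)%R *
  (\1_pos z.1 * (\1_I z.2 * (z.1 * (1 + tanI z.2 ^+ 2))))%:E.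
pose G (z : R * R) := g (z.1 * cos z.2, z.1 * sin z.2)%R *
  (\1_pos z.1 * (\1_I z.2 * z.1))%:E.
have mtan2 : measurable_fun setT (fun z : R * R => tanI z.2).
  by apply: measurableT_comp => //; exact: measurable_tanI.
have mpos1 : measurable_fun setT (fun z : R * R => \1_pos z.1 : R).
  have m1 : measurable_fun setT (\1_pos : R -> R) by exact: measurable_indic.
  exact: (measurableT_comp m1).
have mI2 : measurable_fun setT (fun z : R * R => \1_I z.2 : R).
  have m1 : measurable_fun setT (\1_I : R -> R) by exact: measurable_indic.
  exact: (measurableT_comp m1).
have mF : measurable_fun setT F.
  apply: emeasurable_funM.
    apply: measurableT_comp => //; apply: measurable_fun_pair => //.
    exact: measurable_funM.
  apply/measurable_EFinP; apply: measurable_funM => //; apply: measurable_funM => //.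
  by apply: measurable_funM => //; apply: measurable_funD => //; exact: measurable_funX.
have mcos : measurable_fun setT (fun z : R * R => cos z.2).
  by apply: measurableT_comp => //; apply: continuous_measurable_fun; exact: continuous_cos.
have msin : measurable_fun setT (fun z : R * R => sin z.2).
  by apply: measurableT_comp => //; apply: continuous_measurable_fun; exact: continuous_sin.
have mG : measurable_fun setT G.
  apply: emeasurable_funM.
    apply: measurableT_comp => //; apply: measurable_fun_pair; exact: measurable_funM.
  by apply/measurable_EFinP; apply: measurable_funM => //; apply: measurable_funM => //.
have posE x : (\1_pos x * x >= 0 :> R)%R.
  rewrite indicE; have [|] := boolP (x \in pos); last by rewrite mul0r.
  by rewrite inE/= in_itv/= andbT mul1r => /ltW.
have F0 z : 0 <= F z.
  rewrite mule_ge0// lee_fin mulrCA mulr_ge0 ?indicE//= mulrA mulr_ge0 ?posE//.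
  by rewrite addr_ge0 ?sqr_ge0.
have G0 z : 0 <= G z.
  by rewrite mule_ge0// lee_fin mulrCA; apply: mulr_ge0 => //; rewrite indicE.
transitivity (\int[mu]_x \int[mu]_t F (x, t)).
  rewrite integral_mkcond; apply: eq_integral => x _; rewrite patchE.
  case: ifPn => xpos; rewrite /F/= indicE ?xpos ?(negbTE xpos).
    rewrite (@ge0_integral_tan x)//.
    - by apply: eq_integral => t _; rewrite mul1r.
    - by move: xpos; rewrite inE/= in_itv/= andbT.
    - by apply: measurableT_comp => //; exact: pair1_measurable.
  by rewrite integral0_eq// => t _; rewrite mul0r mule0.
rewrite (tonelli_lebesgue mF F0).
transitivity (\int[mu]_t \int[mu]_r G (r, t)).
  apply: eq_integral => t _; rewrite /F /G/=.
  have [tI|tI] := boolP ((t : R) \in I); last first.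
    rewrite !integral0_eq// => x _; rewrite [\1_I _]indicE (negbTE tI).
      by rewrite mul0r mulr0 mule0.
    by rewrite mul0r mulr0 mule0.
  have ct : (0 < cos (t : R))%R by apply: cos_gt0_itv; exact: set_mem.
  rewrite (ge0_integral_scale ct) => [||x].
  - apply: eq_integral => r _ ; rewrite -muleA -EFinM.
    have -> : tanI (t : R) = (sin (t : R) / cos (t : R))%R by rewrite /tanI patchE tI.
    have -> : (\1_pos (r * cos (t : R)) = \1_pos (r : R) :> R)%R.
      by rewrite !indicE !mem_setE !in_itv/= !andbT pmulr_lgt0.
    have ctN : cos (t : R) != 0%R by rewrite gt_eqF.
    congr (g (_, _) * _%:E); first by field.
    transitivity (\1_pos (r : R) * (\1_I (t : R) *
        (r * (cos (t : R) ^+ 2 + sin (t : R) ^+ 2))))%R; first by field.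
    by rewrite cos2Dsin2 mulr1.
  - exact: (measurableT_comp mF (pair2_measurable t)).
  - exact: F0 (x, t).
rewrite -(tonelli_lebesgue mG G0); apply/esym.
rewrite integral_mkcond; apply: eq_integral => r _; rewrite patchE.
case: ifPn => rpos; rewrite /G/= indicE ?rpos ?(negbTE rpos); last first.
  by rewrite integral0_eq// => t _; rewrite mul0r mule0.
rewrite integral_mkcond; apply: eq_integral => t _; rewrite patchE indicE.
by case: ifPn => tI; rewrite mul1r ?mul1r ?mul0r ?mule0.
Qed.

Lemma ge0_integral_negpos (f : R -> \bar R) :
    measurable_fun setT f -> (forall x, 0 <= f x) ->
  \int[mu]_x f x = \int[mu]_(x in pos) f x + \int[mu]_(x in pos) f (- x)%R.
Proof.
move=> mf f0; rewrite -set_itvNyy.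
rewrite (@ge0_integral_itv_splitU _ _ (BRight 0%R))// addeC; congr (_ + _).
rewrite -integral_itv_bndo_bndc; last exact: measurable_funTS.
rewrite [LHS]integral_mkcond (ge0_integral_opp); last 2 first.
- by apply/(measurable_restrictT _ _).1 => //; exact: measurable_funTS.
- by move=> x; rewrite patchE; case: ifP.
rewrite [RHS]integral_mkcond; apply: eq_integral => x _; rewrite !patchE.
by rewrite !mem_setE !in_itv/= andbT oppr_lt0.
Qed.

Lemma measurable_int_section (A : set R) (F : R * R -> \bar R) :
    measurable A -> measurable_fun setT F -> (forall z, 0 <= F z) ->
  measurable_fun setT (fun x => \int[mu]_(y in A) F (x, y)).
Proof.
move=> mA mF F0; pose F' := F \_ (setT `*` A).
have mF' : measurable_fun setT F'.
  apply/(measurable_restrictT _ _).1; last exact: measurable_funTS.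
  exact: measurableX.
have F'0 z : 0 <= F' z by rewrite /F' patchE; case: ifP.
rewrite (_ : (fun x => _) = fubini_F mu F'); first exact: measurable_fun_fubini_tonelli_F.
apply/funext => x; rewrite integral_mkcond; apply: eq_integral => y _.
rewrite !patchE; have [yA|yA] := boolP (y \in A).
  by rewrite /F' patchE mem_set//; split=> //; exact: set_mem.
by rewrite /F' patchE memNset// => -[_ /mem_set]; exact/negP.
Qed.

(** The second integral is over the half-turn centred at [pi]; together the two cover the period
    that starts at [- pi / 2]. *)
Lemma ge0_integral_halfturns (Q : R -> \bar R) :
    measurable_fun setT Q -> (forall t, 0 <= Q t) ->
    (forall t, Q (t + 2 * pi)%R = Q t) ->
  \int[mu]_(t in I) Q t + \int[mu]_(t in I) Q (t + pi)%R =
  \int[mu]_(t in `[0%R, (2 * pi)%R[) Q t.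
Proof.
move=> mQ Q0 QT; have pi0 : (0 < pi :> R)%R := pi_gt0 R.
have mQpi : measurable_fun setT (fun t => Q (t + pi)%R).
  by apply: measurableT_comp => //; exact: measurable_funD.
rewrite !integral_itv_obnd_cbnd; [|exact: measurable_funTS..].
rewrite ge0_integral_itv_shift//.
have -> : (- (pi / 2) + pi = pi / 2 :> R)%R by lra.
rewrite -(@ge0_integral_itv_splitU _ _ (BLeft (pi / 2)%R)) ?bnd_simp//; [|lra..].
rewrite (_ : `[- (pi / 2), pi / 2 + pi[ =
    `[0 + - (pi / 2), 2 * pi + - (pi / 2)[)%R%classic; last first.
  have -> : (pi / 2 + pi = 2 * pi - pi / 2 :> R)%R by lra.
  by rewrite sub0r.
rewrite -ge0_integral_itv_shift//.
(* The periodicity lemma takes shifts between 0 and one period, so the shift by [- pi / 2] is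
   realised as [3 / 2 * pi] minus a full period. *)
rewrite -(@ge0_integral_periodic _ (2 * pi) (3 / 2 * pi) Q)//; last lra.
apply: eq_integral => t _; rewrite -QT; congr Q; lra.
Qed.

(** The half-plane [x < 0] is the image of [x > 0] under [z -> - z], which adds [pi] to the angle;
    the two half-turns then fill one period. *)
Lemma ge0_polar (g : R * R -> \bar R) :
    measurable_fun setT g -> (forall z, 0 <= g z) ->
  \int[(mu \x mu)%E]_z g z =
  \int[mu]_(r in pos) \int[mu]_(t in `[0%R, (2 * pi)%R[)
     (g (r * cos t, r * sin t)%R * r%:E).
Proof.
move=> mg g0.
pose g' (z : R * R) := g (- z.1, - z.2)%R.
have mg' : measurable_fun setT g'.
  by apply: measurableT_comp => //; apply: measurable_fun_pair; exact: measurableT_comp.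
have g'0 z : 0 <= g' z by exact: g0.
have mgx x : measurable_fun setT (fun y => g (x, y)).
  exact: (measurableT_comp mg (pair1_measurable x)).
transitivity (\int[mu]_x \int[mu]_y g (x, y)).
  exact: (fubini_tonelli1 (m1 := mu) (m2 := mu) g mg g0).
rewrite ge0_integral_negpos; last 2 first.
- exact: (measurable_fun_fubini_tonelli_F (m2 := mu)).
- by move=> x; exact: integral_ge0.
rewrite (ge0_polar_right mg g0).
transitivity (\int[mu]_(r in pos) \int[mu]_(t in I) (g (r * cos t, r * sin t)%R * r%:E) +
  \int[mu]_(r in pos) \int[mu]_(t in I) (g' (r * cos t, r * sin t)%R * r%:E)).
  congr (_ + _); rewrite -(ge0_polar_right mg' g'0).
  apply: eq_integral => x _; exact: (ge0_integral_opp (mgx (- (x : R))%R) (fun y => g0 (_, y))).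
(* The Jacobian is written with an absolute value to make [P] nonnegative on the whole plane; it is
   [r] on the range of integration. *)
pose P (z : R * R) := g (z.1 * cos z.2, z.1 * sin z.2)%R * (`|z.1|%R)%:E.
have mcos : measurable_fun setT (fun z : R * R => cos z.2).
  by apply: measurableT_comp => //; apply: continuous_measurable_fun; exact: continuous_cos.
have msin : measurable_fun setT (fun z : R * R => sin z.2).
  by apply: measurableT_comp => //; apply: continuous_measurable_fun; exact: continuous_sin.
have mP : measurable_fun setT P.
  apply: emeasurable_funM.
    apply: measurableT_comp => //; apply: measurable_fun_pair; exact: measurable_funM.
  by apply/measurable_EFinP; exact: measurableT_comp.
have P0 z : 0 <= P z by rewrite mule_ge0.
have PE (r t : R) : (0 < r)%R -> P (r, t) = g (r * cos t, r * sin t)%R * r%:E.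
  by move=> r0; rewrite /P [fst _]/= (gtr0_norm r0).
pose P' (z : R * R) := P (z.1, z.2 + pi)%R.
have mP' : measurable_fun setT P'.
  apply: measurableT_comp => //; apply: measurable_fun_pair => //.
  exact: measurable_funD.
transitivity (\int[mu]_(r in pos) \int[mu]_(t in I) P (r, t) +
  \int[mu]_(r in pos) \int[mu]_(t in I) P' (r, t)).
  apply: (f_equal2 adde); apply: eq_integral => r;
    rewrite inE/= in_itv/= andbT => r0; apply: eq_integral => t _.
    by rewrite PE.
  rewrite [RHS](PE _ (t + pi)%R r0) cosDpi sinDpi !mulrN /g'/=; exact: erefl.
have int0 (F : R * R -> \bar R) : (forall z, 0 <= F z) ->
    forall r, pos r -> 0 <= \int[mu]_(t in I) F (r, t).
  by move=> F0 r _; exact: integral_ge0.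
have mint (F : R * R -> \bar R) : measurable_fun setT F -> (forall z, 0 <= F z) ->
    measurable_fun pos (fun r => \int[mu]_(t in I) F (r, t)).
  by move=> mF F0; apply: measurable_funTS; exact: measurable_int_section.
have P'0 z : 0 <= P' z by exact: P0.
rewrite -(@ge0_integralD _ _ _ mu pos (measurable_itv _) _ _ (int0 P P0)
  (mint P mP P0) (int0 P' P'0) (mint P' mP' P'0)).
apply: eq_integral => r; rewrite inE/= in_itv/= andbT => r0.
rewrite (ge0_integral_halfturns (Q := fun t => P (r, t))).
- by apply: eq_integral => t _; rewrite PE.
- exact: (measurableT_comp mP (pair1_measurable r)).
- by move=> t; exact: P0.
- by move=> t; rewrite !PE// mulr_natl cosD2pi sinD2pi.
Qed.
End polar.

(** * Moments of radial weights *)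

Section weight.
Context {R : realType}.
Local Notation mu := (@lebesgue_measure R).
Variable w : R -> R.
Implicit Types (r s : R) (n k l : nat).
Hypothesis rw : radial_weight w.
Local Notation J := (`[0%R, 1%R[%classic : set R).
Local Notation H := (omega_hat w).
Local Notation m := (moment w).

Lemma weight_ge0 r : J r -> 0 <= w r.
Proof. by rewrite /= in_itv/=; case: rw => + _; exact. Qed.

Lemma measurable_weight : measurable_fun J w.
Proof.
by apply/measurable_EFinP; case: rw => _ [/integrableP[]].
Qed.

Lemma itv_sub_unit r : 0 <= r -> `[r, 1%R[ `<=` J.
Proof.
by move=> r0 s /=; rewrite !in_itv/= => /andP[rs ->]; rewrite (le_trans r0 rs).
Qed.

Lemma measurable_weight_itv r : 0 <= r ->
  measurable_fun (`[r, 1%R[%classic : set R) (fun s : R => (w s)%:E).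
Proof.
move=> r0; apply: (measurable_funS _ (itv_sub_unit r0)) => //.
by apply/measurable_EFinP; exact: measurable_weight.
Qed.

Lemma integrable_pow_weight n :
  mu.-integrable J (fun s => (s ^+ n * w s)%:E).
Proof.
case: rw => _ [wi _]; apply: (le_integrable _ _ _ wi) => //=.
  apply/measurable_EFinP; apply: measurable_funM; last exact: measurable_weight.
  by apply: measurable_funX.
move=> s; rewrite /= in_itv/= => /andP[s0 s1]; rewrite lee_fin normrM.
by rewrite ler_piMl// normrX exprn_ile1// ?normr_ge0// ger0_norm// ltW.
Qed.

Lemma momentE n : (m n)%:E = (\int[mu]_(s in J) (s ^+ n * w s)%:E)%E.
Proof. by rewrite /moment /Rintegral fineK//; exact: integrable_fin_num (integrable_pow_weight n). Qed.

Lemma omega_hatE r : 0 <= r -> (H r)%:E = (\int[mu]_(s in `[r, 1%R[) (w s)%:E)%E.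
Proof.
move=> r0; rewrite /omega_hat /Rintegral fineK//; apply: integrable_fin_num => //.
case: rw => _ [wi _]; apply: integrableS wi => //; exact: itv_sub_unit.
Qed.

Lemma omega_hat_gt0 r : 0 <= r < 1 -> 0 < H r.
Proof. by case: rw => _ [_]; exact. Qed.

Lemma le_omega_hat r s : 0 <= r -> r <= s -> H s <= H r.
Proof.
move=> r0 rs; rewrite -lee_fin !omega_hatE// ?(le_trans r0 rs)//.
apply: ge0_subset_integral => //.
- exact: measurable_weight_itv.
- by move=> x /(itv_sub_unit r0)/weight_ge0; rewrite lee_fin.
- move=> x /=; rewrite !in_itv/= => /andP[sx ->].
  by rewrite (le_trans rs sx).
Qed.

Lemma pow_omega_hat_le_moment r n : 0 <= r < 1 -> r ^+ n * H r <= m n.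
Proof.
move=> /andP[r0 r1]; rewrite -lee_fin EFinM omega_hatE// momentE.
rewrite -ge0_integralZl//; last 3 first.
- exact: measurable_weight_itv.
- by move=> x /(itv_sub_unit r0)/weight_ge0; rewrite lee_fin.
- by rewrite lee_fin exprn_ge0.
have mJ : measurable_fun J (fun s => (s ^+ n * w s)%:E).
  exact: measurable_int (integrable_pow_weight n).
apply: (@le_trans _ _ (\int[mu]_(x in `[r, 1%R[) (x ^+ n * w x)%:E)%E).
  apply: ge0_le_integral => //.
  - move=> x /(itv_sub_unit r0)/weight_ge0 wx.
    by rewrite -EFinM lee_fin mulr_ge0// exprn_ge0.
  - by apply: measurable_funeM; exact: measurable_weight_itv.
  - by apply: (measurable_funS _ (itv_sub_unit r0)).
  - move=> x xr; have wx := weight_ge0 (itv_sub_unit r0 xr).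
    move: xr; rewrite /= in_itv/= => /andP[rx x1].
    by rewrite -EFinM lee_fin ler_wpM2r// lerXn2r// nnegrE// (le_trans r0).
apply: ge0_subset_integral => //; last exact: itv_sub_unit.
move=> x xJ; have := weight_ge0 xJ; move: xJ; rewrite /= in_itv/= => /andP[x0 _] wx.
by rewrite lee_fin mulr_ge0// exprn_ge0.
Qed.

Lemma moment_gt0 n : 0 < m n.
Proof.
have h : 0 <= (2^-1 : R) < 1 by lra.
apply: lt_le_trans (pow_omega_hat_le_moment n h).
by rewrite mulr_gt0// ?exprn_gt0 ?omega_hat_gt0.
Qed.

Lemma le_moment n k : (n <= k)%N -> m k <= m n.
Proof.
move=> nk; rewrite -lee_fin !momentE; apply: ge0_le_integral => //.
- move=> s sJ; have ws := weight_ge0 sJ; move: sJ; rewrite /= in_itv/= => /andP[s0 _].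
  by rewrite lee_fin mulr_ge0// exprn_ge0.
- exact: measurable_int (integrable_pow_weight _).
- exact: measurable_int (integrable_pow_weight _).
- move=> s sJ; have ws := weight_ge0 sJ; move: sJ; rewrite /= in_itv/= => /andP[s0 s1].
  by rewrite lee_fin ler_wpM2r// ler_wiXn2l// ltW.
Qed.

(** Cut at [r]: the factor [s ^ l] is at most [r ^ l] below [r] and at most 1 above. When [r ^ l] is
    small, the first term can be absorbed. *)
Lemma moment_split r l n : 0 <= r < 1 -> m (l + n)%N <= r ^+ l * m n + H r.
Proof.
move=> /andP[r0 r1]; have rJ := itv_sub_unit r0.
have sub : `[0, r[ `<=` J.
  by move=> s /=; rewrite !in_itv/= => /andP[-> sr]; rewrite (lt_trans sr r1).
have mJ k : measurable_fun J (fun s => (s ^+ k * w s)%:E).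
  exact: measurable_int (integrable_pow_weight k).
have J0 k s : J s -> (0 <= (s ^+ k * w s)%:E)%E.
  move=> sJ; have ws := weight_ge0 sJ; move: sJ; rewrite /= in_itv/= => /andP[s0 _].
  by rewrite lee_fin mulr_ge0// exprn_ge0.
have mw := measurable_weight_itv r0.
rewrite -lee_fin EFinD EFinM momentE (momentE n) omega_hatE//.
have JU : J = `[0, r[ `|` `[r, 1[ :> set R.
  by rewrite -itv_bndbnd_setU// bnd_simp// ltW.
have Jdisj : [disjoint (`[0%R, r[%classic : set R) & `[r, 1%R[].
  apply/disj_setPS => t [] /=; rewrite !in_itv/= => /andP[_ ty] /andP[yt _].
  by have := le_lt_trans yt ty; rewrite ltxx.
rewrite [in X in (X <= _)%E]JU.
rewrite ge0_integral_setU//; last 2 first.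
- by rewrite -JU; exact: mJ.
- by move=> x; rewrite -JU; exact: J0.
apply: leeD; last first.
  apply: ge0_le_integral => //.
  - by move=> x xr; apply: J0; exact: rJ.
  - by apply: measurable_funS (mJ _).
  - move=> s /rJ sJ; have ws := weight_ge0 sJ; move: sJ; rewrite /= in_itv/= => /andP[s0 s1].
    by rewrite lee_fin ler_piMl// exprn_ile1// ltW.
apply: (@le_trans _ _ ((r ^+ l)%:E * \int[mu]_(s in `[0%R, r[) (s ^+ n * w s)%:E)%E).
  rewrite -ge0_integralZl//; last 3 first.
  - by apply: measurable_funS (mJ _).
  - by move=> x /sub; exact: J0.
  - by rewrite lee_fin exprn_ge0.
  apply: ge0_le_integral => //.
  - by move=> x /sub; exact: J0.
  - by apply: measurable_funS (mJ _).
  - by apply: measurable_funeM; apply: measurable_funS (mJ _).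
  - move=> s sr; have := J0 n _ (sub _ sr); move: sr; rewrite /= in_itv/= lee_fin => /andP[s0 sr] ws.
    by rewrite -EFinM lee_fin exprD -mulrA ler_wpM2r// lerXn2r ?nnegrE// ltW.
rewrite lee_wpmul2l ?lee_fin ?exprn_ge0//.
by apply: ge0_subset_integral => //; first [exact: mJ|exact: J0].
Qed.

Lemma integral_pow (r : R) n : 0 <= r ->
  (\int[mu]_(t in `[0%R, r[) (n.+1%:R * t ^+ n)%:E = (r ^+ n.+1)%:E)%E.
Proof.
move=> r0; rewrite integral_itv_bndo_bndc; last first.
  apply/measurable_EFinP; apply: measurable_funM => //; exact: measurable_funX.
transitivity ((r ^+ n.+1 - 0 ^+ n.+1)%:E); last by rewrite expr0n subr0.
apply: (integral_is_derive (F := fun t : R => t ^+ n.+1)) => //.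
- move=> t _; apply: DeriveDef; first exact: exprn_derivable.
  by rewrite exp_derive; rewrite /GRing.scale/= mulr1.
- move=> t _; apply: cvgM; first exact: cvg_cst.
  exact: exprn_continuous.
Qed.

(** Write [s ^ n.+1] as the integral of [n.+1 * t ^ n] over [[0, s[] and exchange the integrals.
    Moments are thereby expressed through [H], so that conditions on [H] can be applied under the
    integral sign. *)
Lemma moment_layer_cake n :
  ((m n.+1)%:E = \int[mu]_(t in J) (n.+1%:R * t ^+ n * H t)%:E)%E.
Proof.
pose W := w \_ J.
have W0 s : 0 <= W s.
  rewrite /W patchE; case: ifPn => // /set_mem; exact: weight_ge0.
have mW : measurable_fun setT W.
  by apply/(measurable_restrictT _ _).1 => //; exact: measurable_weight.
have WJ s : ~ J s -> W s = 0 by move=> sJ; rewrite /W patchE memNset.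
pose p (t : R) := (if 0 <= t then n.+1%:R * t ^+ n else 0) : R.
have p0 t : 0 <= p t.
  by rewrite /p; case: ifP => // t0; rewrite mulr_ge0// exprn_ge0.
have mp : measurable_fun setT p.
  apply: measurable_fun_ifT => //.
  - exact: measurable_fun_ler.
  - by apply: measurable_funM => //; exact: measurable_funX.
pose F (z : R * R) := (if z.2 < z.1 then W z.1 * p z.2 else 0)%:E.
have F0 z : (0 <= F z)%E by rewrite /F lee_fin; case: ifP => // _; rewrite mulr_ge0.
have mF : measurable_fun setT F.
  apply/measurable_EFinP; apply: measurable_fun_ifT => //.
  - exact: measurable_fun_ltr.
  - by apply: measurable_funM; exact: measurableT_comp.
transitivity (\int[mu]_s \int[mu]_t F (s, t))%E.
  rewrite momentE integral_mkcond; apply: eq_integral => s _; rewrite patchE.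
  case: ifPn => sJ; last first.
    rewrite integral0_eq// => t _; rewrite /F/= WJ ?mul0r ?if_same//.
    by move=> /mem_set; exact/negP.
  have s0 : 0 <= (s : R) by move: sJ; rewrite inE/= in_itv/= => /andP[].
  have Ws : W s = w s by rewrite /W patchE sJ.
  rewrite mulrC EFinM -(integral_pow n s0) -ge0_integralZl//; last 3 first.
  - by apply/measurable_EFinP; apply: measurable_funM => //; exact: measurable_funX.
  - by move=> x /=; rewrite in_itv/= => /andP[x0 _]; rewrite lee_fin mulr_ge0// exprn_ge0.
  - by rewrite lee_fin -Ws.
  rewrite integral_mkcond; apply: eq_integral => t _; rewrite patchE mem_setE in_itv/=.
  rewrite /F /p/= Ws; case: ltP => ts; last by rewrite andbF.
  by rewrite andbT; case: ifP => // t0; rewrite mulr0.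
rewrite (tonelli_lebesgue mF F0) [RHS]integral_mkcond.
apply: eq_integral => t _; rewrite patchE mem_setE in_itv/=.
have [t0|t0] := leP 0 (t : R); last first.
  by rewrite integral0_eq// => s _; rewrite /F/= /p leNgt t0/= mulr0 if_same.
have [t1|t1] := ltP (t : R) 1; last first.
  rewrite integral0_eq// => s _; rewrite /F/=; case: ifP => // ts.
  by rewrite WJ ?mul0r//= in_itv/= => /andP[_ /(lt_trans ts)]; rewrite ltNge t1.
rewrite EFinM omega_hatE// -ge0_integralZl//; last 3 first.
- exact: measurable_weight_itv.
- by move=> x /(itv_sub_unit t0)/weight_ge0; rewrite lee_fin.
- by rewrite lee_fin mulr_ge0// exprn_ge0.
rewrite -integral_itv_obnd_cbnd; last first.
  apply: measurable_funeM; apply: measurable_funS (measurable_weight_itv t0) => //.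
  by apply: subset_itvr; rewrite bnd_simp.
rewrite [RHS]integral_mkcond; apply: eq_integral => s _.
rewrite patchE mem_setE in_itv/= /F/= /p t0; case: ltP => //= ts.
rewrite mulrC; case: ifP => s1; last first.
  by rewrite WJ ?mulr0//= in_itv/= s1 andbF.
by rewrite /W patchE mem_set//= in_itv/= s1 (le_trans t0 (ltW ts)).
Qed.

Lemma measurable_omega_hat : measurable_fun J H.
Proof.
apply: (eq_measurable_fun (fun r => H (Num.max 0 r))).
  by move=> r; rewrite inE/= in_itv/= => /andP[r0 _]; rewrite max_r.
apply: nonincreasing_measurable => // x y xy; apply: le_omega_hat.
  by rewrite le_max lexx.
by rewrite ge_max le_max lexx/= le_max xy orbT.
Qed.

(** After the layer-cake formula and [H t <= C * H ((1 + t) / 2)], the substitution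
    [u = (1 + t) / 2] costs the factor 2 and turns [t ^ k] into [(2 u - 1) ^ k]. Since
    [2 u - 1 <= u ^ 2], this is at most [u ^ (2 k)]: doubling of the distance to 1 becomes doubling
    of the exponent. *)
Lemma moment_doubling C k : 0 < C ->
    (forall r, 0 <= r < 1 -> H r <= C * H ((1 + r) / 2)) ->
  m k.+1 <= 2 * C * m (2 * k).+1.
Proof.
move=> C0 HC; rewrite -lee_fin EFinM.
have mJ (f : R -> R) : measurable_fun J f -> measurable_fun J (EFin \o f).
  by move=> mf; apply/measurable_EFinP.
pose G n (t : R) := ((n.+1%:R * t ^+ n * H t) : R).
have mG n : measurable_fun J (G n).
  apply: measurable_funM; last exact: measurable_omega_hat.
  by apply: measurable_funM => //; exact: measurable_funX.
pose h (u : R) := (k.+1%:R * (2 * u - 1) ^+ k * H u)%:E.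
pose f (u : R) := (h \_ (`[2^-1, 1[%classic : set R)) u.
have sub2 : `[(2^-1 : R), 1%R[ `<=` J by apply: itv_sub_unit; lra.
have mh : measurable_fun (`[(2^-1)%R, 1%R[%classic : set R) h.
  apply/measurable_EFinP; apply: measurable_funM; last first.
    by apply: measurable_funS measurable_omega_hat.
  apply: measurable_funM => //; apply: measurable_funX.
  by apply: measurable_funB => //; exact: measurable_funM.
have h0 (u : R) : `[(2^-1 : R), 1%R[%classic u -> (0 <= h u)%E.
  rewrite /= in_itv/= => /andP[u2 u1]; rewrite lee_fin !mulr_ge0//.
    by rewrite exprn_ge0//; lra.
  by rewrite ltW// omega_hat_gt0//; lra.
have mf : measurable_fun setT f.
  by apply/(measurable_restrictT _ _).1 => //; exact: measurable_itv.
have f0 u : (0 <= f u)%E.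
  by rewrite /f patchE; case: ifPn => // /set_mem; exact: h0.
have fE : (\int[mu]_u f u = \int[mu]_(t in J) (2^-1%:E * f ((1 + t) / 2)%R))%E.
  rewrite (ge0_integral_shift 2^-1)// (@ge0_integral_scale _ 2^-1)//; last first.
    by apply: measurableT_comp => //; exact: measurable_funD.
  rewrite [RHS]integral_mkcond; apply: eq_integral => t _; rewrite patchE muleC.
  have -> : ((t : R) / 2 + 2^-1 = (1 + (t : R)) / 2) by lra.
  case: ifPn => //; rewrite mem_setE in_itv/= => tJ.
  rewrite /f patchE mem_setE in_itv/= ifF ?mule0//.
  by apply/negbTE; apply: contra tJ => /andP[t0 t1]; apply/andP; split; lra.
have mf2 : measurable_fun J (fun t => 2^-1%:E * f ((1 + t) / 2)%R)%E.
  apply: measurable_funTS; apply: measurable_funeM; apply: measurableT_comp => //.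
  by apply: measurable_funM => //; exact: measurable_funD.
have G0 n t : J t -> (0 <= (G n t)%:E)%E.
  rewrite /= in_itv/= => /andP[t0 t1]; rewrite lee_fin !mulr_ge0 ?exprn_ge0//.
  by rewrite ltW// omega_hat_gt0// t0.
apply: (@le_trans _ _ ((2 * C)%:E * \int[mu]_u f u)%E).
  rewrite fE moment_layer_cake -ge0_integralZl//; last 2 first.
  - by move=> t _; rewrite mule_ge0// lee_fin.
  - by rewrite lee_fin mulr_ge0// ltW.
  apply: ge0_le_integral => //.
  - exact: G0.
  - exact: (mJ _ (mG _)).
  - exact: measurable_funeM.
  - move=> t /=; rewrite in_itv/= => /andP[t0 t1].
    rewrite /f patchE mem_set/=; last by rewrite in_itv/=; lra.
    rewrite /h -!EFinM lee_fin.
    have -> : 2 * ((1 + (t : R)) / 2) - 1 = t by lra.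
    have -> : 2 * C * (2^-1 * (k.+1%:R * (t : R) ^+ k * H ((1 + (t : R)) / 2))) =
      k.+1%:R * (t : R) ^+ k * (C * H ((1 + (t : R)) / 2)) by field.
    by rewrite ler_wpM2l ?mulr_ge0 ?exprn_ge0// HC// t0.
rewrite EFinM; apply: lee_wpmul2l; first by rewrite -EFinM lee_fin mulr_ge0// ltW.
rewrite moment_layer_cake -integral_mkcond.
have mG2 : measurable_fun (`[(2^-1)%R, 1%R[%classic : set R) (EFin \o G (2 * k)%N).
  by apply: (measurable_funS _ sub2) => //; exact: (mJ _ (mG _)).
apply: (@le_trans _ _ (\int[mu]_(u in `[(2^-1)%R, 1%R[) (G (2 * k)%N u)%:E)%E).
  apply: ge0_le_integral => // u u2; have /= := sub2 _ u2; move: u2.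
  rewrite /= !in_itv/= => /andP[u2 u1] _; rewrite lee_fin.
  apply: ler_wpM2r; first by rewrite ltW// omega_hat_gt0//; lra.
  rewrite exprM ler_pM ?exprn_ge0//; first by lra.
    by rewrite ler_nat ltnS leq_pmull.
  rewrite lerXn2r ?nnegrE ?sqr_ge0//; first by lra.
  by have := sqr_ge0 ((u : R) - 1); rewrite sqrrB1 -mulr_natl; lra.
apply: ge0_subset_integral => //.
- exact: (mJ _ (mG _)).
- exact: G0.
Qed.

(** A consequence of Bernoulli's inequality for [1 / r], stated without division; it turns
    [k (1 - r) >= 1] into [r ^ k <= 1 / 2]. *)
Lemma pow_le_inv (r : R) k : 0 <= r <= 1 -> r ^+ k * (1 + k%:R * (1 - r)) <= 1.
Proof.
move=> /andP[r0 r1]; elim: k => [|k IH]; first by rewrite expr0 mul0r addr0 mulr1.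
apply: le_trans IH; rewrite exprSr -mulrA ler_wpM2l ?exprn_ge0//.
rewrite -natr1; have k0 : 0 <= k%:R :> R by [].
have : 0 <= (1 - r) * (1 - r) * (k%:R + 1) by rewrite !mulr_ge0// ?subr_ge0// addr_ge0.
nra.
Qed.

Lemma sqr_le_exp2 k : (4 <= k)%N -> (k ^ 2 <= 2 ^ k)%N.
Proof.
elim: k => // k IH; rewrite leq_eqVlt => /predU1P[<-//|]; rewrite ltnS => k4.
rewrite (expnS 2); apply: leq_trans (leq_mul (leqnn 2) (IH k4)).
rewrite -addn1 sqrnD muln1 exp1n [leqRHS]mul2n -addnn -addnA leq_add2l -mulnn.
apply: leq_trans (leq_mul k4 (leqnn k)).
rewrite (_ : 4 = 2 + 2)%N// mulnDl leq_add2r (leq_trans _ (leq_pmull _ _))//.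
exact: leq_trans k4.
Qed.

(** Iterating the doubling of moments [j] times loses a factor [(2 ^ b) ^ j] and raises the exponent
    to [2 ^ j * k + 1]. Splitting that moment at [r] gains
    [r ^ ((2 ^ j - 1) k) <= 2 ^ -(2 ^ j - 1)], which is doubly exponential in [j]. For large [j] the
    gain beats the loss and the term containing [m k.+1] is absorbed on the left. *)
Lemma moment_le_omega_hat : Dhat w -> exists2 A, 0 < A &
  forall r k, 0 <= r < 1 -> 1 <= k%:R * (1 - r) -> m k.+1 <= A * H r.
Proof.
case=> C [C0 HC].
have [b Cb] : exists b, 2 * C <= 2 ^+ b.
  exists (Num.truncn (2 * C)).+1; apply: ltW.
  apply: lt_le_trans (truncnS_gt (2 * C)) _.
  by rewrite -natrX ler_nat ltnW// ltn_expl.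
(* With this choice [b j + 2 <= b j + 4 j = j ^ 2 <= 2 ^ j], so the loss [2 ^ (b j)] times the gain
   is at most 1/2. *)
pose j := (b + 4)%N.
have iter k i : m k.+1 <= (2 ^+ b) ^+ i * m (2 ^ i * k).+1.
  elim: i => [|i IH]; first by rewrite expr0 mul1r mul1n.
  apply: (le_trans IH); rewrite exprSr -mulrA ler_wpM2l ?exprn_ge0//.
  apply: (le_trans (moment_doubling (2 ^ i * k) C0 HC)).
  by rewrite mulnA -expnS ler_wpM2r// ltW// moment_gt0.
exists (2 * (2 ^+ b) ^+ j); first by rewrite mulr_gt0// !exprn_gt0.
move=> r k /andP[r0 r1] kr.
have rk : r ^+ k <= 2^-1.
  have := @pow_le_inv r k; rewrite r0 ltW// => /(_ isT).
  have : 0 <= r ^+ k by rewrite exprn_ge0.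
  by nra.
have e : ((2 ^ j * k).+1 = (2 ^ j - 1) * k + k.+1)%N.
  by rewrite mulnBl mul1n addnS subnK// leq_pmull// expn_gt0.
have := iter k j; rewrite e => h.
have rr : 0 <= r < 1 by rewrite r0.
have := moment_split ((2 ^ j - 1) * k) k.+1 rr => h2.
have h3 : r ^+ ((2 ^ j - 1) * k) <= 2^-1 ^+ (2 ^ j - 1).
  by rewrite mulnC exprM lerXn2r ?nnegrE ?exprn_ge0.
have h4 : (2 ^+ b) ^+ j * 2^-1 ^+ (2 ^ j - 1) <= 2^-1 :> R.
  have jj : (b * j + 1 <= 2 ^ j - 1)%N.
    rewrite leq_subRL ?expn_gt0//; apply: leq_trans (@sqr_le_exp2 j _).
      have -> : (j ^ 2 = b * j + 4 * j)%N by rewrite -mulnDl mulnn.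
      rewrite addnC -addnA leq_add2l.
      by apply: (@leq_trans (4 * 1)%N) => //; rewrite leq_mul2l /j addnS.
    by rewrite /j leq_addl.
  rewrite -(subnKC jj) exprD exprD expr1 -exprM.
  rewrite mulrA mulrA -exprMn divff ?pnatr_eq0// expr1n mul1r.
  by rewrite ler_piMr// exprn_ile1//; lra.
set M := m k.+1 in h h2 *; have M0 : 0 < M by exact: moment_gt0.
have B0 : 0 < (2 ^+ b) ^+ j :> R by rewrite !exprn_gt0.
have : M <= 2^-1 * M + (2 ^+ b) ^+ j * H r.
  apply: (le_trans h); apply: (@le_trans _ _ ((2 ^+ b) ^+ j * (r ^+ ((2 ^ j - 1) * k) * M + H r))).
    by rewrite ler_wpM2l// ltW.
  rewrite mulrDr lerD2r mulrA ler_wpM2r ?(ltW M0)//.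
  by apply: le_trans h4; rewrite ler_wpM2l// ltW.
by lra.
Qed.

Definition coef n := (2 * m (2 * n + 1))^-1.

Lemma coef_gt0 n : 0 < coef n.
Proof. by rewrite invr_gt0 mulr_gt0// moment_gt0. Qed.

(** The lower bound [r ^ (2 n + 3) * H r] for the moment is used at [r = 1 - (1 - s) / 4]. Then
    [s <= r ^ 4], so the square of the power dominates [s ^ n] up to [r ^ 6], and two applications
    of doubling replace [H r] by [H s]. The shape suits sums of squares: in
    [(coef n.+1 * s ^ n) ^ 2] one factor [s ^ n] is spent here and the other is left for a geometric
    series. *)
Lemma coef_decay : Dhat w -> exists2 A, 0 < A &
  forall s n, 0 <= s < 1 -> coef n.+1 ^+ 2 * s ^+ n <= A / H s ^+ 2.
Proof.
case=> C [C0 HC]; exists (2 * C ^+ 4); first by rewrite mulr_gt0// exprn_gt0.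
move=> s n /andP[s0 s1]; pose r1 := (1 + s) / 2; pose r := (1 + r1) / 2.
have r1b : 0 <= r1 < 1 by rewrite /r1; lra.
have rb : 0 <= r < 1 by rewrite /r /r1; lra.
have Hs : 0 < H s by rewrite omega_hat_gt0 ?s0.
have Hr : 0 < H r by rewrite omega_hat_gt0.
have HH : H s <= C ^+ 2 * H r.
  apply: (@le_trans _ _ (C * H r1)); first by apply: HC; rewrite s0.
  by rewrite expr2 -mulrA ler_wpM2l ?HC// ltW.
have r4 : s <= r ^+ 4.
  have rE : r = 1 - (1 - s) / 4 by rewrite /r /r1; lra.
  set x := 1 - s in rE; have sE : s = 1 - x by rewrite /x; lra.
  have x01 : 0 <= x <= 1 by rewrite /x; lra.
  have r2 : 1 - x / 2 <= r ^+ 2 by rewrite rE; nra.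
  rewrite (_ : 4 = 2 * 2)%N// exprM; apply: (@le_trans _ _ ((1 - x / 2) ^+ 2)).
    by rewrite sE; nra.
  by rewrite lerXn2r ?nnegrE ?sqr_ge0//; lra.
have := pow_omega_hat_le_moment (2 * n.+1 + 1) rb; set M := m _ => hM.
have M0 : 0 < M by exact: moment_gt0.
(* This is the source of the constant 8: it gives [8 * r ^ 6 >= 1]. *)
have r34 : 2^-1 <= r ^+ 2 by rewrite /r /r1; nra.
have key : s ^+ n * H s ^+ 2 <= 8 * C ^+ 4 * M ^+ 2.
  have h1 : s ^+ n <= 8 * (r ^+ (2 * n.+1 + 1)) ^+ 2.
    have -> : 8 * (r ^+ (2 * n.+1 + 1)) ^+ 2 = (r ^+ 4) ^+ n * (8 * (r ^+ 2) ^+ 3).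
      by rewrite -!exprM !mulnDl mulnS mul1n mulrCA -exprD; congr (8 * r ^+ _); ring.
    have r6 : 1 <= 8 * (r ^+ 2) ^+ 3.
      have : (2^-1) ^+ 3 <= (r ^+ 2) ^+ 3 by rewrite lerXn2r ?nnegrE ?sqr_ge0//; lra.
      by rewrite exprVn; lra.
    rewrite -[leLHS]mulr1; apply: ler_pM; rewrite ?exprn_ge0//.
    by rewrite lerXn2r ?nnegrE ?exprn_ge0//; case/andP: rb.
  have h2 : H s ^+ 2 <= C ^+ 4 * H r ^+ 2.
    rewrite (_ : 4 = 2 * 2)%N// exprM -exprMn lerXn2r ?nnegrE ?(ltW Hs)//.
    by rewrite mulr_ge0 ?exprn_ge0 ?(ltW C0) ?(ltW Hr).
  apply: (@le_trans _ _ ((8 * (r ^+ (2 * n.+1 + 1)) ^+ 2) * (C ^+ 4 * H r ^+ 2))).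
    by apply: ler_pM => //; rewrite ?sqr_ge0// exprn_ge0.
  have -> : (8 * (r ^+ (2 * n.+1 + 1)) ^+ 2) * (C ^+ 4 * H r ^+ 2) =
      8 * C ^+ 4 * (r ^+ (2 * n.+1 + 1) * H r) ^+ 2 by ring.
  rewrite ler_wpM2l ?mulr_ge0 ?exprn_ge0 ?(ltW C0)// lerXn2r ?nnegrE ?(ltW M0)//.
  by rewrite mulr_ge0 ?exprn_ge0 ?(ltW Hr)//; case/andP: rb.
rewrite /coef -/M exprVn exprMn ler_pdivlMr ?exprn_gt0//.
rewrite -mulrA mulrC ler_pdivrMr ?mulr_gt0 ?exprn_gt0//.
have : 0 <= C ^+ 4 * M ^+ 2 by rewrite mulr_ge0 ?sqr_ge0// exprn_ge0// ltW.
by move: key; lra.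
Qed.

Lemma pow_subr_le1 s n : 0 <= s <= 1 -> n.+1%:R * s ^+ n * (1 - s) <= 1 - s ^+ n.+1.
Proof.
move=> /andP[s0 s1]; elim: n => [|n IH]; first by rewrite expr0 expr1; lra.
have sn : 0 <= s ^+ n.+1 <= 1 by rewrite exprn_ge0//= exprn_ile1.
have : s * (n.+1%:R * s ^+ n * (1 - s)) <= s * (1 - s ^+ n.+1) by rewrite ler_wpM2l.
have -> : s * (n.+1%:R * s ^+ n * (1 - s)) = n.+1%:R * s ^+ n.+1 * (1 - s).
  by rewrite exprS; ring.
rewrite (exprS _ n.+1) -(natr1 n.+1); set u := s ^+ n.+1 in sn *.
by move: sn => /andP[]; nra.
Qed.

(** Integrated form of [n.+1 * s ^ n * (1 - s ^ 2) <= 2], multiplied by [s ^ n.+1]: half of the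
    exponent [2 n + 1] is spent to absorb the factor [n.+1]. *)
Lemma moment_diff n :
  n.+1%:R * m (2 * n + 1)%N <= 2 * m n.+1 + n.+1%:R * m (2 * n.+1 + 1)%N.
Proof.
have ip k : mu.-integrable J (EFin \o (fun s => s ^+ k * w s)).
  exact: integrable_pow_weight.
have ipZ (c : R) k : mu.-integrable J (EFin \o (fun s => c * (s ^+ k * w s))).
  rewrite (_ : _ \o _ = (fun s => c%:E * (s ^+ k * w s)%:E)%E)//.
  by apply: integrableZl => //; exact: ip.
rewrite /moment -!RintegralZl// -RintegralD//.
apply: le_Rintegral => //.
  by apply: (integrableD _ (ipZ 2 n.+1) (ipZ n.+1%:R (2 * n.+1 + 1)%N)).
move=> s sJ; have ws := weight_ge0 sJ; move: sJ; rewrite /= in_itv/= => /andP[s0 s1].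
have -> : (2 * n.+1 + 1 = 2 + (2 * n + 1))%N by rewrite mulnS -addnA.
have -> : (2 * n + 1 = n + n.+1)%N by rewrite addn1 mul2n -addnn addnS.
rewrite !exprD (exprS _ n).
have := @pow_subr_le1 s n; rewrite s0 ltW// => /(_ isT).
have : 0 <= s ^+ n.+1 by rewrite exprn_ge0.
have sn : 0 <= s ^+ n by rewrite exprn_ge0.
move=> sn1 h.
have h2 : n.+1%:R * s ^+ n * (1 - s ^+ 2) <= 2.
  have -> : 1 - s ^+ 2 = (1 - s) * (1 + s) by ring.
  have h0 : 0 <= n.+1%:R * s ^+ n * (1 - s) by rewrite !mulr_ge0// subr_ge0 ltW.
  by rewrite mulrA; nra.
have : 0 <= (2 - n.+1%:R * s ^+ n * (1 - s ^+ 2)) * (s * s ^+ n * w s).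
  by rewrite !mulr_ge0// subr_ge0.
by lra.
Qed.

(** The difference of the reciprocals has the difference of two consecutive odd moments as
    numerator. This is bounded by a moment with exponent [n.+1], and the doubling of moments brings
    it back to the moment in the denominator. *)
Lemma coef_diff : Dhat w -> exists2 A, 0 < A &
  forall n, 0 <= n.+1%:R * (coef n.+1 - coef n) <= A * coef n.+1.
Proof.
case=> C [C0 HC]; exists (4 * C); first by rewrite mulr_gt0.
move=> n; have := moment_diff n; have := moment_doubling n C0 HC.
have : m (2 * n.+1 + 1) <= m (2 * n + 1).
  by apply: le_moment; rewrite leq_add2r leq_mul2l leqnSn.
have := moment_gt0 (2 * n.+1 + 1); have := moment_gt0 (2 * n + 1).
rewrite /coef addn1; set x := m (2 * n).+1; set y := m (2 * n.+1 + 1).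
move=> x0 y0 yx h1 h2; have -> : (2 * y)^-1 - (2 * x)^-1 = (x - y) / (2 * x * y).
  by field; rewrite !gt_eqF.
apply/andP; split.
  by rewrite !mulr_ge0// ?subr_ge0// invr_ge0 !mulr_ge0// ltW.
have -> : 4 * C / (2 * y) = (4 * C * x) / (2 * x * y) by field; rewrite !gt_eqF.
rewrite [leLHS]mulrA ler_wpM2r ?invr_ge0 ?mulr_ge0 ?(ltW x0) ?(ltW y0)//.
by rewrite mulrBr; lra.
Qed.

Lemma le_coefS : Dhat w -> forall n, coef n <= coef n.+1.
Proof.
move=> /coef_diff[A A0 h] n; have /andP[+ _] := h n.
by rewrite pmulr_rge0// subr_ge0.
Qed.

Lemma coef_bound : Dhat w -> exists2 A, 0 < A &
  forall s n, 0 <= s < 1 -> coef n * s ^+ n <= A / H s.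
Proof.
move=> Dw; have [A A0 h] := coef_decay Dw.
exists (Num.sqrt A); first by rewrite sqrtr_gt0.
move=> s n s01; have Hs := omega_hat_gt0 s01; case/andP: (s01) => s0 s1.
have sn : 0 <= s ^+ n <= 1 by rewrite exprn_ge0//= exprn_ile1// ltW.
have c0 := coef_gt0 n; have c1 := coef_gt0 n.+1; have c01 := le_coefS Dw n.
rewrite -(@ler_pXn2r _ 2)// ?nnegrE; last 2 first.
- by rewrite mulr_ge0// ?(ltW c0)//; case/andP: sn.
- by rewrite divr_ge0 ?sqrtr_ge0// ltW.
rewrite [leRHS]exprMn exprVn sqr_sqrtr ?(ltW A0)// exprMn.
apply: (@le_trans _ _ (coef n.+1 ^+ 2 * s ^+ n)); last exact: h.
by apply: ler_pM; rewrite ?sqr_ge0//; case/andP: sn => ? ?; nra.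
Qed.

(** Comparison with the radius [s] halfway between [r] and 1, where [coef n * s ^ n] is bounded; the
    ratio [r / s] is left. This gives convergence of the kernel series, uniformly in the angle. *)
Lemma coef_geometric : Dhat w -> forall r, 0 <= r < 1 ->
  exists D x, [/\ 0 <= D, 0 <= x < 1 & forall n, coef n * r ^+ n <= D * x ^+ n].
Proof.
move=> Dw r /andP[r0 r1]; have [A A0 h] := coef_bound Dw.
pose s := (1 + r) / 2; have s01 : 0 <= s < 1 by rewrite /s; lra.
have s0 : 0 < s by rewrite /s; lra.
exists (A / H s), (r / s); split.
- by rewrite divr_ge0 ?ltW// omega_hat_gt0.
- by rewrite divr_ge0 ?(ltW s0)//= ltr_pdivrMr// mul1r /s; lra.
- move=> n; rewrite expr_div_n mulrA ler_pdivlMr ?exprn_gt0//.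
  by rewrite mulrAC ler_wpM2r ?exprn_ge0// h.
Qed.
End weight.

(** * Upper and lower bounds for L1 norms of trigonometric series *)

Section trigonometric_polynomials.
Context {R : realType}.
Local Notation mu := (@lebesgue_measure R).
Local Notation normc := (@ComplexField.Normc.normc R).
Implicit Types (h : nat -> R) (t : R).

Definition expi t : R[i] := (cos t +i* sin t)%C.

Definition trigpoly h n t : R[i] := \sum_(k < n) (h k)%:C%C * expi t ^+ k.

Lemma expiD s t : expi (s + t) = expi s * expi t.
Proof. by rewrite /expi cosD sinD; apply/eqP; rewrite eq_complex/= eqxx/= addrC. Qed.

Lemma expi_pow t k : expi t ^+ k = expi (k%:R * t).
Proof.
elim: k => [|k IH]; first by rewrite expr0 mul0r /expi cos0 sin0.
by rewrite exprS IH -expiD -natr1 mulrDl mul1r addrC.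
Qed.

Lemma normcE (z : R[i]) : normc z ^+ 2 = complex.Re z ^+ 2 + complex.Im z ^+ 2.
Proof. by case: z => a b /=; rewrite sqr_sqrtr// addr_ge0 ?sqr_ge0. Qed.

Lemma normc_ge0 (z : R[i]) : 0 <= normc z.
Proof. by case: z => a b /=; exact: sqrtr_ge0. Qed.

Lemma normc_expi t : normc (expi t) = 1.
Proof. by rewrite /expi/= cos2Dsin2 sqrtr1. Qed.

Lemma normcX (z : R[i]) k : normc (z ^+ k) = normc z ^+ k.
Proof.
elim: k => [|k IH]; first by rewrite !expr0 ComplexField.Normc.normc1.
by rewrite !exprS ComplexField.Normc.normcM IH.
Qed.

Lemma normcR (x : R) : normc (x%:C)%C = `|x|.
Proof. by rewrite /= expr0n addr0 sqrtr_sqr. Qed.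

Lemma trigpolyE h n t : trigpoly h n t =
  ((\sum_(k < n) h k * cos (k%:R * t)) +i* (\sum_(k < n) h k * sin (k%:R * t)))%C.
Proof.
rewrite /trigpoly; elim: n => [|n IH]; first by rewrite !big_ord0.
rewrite !big_ord_recr/= IH expi_pow; apply/eqP.
by rewrite eq_complex/= !mul0r subr0 addr0 !eqxx.
Qed.

Lemma sin_2pi_int (k : nat) : sin (k%:R * (2 * pi)) = 0 :> R.
Proof.
elim: k => [|k IH]; first by rewrite mul0r sin0.
by rewrite -natr1 mulrDl mul1r [X in _ + X]mulr_natl sinD2pi.
Qed.

Lemma cos_2pi_int (k : nat) : cos (k%:R * (2 * pi)) = 1 :> R.
Proof.
elim: k => [|k IH]; first by rewrite mul0r cos0.
by rewrite -natr1 mulrDl mul1r [X in _ + X]mulr_natl cosD2pi.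
Qed.

Let prim (i j : nat) t : R :=
  if i == j then t else sin ((i%:R - j%:R) * t) / (i%:R - j%:R).

Let is_derive_prim (i j : nat) t : is_derive t 1 (prim i j) (cos ((i%:R - j%:R) * t)).
Proof.
rewrite /prim; have [->|ij] := eqVneq i j.
  by rewrite subrr mul0r cos0; exact: is_derive_id.
have dij : i%:R - j%:R != 0 :> R by rewrite subr_eq0 eqr_nat.
set c := i%:R - j%:R in dij *.
have d1 : is_derive t 1 (fun t : R => c * t) c.
  have d0 := @is_deriveZ R R R id c t 1 1 (is_derive_id _ _).
  by apply: is_derive_eq d0 _; rewrite /GRing.scale/= mulr1.
have d2 := @is_derive1_comp R sin (fun t : R => c * t) t _ _ (is_derive_sin _) d1.
have d3 := @is_deriveZ R R R _ c^-1 t 1 _ d2.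
rewrite (_ : (fun t : R => sin (c * t) / c) = c^-1 \*: (sin \o (fun t : R => c * t))).
  by apply: is_derive_eq d3 _; rewrite /GRing.scale/= mulrCA mulVf// mulr1.
by apply/funext => x; rewrite mulrC.
Qed.

Lemma is_derive_bigsum n (f : 'I_n -> R -> R) (df : 'I_n -> R) t :
    (forall i, is_derive t 1 (f i) (df i)) ->
  is_derive t 1 (fun t => \sum_(i < n) f i t) (\sum_(i < n) df i).
Proof.
move=> dfE; have := is_derive_sum dfE.
by rewrite (_ : \sum_(i < n) f i = (fun t => \sum_(i < n) f i t))// fct_sumE.
Qed.

Lemma normc_trigpoly h n t : normc (trigpoly h n t) ^+ 2 =
  \sum_(i < n) \sum_(j < n) h i * h j * cos ((i%:R - j%:R) * t).
Proof.
rewrite trigpolyE normcE/= !expr2 !big_distrlr/= -big_split/=.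
apply: eq_bigr => i _; rewrite -big_split/=; apply: eq_bigr => j _.
by rewrite mulrBl cosB; ring.
Qed.

Lemma continuous_bigsum n (f : 'I_n -> R -> R) t :
    (forall i, {for t, continuous (f i)}) ->
  {for t, continuous (fun t => \sum_(i < n) f i t)}.
Proof.
move=> cf; elim: n f cf => [|n IH] f cf.
  rewrite (_ : (fun _ => _) = cst 0); first exact: cvg_cst.
  by apply/funext => x; rewrite big_ord0.
rewrite (_ : (fun _ => _) = (fun t => \sum_(i < n) f (widen_ord (leqnSn n) i) t) \+ f ord_max).
  2: by apply/funext => x; rewrite big_ord_recr.
by apply: (@continuousD _ R^o _ _ _ t) => //; exact: IH.
Qed.

(** The expanded square has an explicit primitive, whose off-diagonal terms vanish at both ends of
    the period. *)
Lemma trigpoly_parseval h n :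
  (\int[mu]_(t in `[0%R, (2 * pi)%R]) (normc (trigpoly h n t) ^+ 2)%:E =
   (2 * pi * \sum_(i < n) h i ^+ 2)%:E)%E.
Proof.
pose F t := \sum_(i < n) \sum_(j < n) h i * h j * prim i j t.
transitivity ((F (2 * pi) - F 0)%:E); last first.
  congr (_%:E); rewrite -sumrB mulr_sumr; apply: eq_bigr => i _.
  rewrite -sumrB (bigD1 i)//= big1 ?addr0 => [|j ij].
    by rewrite /prim eqxx; ring.
  rewrite /prim val_eqE eq_sym (negbTE ij) mulr0 sin0 mul0r mulr0 subr0.
  rewrite mulrBl sinB !sin_2pi_int; ring.
under eq_integral do rewrite normc_trigpoly.
apply: integral_is_derive.
- by rewrite mulr_ge0// pi_ge0.
- move=> t _; apply: is_derive_bigsum => i; apply: is_derive_bigsum => j.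
  exact: (@is_deriveZ R R R _ (h i * h j) t 1 _ (is_derive_prim i j t)).
- move=> t _; apply: continuous_bigsum => i; apply: continuous_bigsum => j.
  apply: cvgM; first exact: cvg_cst.
  apply: (continuous_comp (g := cos)); last exact: continuous_cos.
  by apply: cvgM; [exact: cvg_cst|exact: cvg_id].
Qed.

Implicit Types (s c : R).
(** Coefficients of [1 - s e^{it}] times the series with coefficients [h]: the differences produced
    by summation by parts. *)
Definition twist (s : R) h k := if k is j.+1 then h k - s * h j else h 0.

Lemma twist_trigpoly s h n t :
  (1 - s%:C%C * expi t) * trigpoly h n.+1 t =
  trigpoly (twist s h) n.+1 t - (s * h n)%:C%C * expi t ^+ n.+1.
Proof.
elim: n => [|n IH].
  rewrite /trigpoly !big_ord_recr !big_ord0 /= !expr0 !add0r !mulr1 expr1 rmorphM/=.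
  by ring.
rewrite /trigpoly big_ord_recr/= -/(trigpoly h n.+1 t) mulrDr IH.
rewrite [in RHS]big_ord_recr/= -/(trigpoly (twist s h) n.+1 t).
rewrite rmorphB !rmorphM/= (exprS _ n.+1); ring.
Qed.

Lemma twist_pow s n t :
  (1 - s%:C%C * expi t) * trigpoly (GRing.exp s) n.+1 t =
  1 - (s ^+ n.+1)%:C%C * expi t ^+ n.+1.
Proof.
rewrite twist_trigpoly -exprS; congr (_ - _).
rewrite /trigpoly big_ord_recl/= expr0 mulr1 big1 ?addr0// => i _.
by rewrite /= exprS subrr mul0r.
Qed.

Lemma exists_pow_le_half s : 0 <= s < 1 -> exists n, s ^+ n.+1 <= 2^-1.
Proof.
move=> /andP[s0 s1]; pose n := Num.truncn (1 - s)^-1; exists n.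
have s1' : 0 < 1 - s by rewrite subr_gt0.
have hn : 1 <= n.+1%:R * (1 - s).
  by rewrite -ler_pdivrMr// mul1r ltW// truncnS_gt.
have := @pow_le_inv _ s n.+1; rewrite s0 ltW// => /(_ isT).
by have : 0 <= s ^+ n.+1 by [rewrite exprn_ge0]; nra.
Qed.

Lemma continuous_normc_trigpoly h n : continuous (fun t => normc (trigpoly h n t)).
Proof.
move=> t; rewrite (_ : (fun _ => _) =
    fun t => Num.sqrt (\sum_(i < n) \sum_(j < n) h i * h j * cos ((i%:R - j%:R) * t))).
  apply: (continuous_comp (g := Num.sqrt)); last exact: sqrt_continuous.
  apply: continuous_bigsum => i; apply: continuous_bigsum => j.
  apply: cvgM; first exact: cvg_cst.
  apply: (continuous_comp (g := cos)); last exact: continuous_cos.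
  by apply: cvgM; [exact: cvg_cst|exact: cvg_id].
by apply/funext => u; rewrite -normc_trigpoly sqrtr_sqr ger0_norm// normc_ge0.
Qed.

Lemma measurable_normc_trigpoly h n D : measurable_fun D (fun t => normc (trigpoly h n t)).
Proof.
apply: measurable_funTS; apply: continuous_measurable_fun.
exact: continuous_normc_trigpoly.
Qed.

Lemma ler_normcD (x y : R[i]) : normc (x + y) <= normc x + normc y.
Proof. exact: le_normcD. Qed.

Lemma normcN (x : R[i]) : normc (- x) = normc x.
Proof. by case: x => a b /=; rewrite !sqrrN. Qed.

(* Cauchy-Schwarz against [1 / (1 - s e^{it})], whose coefficients are explicit. *)
Lemma trigpoly_L1_le s c h n : 0 <= s < 1 -> 0 < c ->
    \sum_(k < n.+1) twist s h k ^+ 2 <= c ^+ 2 * (1 - s) ->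
    h n ^+ 2 <= c ^+ 2 * (1 - s) ->
  (\int[mu]_(t in `[0%R, (2 * pi)%R]) (normc (trigpoly h n.+1 t))%:E <=
   (10 * pi * c)%:E)%E.
Proof.
move=> s01 c0 htw hn; have [M sM] := exists_pow_le_half s01; case/andP: s01 => s0 s1.
(* [V] is a truncation of the geometric series of [1 / (1 - s e^{it})], which keeps the argument
   among polynomials; [M] makes the truncation error at most 1/2. *)
pose V t := trigpoly (GRing.exp s) M.+1 t; pose U t := trigpoly (twist s h) n.+1 t.
have s1' : 0 < 1 - s by rewrite subr_gt0.
(* Cauchy-Schwarz is used in the additive form [2 x y <= l x ^ 2 + y ^ 2 / l]. This [l] balances the
   terms: after integration each is at most a multiple of [c]. *)
pose l := (c * (1 - s))^-1; have l0 : 0 < l by rewrite invr_gt0 mulr_gt0.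
have ptw t : normc (trigpoly h n.+1 t) <=
    2 * l * normc (U t) ^+ 2 + (2 * l * h n ^+ 2 + l^-1 * normc (V t) ^+ 2).
  set G := normc (trigpoly h n.+1 t).
  have hV : 2^-1 <= normc (1 - s%:C%C * expi t) * normc (V t).
    rewrite -ComplexField.Normc.normcM twist_pow.
    have := ler_normcD (1 - (s ^+ M.+1)%:C%C * expi t ^+ M.+1) ((s ^+ M.+1)%:C%C * expi t ^+ M.+1).
    rewrite subrK ComplexField.Normc.normc1 ComplexField.Normc.normcM normcX normc_expi.
    rewrite expr1n mulr1 normcR ger0_norm ?exprn_ge0//.
    by move: sM; lra.
  have hU : normc (1 - s%:C%C * expi t) * G <= normc (U t) + `|h n|.
    rewrite -ComplexField.Normc.normcM twist_trigpoly.
    apply: (le_trans (ler_normcD _ _)); rewrite lerD2l normcN ComplexField.Normc.normcM.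
    rewrite normcX normc_expi expr1n mulr1 normcR normrM (ger0_norm s0).
    by rewrite ler_piMl// ltW.
  have G0 : 0 <= G by exact: normc_ge0.
  have V0 := normc_ge0 (V t); have U0 := normc_ge0 (U t).
  set q := normc (1 - _) in hV hU; have q0 : 0 <= q by exact: normc_ge0.
  set v := normc (V t) in hV V0 *; set u := normc (U t) in hU U0 *.
  have Gle : G <= 2 * (u + `|h n|) * v.
    apply: (@le_trans _ _ (2 * (q * v) * G)); first by nra.
    by rewrite (_ : 2 * (q * v) * G = 2 * (q * G) * v); [nra|ring].
  apply: (le_trans Gle).
  have -> : h n ^+ 2 = `|h n| ^+ 2 by rewrite real_normK ?num_real.
  set a := `|h n|.
  have ll : l * l^-1 = 1 by rewrite divff// gt_eqF.
  have li0 : 0 < l^-1 by rewrite invr_gt0.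
  have h1 : 0 <= l^-1 * (l * (u + a) - v) ^+ 2 by rewrite mulr_ge0 ?sqr_ge0// ltW.
  have h2 : 0 <= l * (u - a) ^+ 2 by rewrite mulr_ge0 ?sqr_ge0// ltW.
  have e1 : l^-1 * (l * (u + a) - v) ^+ 2 =
      l * (u + a) ^+ 2 - 2 * (u + a) * v + l^-1 * v ^+ 2.
    by field; rewrite gt_eqF.
  have e2 : l * (u + a) ^+ 2 + l * (u - a) ^+ 2 = 2 * l * u ^+ 2 + 2 * l * a ^+ 2 by ring.
  by lra.
have mn k g D : measurable_fun D (fun t => (normc (trigpoly g k t) ^+ 2)%:E).
  by apply/measurable_EFinP; apply: measurable_funX; exact: measurable_normc_trigpoly.
have mk k x g D : measurable_fun D (fun t => x%:E * (normc (trigpoly g k t) ^+ 2)%:E)%E.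
  by apply: measurable_funeM; exact: mn.
have l20 : 0 <= 2 * l by rewrite mulr_ge0// ltW.
have li0 : 0 <= l^-1 by rewrite invr_ge0 ltW.
have hu t : 0 <= 2 * l * normc (U t) ^+ 2 by apply: mulr_ge0 => //; exact: sqr_ge0.
have hh0 : 0 <= 2 * l * h n ^+ 2 by apply: mulr_ge0 => //; exact: sqr_ge0.
have hv t : 0 <= l^-1 * normc (V t) ^+ 2 by apply: mulr_ge0 => //; exact: sqr_ge0.
have pi2 : 0 <= 2 * pi :> R by rewrite mulr_ge0// pi_ge0.
have sV : \sum_(k < M.+1) (s ^+ k) ^+ 2 <= (1 - s)^-1.
  apply: (@le_trans _ _ (\sum_(k < M.+1) s ^+ k)).
    apply: ler_sum => k _; rewrite expr2 ler_piMl ?exprn_ge0// exprn_ile1//.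
    exact: ltW.
  by apply: sum_geometric_le; rewrite s0.
apply: (@le_trans _ _ (\int[mu]_(t in `[0%R, (2 * pi)%R])
   (((2 * l)%:E * (normc (U t) ^+ 2)%:E) +
    ((2 * l * h n ^+ 2)%:E + (l^-1)%:E * (normc (V t) ^+ 2)%:E)))%E).
  apply: ge0_le_integral => //.
  - by move=> t _; rewrite lee_fin normc_ge0.
  - by apply/measurable_EFinP; exact: measurable_normc_trigpoly.
  - apply: emeasurable_funD; first exact: mk.
    by apply: emeasurable_funD => //; exact: mk.
  - by move=> t _; rewrite -!EFinM -!EFinD lee_fin ptw.
rewrite ge0_integralD//; last 4 first.
- by move=> t _; rewrite -EFinM lee_fin hu.
- exact: mk.
- by move=> t _; rewrite -EFinM -EFinD lee_fin addr_ge0.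
- by apply: emeasurable_funD => //; exact: mk.
rewrite ge0_integralD//; last 2 first.
- by move=> t _; rewrite -EFinM lee_fin hv.
- exact: mk.
rewrite !ge0_integralZl//; last 4 first.
- exact: mn.
- by move=> t _; rewrite lee_fin sqr_ge0.
- exact: mn.
- by move=> t _; rewrite lee_fin sqr_ge0.
rewrite integral_cst_EFin//= lebesgue_measure_itv/= lte_fin.
rewrite mulr_gt0 ?pi_gt0// -EFinB subr0 !trigpoly_parseval -!EFinM -!EFinD lee_fin.
have lE : l * (c ^+ 2 * (1 - s)) = c by rewrite /l; field; rewrite !gt_eqF.
have liE : l^-1 = c * (1 - s) by rewrite invrK.
set A := \sum_(k < n.+1) _ in htw *; set B := \sum_(k < M.+1) _ in sV *.
have hA : l * A <= c by rewrite -lE ler_wpM2l// ltW.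
have hh : l * h n ^+ 2 <= c by rewrite -lE ler_wpM2l// ltW.
have hB : l^-1 * B <= c.
  rewrite liE -[leRHS]mulr1 -mulrA ler_wpM2l ?(ltW c0)//.
  by rewrite -(ler_pdivlMl _ _ s1') mulr1.
have p0 := pi_gt0 R.
have -> : 2 * l * (2 * pi * A) + (2 * l * h n ^+ 2 * (2 * pi) + l^-1 * (2 * pi * B)) =
  2 * pi * (2 * (l * A) + 2 * (l * h n ^+ 2) + l^-1 * B) by ring.
(* The 5 is [2 + 2 + 1]: the twisted polynomial, the boundary coefficient [h n], and the geometric
   factor. *)
rewrite (_ : 10 * pi * c = 2 * pi * (5 * c)); last by ring.
by rewrite ler_wpM2l//; lra.
Qed.

Definition geom_bounded h D x := [/\ 0 <= D, 0 <= x < 1 & forall n, `|h n| <= D * x ^+ n :> R].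

(** The two components are real limits, so that convergence is a matter of real series only. *)
Definition trigser h t : R[i] :=
  (limn (series (fun k => h k * cos (k%:R * t))) +i*
   limn (series (fun k => h k * sin (k%:R * t))))%C.

Lemma geom_bounded_cvg h D x (f : nat -> R) : geom_bounded h D x ->
  (forall k, `|f k| <= 1) -> cvgn (series (fun k => h k * f k)).
Proof.
move=> [D0 /andP[x0 x1] hx] f1; apply: normed_cvg.
apply: (series_le_cvg (v_ := fun n => D * x ^+ n)) => [n|n|n|].
- exact: normr_ge0.
- by rewrite mulr_ge0// exprn_ge0.
- by rewrite /= normrM; apply: le_trans (hx n); rewrite ler_piMr.
- by apply: (@is_cvg_geometric_series R D x); rewrite ger0_norm.
Qed.

Lemma re_trigpoly h n t :
  complex.Re (trigpoly h n t) = series (fun k => h k * cos (k%:R * t)) n.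
Proof. by rewrite trigpolyE /series/= big_mkord. Qed.

Lemma im_trigpoly h n t :
  complex.Im (trigpoly h n t) = series (fun k => h k * sin (k%:R * t)) n.
Proof. by rewrite trigpolyE /series/= big_mkord. Qed.

Lemma normr_cos_le1 t : `|cos t| <= 1.
Proof. by rewrite ler_norml cos_geN1 cos_le1. Qed.

Lemma normr_sin_le1 t : `|sin t| <= 1.
Proof. by rewrite ler_norml sin_geN1 sin_le1. Qed.

Lemma cvg_normc (u : nat -> R[i]) (a b : R) :
  complex.Re (u n) @[n --> \oo] --> a -> complex.Im (u n) @[n --> \oo] --> b ->
  normc (u n) @[n --> \oo] --> normc (a +i* b)%C.
Proof.
move=> ca cb; rewrite [X in _ --> X]/=.
rewrite (_ : (fun n => normc (u n)) =
   fun n => Num.sqrt (complex.Re (u n) ^+ 2 + complex.Im (u n) ^+ 2)); last first.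
  by apply/funext => n; case: (u n).
apply: (continuous_cvg _ (@sqrt_continuous R _)).
by apply: cvgD; rewrite ?expr2; apply: cvgM.
Qed.

Lemma cvg_trigpoly h D x t : geom_bounded h D x ->
  normc (trigpoly h n t) @[n --> \oo] --> normc (trigser h t).
Proof.
move=> hb; apply: cvg_normc.
- rewrite (_ : (fun n => _) = series (fun k => h k * cos (k%:R * t))).
    by apply: (geom_bounded_cvg hb) => k; exact: normr_cos_le1.
  by apply/funext => n; exact: re_trigpoly.
- rewrite (_ : (fun n => _) = series (fun k => h k * sin (k%:R * t))).
    by apply: (geom_bounded_cvg hb) => k; exact: normr_sin_le1.
  by apply/funext => n; exact: im_trigpoly.
Qed.

Lemma trigpoly_le h D x n t : geom_bounded h D x ->
  normc (trigpoly h n t) <= D / (1 - x).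
Proof.
move=> [D0 /andP[x0 x1] hx]; have x1' : 0 < 1 - x by rewrite subr_gt0.
apply: (@le_trans _ _ (\sum_(k < n) D * x ^+ k)).
  rewrite /trigpoly; elim: n => [|n IH].
    by rewrite !big_ord0 ComplexField.Normc.normc0.
  rewrite !big_ord_recr/=; apply: (le_trans (ler_normcD _ _)); apply: lerD => //.
  by rewrite ComplexField.Normc.normcM normcX normc_expi expr1n mulr1 normcR.
by rewrite -mulr_sumr ler_wpM2l// sum_geometric_le// x0.
Qed.

Lemma trigser_le h D x t : geom_bounded h D x -> normc (trigser h t) <= D / (1 - x).
Proof.
move=> hb; rewrite -(cvg_lim _ (@cvg_trigpoly _ _ _ t hb))//.
apply: limr_le; first by apply: cvgP; exact: cvg_trigpoly hb.
by near=> n; exact: trigpoly_le hb.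
Unshelve. all: by end_near. Qed.

Lemma measurable_normc_trigser h D x : geom_bounded h D x ->
  measurable_fun setT (fun t => normc (trigser h t)).
Proof.
move=> hb; apply: (measurable_fun_cvg (h := fun n t => normc (trigpoly h n t))).
- by move=> n; exact: measurable_normc_trigpoly.
- by move=> t _; exact: cvg_trigpoly hb.
Qed.

Lemma cvg_integral_trigpoly h D x : geom_bounded h D x ->
  (\int[mu]_(t in `[0%R, (2 * pi)%R]) (normc (trigpoly h n t))%:E)%E @[n --> \oo] -->
  (\int[mu]_(t in `[0%R, (2 * pi)%R]) (normc (trigser h t))%:E)%E.
Proof.
move=> hb.
have mpi : measurable (`[0%R, (2 * pi)%R]%classic : set R) by [].
have m1 n : measurable_fun (`[0%R, (2 * pi)%R]%classic : set R)
    (fun t => (normc (trigpoly h n t))%:E).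
  by apply/measurable_EFinP; exact: measurable_normc_trigpoly.
have m2 : measurable_fun (`[0%R, (2 * pi)%R]%classic : set R)
    (fun t => (normc (trigser h t))%:E).
  by apply/measurable_EFinP; apply: measurable_funTS; exact: measurable_normc_trigser hb.
have ig : mu.-integrable `[0%R, (2 * pi)%R] (EFin \o cst (D / (1 - x))).
  apply: continuous_compact_integrable; first exact: segment_compact.
  by apply: continuous_subspaceT => y; exact: cvg_cst.
have [||_ _] := @dominated_convergence _ _ _ mu _ mpi _ _ _ m1 m2 _ ig.
- apply: aeW => t _; apply: cvg_EFin; first exact: nearW.
  exact: cvg_trigpoly hb.
- by apply: aeW => t n _; rewrite gee0_abs ?lee_fin ?normc_ge0//; exact: trigpoly_le hb.
exact.
Qed.

Lemma geom_bounded_cvg0 h D x : geom_bounded h D x -> h n @[n --> \oo] --> (0 : R).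
Proof.
move=> [D0 /andP[x0 x1] hx]; apply/cvgr0Pnorm_le => e e0.
have : D * x ^+ n @[n --> \oo] --> (0 : R) by apply: cvg_geometric; rewrite ger0_norm.
move=> /cvgr0Pnorm_le/(_ _ e0); apply: filterS => n; apply: le_trans.
by apply: le_trans (hx n) _; exact: ler_norm.
Qed.

(** Passage to the limit in the bound for polynomials. The condition on the last coefficient holds
    eventually because [h n] tends to 0. *)
Lemma trigser_L1_le h D x s c : geom_bounded h D x -> 0 <= s < 1 -> 0 < c ->
    (forall n, \sum_(k < n) twist s h k ^+ 2 <= c ^+ 2 * (1 - s)) ->
  (\int[mu]_(t in `[0%R, (2 * pi)%R]) (normc (trigser h t))%:E <= (10 * pi * c)%:E)%E.
Proof.
move=> hb s01 c0 htw; have cI := cvg_integral_trigpoly hb.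
rewrite -(cvg_lim _ cI)//; apply: lime_le; first by apply: cvgP; exact: cI.
have e0 : 0 < c * Num.sqrt (1 - s).
  by rewrite mulr_gt0// sqrtr_gt0 subr_gt0; case/andP: s01.
have /cvgr0Pnorm_le/(_ _ e0) hn := geom_bounded_cvg0 hb.
have hn1 : \forall n \near \oo, `|h n.-1| <= c * Num.sqrt (1 - s).
  have [N _ hN] := hn; exists N.+1 => // n /= Nn; apply: hN => /=.
  by rewrite -ltnS (ltn_predK Nn).
near=> n; have n0 : (0 < n)%N by near: n; exact: nbhs_infty_gt.
rewrite -(prednK n0); apply: (trigpoly_L1_le s01) => //.
have -> : h n.-1 ^+ 2 = `|h n.-1| ^+ 2 by rewrite real_normK ?num_real.
apply: (@le_trans _ _ ((c * Num.sqrt (1 - s)) ^+ 2)).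
  rewrite lerXn2r ?nnegrE ?normr_ge0 ?(ltW e0)//.
  by near: n.
by rewrite exprMn sqr_sqrtr// subr_ge0 ltW//; case/andP: s01.
Unshelve. all: by end_near. Qed.

Lemma geom_boundedB h g D x D' x' : geom_bounded h D x -> geom_bounded g D' x' ->
  geom_bounded (fun k => h k - g k) (D + D') (Num.max x x').
Proof.
move=> [D0 /andP[x0 x1] hx] [D0' /andP[x0' x1'] hx']; split.
- exact: addr_ge0.
- by rewrite le_max x0/= gt_max x1.
- move=> n; apply: (le_trans (ler_normB _ _)); rewrite mulrDl; apply: lerD.
    apply: (le_trans (hx n)); rewrite ler_wpM2l// lerXn2r ?nnegrE ?le_max ?x0//.
    by rewrite lexx.
  apply: (le_trans (hx' n)); rewrite ler_wpM2l// lerXn2r ?nnegrE ?le_max ?x0//.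
  by rewrite lexx orbT.
Qed.

Lemma trigserB h g D x D' x' t : geom_bounded h D x -> geom_bounded g D' x' ->
  trigser (fun k => h k - g k) t = trigser h t - trigser g t.
Proof.
move=> hb gb.
have e f : (forall k, `|f k| <= 1) -> limn (series (fun k => (h k - g k) * f k)) =
    limn (series (fun k => h k * f k)) - limn (series (fun k => g k * f k)) :> R.
  move=> f1; have ch := geom_bounded_cvg hb f1; have cg := geom_bounded_cvg gb f1.
  rewrite -limB//; congr (lim (_ @ \oo)); apply/funext => n.
  change (series (fun k => (h k - g k) * f k) n =
    series (fun k => h k * f k) n - series (fun k => g k * f k) n).
  rewrite /series/= -sumrB; apply: eq_bigr => k _; exact: mulrBl.
rewrite /trigser !e => [|k|k]; [|exact: normr_sin_le1|exact: normr_cos_le1].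
by apply/eqP; rewrite eq_complex/= !eqxx.
Qed.

Lemma trigser_periodic h t : trigser h (t + 2 * pi) = trigser h t.
Proof.
rewrite /trigser; have c2 (k : nat) : cos (k%:R * (t + 2 * pi)) = cos (k%:R * t).
  by rewrite mulrDr cosD cos_2pi_int sin_2pi_int mulr1 mulr0 subr0.
have s2 (k : nat) : sin (k%:R * (t + 2 * pi)) = sin (k%:R * t).
  by rewrite mulrDr sinD cos_2pi_int sin_2pi_int mulr1 mulr0 addr0.
by under eq_fun do rewrite c2; under [in X in (_ +i* X)%C]eq_fun do rewrite s2.
Qed.

Lemma trigser_int_shift h D x a : geom_bounded h D x -> 0 <= a <= 2 * pi ->
  (\int[mu]_(t in `[0%R, (2 * pi)%R]) (normc (trigser h (t + a)))%:E =
   \int[mu]_(t in `[0%R, (2 * pi)%R]) (normc (trigser h t))%:E)%E.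
Proof.
move=> hb a2; have mh := measurable_normc_trigser hb.
rewrite -!integral_itv_bndo_bndc; last 2 first.
- by apply/measurable_EFinP; exact: measurable_funTS.
- apply/measurable_EFinP; apply: measurable_funTS; apply: (measurableT_comp mh).
  exact: measurable_funD.
apply: (@ge0_integral_periodic _ _ _ (fun t => (normc (trigser h t))%:E)) => //.
- exact/measurable_EFinP.
- by move=> t; rewrite lee_fin normc_ge0.
- by move=> t; rewrite trigser_periodic.
Qed.

(** A primitive of [(pi - t) * sin (k t)], by parts. For [k = 0] it is identically 0, the inverse of
    0 being 0. *)
Let hardy_prim (k : nat) t : R :=
  (t - pi) * (k%:R^-1 * cos (k%:R * t)) - k%:R^-1 ^+ 2 * sin (k%:R * t).

Let is_derive_hardy_prim (k : nat) t :
  is_derive t 1 (hardy_prim k) ((pi - t) * sin (k%:R * t)).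
Proof.
rewrite /hardy_prim; have [->|k0] := eqVneq k 0%N.
  rewrite (_ : (fun _ => _) = cst 0); last first.
    by apply/funext => u; rewrite invr0 expr0n !mul0r mulr0 subr0.
  by rewrite mul0r sin0 mulr0; exact: is_derive_cst.
set c : R := k%:R; have cN0 : c != 0 by rewrite pnatr_eq0.
have d1 : is_derive t 1 (fun t : R => c * t) c.
  have d0 := @is_deriveZ R R R id c t 1 1 (is_derive_id _ _).
  by apply: is_derive_eq d0 _; rewrite /GRing.scale/= mulr1.
have ds := @is_derive1_comp R sin (fun t : R => c * t) t _ _ (is_derive_sin _) d1.
have dc := @is_derive1_comp R cos (fun t : R => c * t) t _ _ (is_derive_cos _) d1.
have dl : is_derive t 1 (fun t : R => t - pi) 1.
  have d0 := is_deriveB (is_derive_id t (1 : R)) (is_derive_cst (pi : R) t 1).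
  by apply: is_derive_eq d0 _; rewrite subr0.
have dcZ := @is_deriveZ R R R _ c^-1 t 1 _ dc.
have dsZ := @is_deriveZ R R R _ (c^-1 ^+ 2) t 1 _ ds.
have := is_deriveB (is_deriveM dl dcZ) dsZ.
move=> d; apply: is_derive_eq d _; rewrite /GRing.scale/= /GRing.scale/=.
by field.
Qed.

Lemma normr_Im_le (z : R[i]) : `|complex.Im z| <= normc z.
Proof.
rewrite -(@ler_pXn2r _ 2)// ?nnegrE ?normr_ge0 ?normc_ge0// real_normK ?num_real//.
by rewrite normcE lerDr sqr_ge0.
Qed.

Lemma normr_Re_le (z : R[i]) : `|complex.Re z| <= normc z.
Proof.
rewrite -(@ler_pXn2r _ 2)// ?nnegrE ?normr_ge0 ?normc_ge0// real_normK ?num_real//.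
by rewrite normcE lerDl sqr_ge0.
Qed.

(* Hardy's inequality by duality: the bounded function [pi - t] has sine
   coefficients [2 / k]. *)
Lemma trigpoly_hardy h n :
  ((2 * \sum_(k < n) h k / k%:R)%:E <=
   \int[mu]_(t in `[0%R, (2 * pi)%R]) (normc (trigpoly h n t))%:E)%E.
Proof.
have p0 := pi_gt0 R.
pose f t := (pi - t) * complex.Im (trigpoly h n t).
have fE t : f t = \sum_(k < n) h k * ((pi - t) * sin (k%:R * t)).
  by rewrite /f trigpolyE/= mulr_sumr; apply: eq_bigr => k _; rewrite mulrCA.
have cf t : {for t, continuous f}.
  rewrite (funext fE); apply: continuous_bigsum => i.
  apply: cvgM; first exact: cvg_cst.
  apply: cvgM; first by apply: cvgB; [exact: cvg_cst|exact: cvg_id].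
  apply: (continuous_comp (g := sin)); last exact: continuous_sin.
  by apply: cvgM; [exact: cvg_cst|exact: cvg_id].
have mf D : measurable_fun D f.
  by apply: measurable_funTS; apply: continuous_measurable_fun => t; exact: cf.
have intf : (\int[mu]_(t in `[0%R, (2 * pi)%R]) (f t)%:E =
    (pi * (2 * \sum_(k < n) h k / k%:R))%:E)%E.
  pose F t := \sum_(k < n) h k * hardy_prim k t.
  transitivity (F (2 * pi) - F 0)%:E; last first.
    congr (_%:E); rewrite /F -sumrB !mulr_sumr; apply: eq_bigr => k _.
    rewrite /hardy_prim cos_2pi_int sin_2pi_int !mulr0 cos0 sin0; ring.
  apply: integral_is_derive => [|t _|t _]; [by rewrite mulr_ge0// ltW| |exact: cf].
  rewrite fE; apply: is_derive_bigsum => k.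
  exact: (@is_deriveZ R R R _ (h k) t 1 _ (is_derive_hardy_prim k t)).
rewrite -(@lee_pmul2l _ pi%:E) ?lte_fin// -EFinM -intf -ge0_integralZl//; last 3 first.
- by apply/measurable_EFinP; exact: measurable_normc_trigpoly.
- by move=> t _; rewrite lee_fin normc_ge0.
- by rewrite lee_fin ltW.
apply: (le_trans (lee_abs _)).
apply: (le_trans (le_abse_integral _ _ _)) => //; first by apply/measurable_EFinP; exact: mf.
apply: ge0_le_integral => //.
- by apply: measurableT_comp => //; apply/measurable_EFinP; exact: mf.
- by apply: measurable_funeM; apply/measurable_EFinP; exact: measurable_normc_trigpoly.
- move=> t; rewrite /= in_itv/= => /andP[t0 t2]; rewrite lee_fin normrM.
  by apply: ler_pM => //; [rewrite ler_norml; lra|exact: normr_Im_le].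
Qed.

(** Since [h] is nonnegative, every longer partial sum dominates the one of length [n], so the
    polynomial bound survives the limit. The term [k = 0] contributes 0. *)
Lemma trigser_hardy h D x n : geom_bounded h D x -> (forall k, 0 <= h k) ->
  ((2 * \sum_(k < n) h k / k%:R)%:E <=
   \int[mu]_(t in `[0%R, (2 * pi)%R]) (normc (trigser h t))%:E)%E.
Proof.
move=> hb h0; have cI := cvg_integral_trigpoly hb.
rewrite -(cvg_lim _ cI)//; apply: lime_ge; first by apply: cvgP; exact: cI.
exists n => // k /= nk; apply: le_trans (trigpoly_hardy h k).
rewrite lee_fin ler_wpM2l// -!(big_mkord xpredT (fun k => h k / k%:R)).
rewrite [leRHS](big_cat_nat (n := n))//= lerDl sumr_ge0// => i _.
by rewrite divr_ge0.
Qed.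
End trigonometric_polynomials.

(** * Integral means of the Bergman kernel *)

Section kernel.
Context {R : realType}.
Local Notation mu := (@lebesgue_measure R).
Local Notation normc := (@ComplexField.Normc.normc R).
Variable w : R -> R.
Hypotheses (rw : radial_weight w) (Dw : Dhat w).
Implicit Types (r s t : R).
Local Notation H := (omega_hat w).

(** Links the componentwise limits of [trigser] to the limit in modulus by which [Bker] is
    defined. *)
Lemma limn_complex (u : nat -> R[i]) (a b : R) :
  complex.Re (u n) @[n --> \oo] --> a -> complex.Im (u n) @[n --> \oo] --> b ->
  limn (u : nat -> R[i]^o) = (a +i* b)%C.
Proof.
move=> ca cb; apply: (@cvg_lim R[i]^o) => //.
apply/(@cvgrPdist_le _ R[i]^o) => -[e e'] /=; rewrite ltcE/= => /andP[/eqP-> e0].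
have h (c : R) (v : nat -> R) : v n @[n --> \oo] --> c -> c - v n @[n --> \oo] --> 0.
  by move=> cv; rewrite -(subrr c); apply: cvgB => //; exact: cvg_cst.
have cre : complex.Re ((a +i* b)%C - u n) @[n --> \oo] --> 0.
  rewrite (_ : (fun n => _) = fun n => a - complex.Re (u n)); first exact: h.
  by apply/funext => n; case: (u n).
have cim : complex.Im ((a +i* b)%C - u n) @[n --> \oo] --> 0.
  rewrite (_ : (fun n => _) = fun n => b - complex.Im (u n)); first exact: h.
  by apply/funext => n; case: (u n).
have := cvg_normc cre cim.
have -> : normc (0 +i* 0)%C = 0 :> R by rewrite /= !expr0n addr0 sqrtr0.
move=> /cvgr0Pnorm_le/(_ _ e0); apply: filterS => n.
rewrite ger0_norm ?normc_ge0// => ne.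
have -> : `|(a +i* b)%C - u n| = (normc ((a +i* b)%C - u n))%:C%C by case: (_ - _).
by rewrite -[(e +i* 0)%C]/(e%:C)%C lecR.
Qed.

Definition kcoef r k := coef w k * r ^+ k.

Lemma kcoef_ge0 r k : 0 <= r -> 0 <= kcoef r k.
Proof. by move=> r0; rewrite mulr_ge0 ?exprn_ge0// ltW// coef_gt0. Qed.

Lemma kcoef_bounded r : 0 <= r < 1 -> exists D x, geom_bounded (kcoef r) D x.
Proof.
move=> r01; have [D [x [D0 x01 h]]] := coef_geometric rw Dw r01.
have r0 : 0 <= r by case/andP: r01.
exists D, x; split => // n.
by rewrite ger0_norm; [exact: h|exact: kcoef_ge0].
Qed.

(** The modulus of the Bergman kernel when [conj z * zeta] has modulus [r] and argument [t]. *)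
Definition ker r t : R := normc (trigser (kcoef r) t).

Lemma normc_Bker (z zeta : R[i]) r t : 0 <= r < 1 ->
  conjc z * zeta = r%:C%C * expi t -> normc (Bker w z zeta) = ker r t.
Proof.
move=> r01 zE; rewrite /ker /Bker zE; congr normc.
have [D [x hb]] := kcoef_bounded r01.
rewrite (_ : series _ = (fun n => trigpoly (kcoef r) n t)); last first.
  apply/funext => n; rewrite /series/= big_mkord; apply: eq_bigr => k _.
  rewrite exprMn -rmorphXn/= /kcoef /coef -rmorphV/=; last first.
    by rewrite unitfE gt_eqF// mulr_gt0// moment_gt0.
  by rewrite [in RHS]rmorphM/= [LHS]mulrC mulrA.
apply: limn_complex.
- rewrite (_ : (fun n => _) = series (fun k => kcoef r k * cos (k%:R * t))).
    by apply: (geom_bounded_cvg hb) => k; exact: normr_cos_le1.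
  by apply/funext => n; exact: re_trigpoly.
- rewrite (_ : (fun n => _) = series (fun k => kcoef r k * sin (k%:R * t))).
    by apply: (geom_bounded_cvg hb) => k; exact: normr_sin_le1.
  by apply/funext => n; exact: im_trigpoly.
Qed.

Definition ker_int r : \bar R := (\int[mu]_(t in `[0%R, (2 * pi)%R]) (ker r t)%:E)%E.

Lemma ker_ge0 r t : 0 <= ker r t. Proof. exact: normc_ge0. Qed.

Lemma measurable_ker r : 0 <= r < 1 -> measurable_fun setT (ker r).
Proof. by move=> /kcoef_bounded[D [x]]; exact: measurable_normc_trigser. Qed.

Lemma ker_int_shift r a : 0 <= r < 1 -> 0 <= a <= 2 * pi ->
  (\int[mu]_(t in `[0%R, (2 * pi)%R]) (ker r (t + a))%:E = ker_int r)%E.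
Proof. by move=> /kcoef_bounded[D [x hb]] a2; exact: trigser_int_shift hb a2. Qed.

Lemma ker_periodic r t : ker r (t + 2 * pi) = ker r t.
Proof. by rewrite /ker trigser_periodic. Qed.

Lemma ker_int_ge r n : 0 <= r < 1 ->
  ((2 * \sum_(k < n) kcoef r k / k%:R)%:E <= ker_int r)%E.
Proof.
move=> r01; have [D [x hb]] := kcoef_bounded r01; apply: (trigser_hardy n hb) => k.
by apply: kcoef_ge0; case/andP: r01.
Qed.

Lemma subrX_le r s n : 0 <= r -> r <= s -> s ^+ n.+1 - r ^+ n.+1 <= n.+1%:R * s ^+ n * (s - r).
Proof.
move=> r0 rs; have s0 := le_trans r0 rs; rewrite subrXX [leRHS]mulrC ler_wpM2l ?subr_ge0//.
rewrite mulr_natl -[X in _ *+ X]card_ord -sumr_const; apply: ler_sum => i _.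
rewrite -[X in _ <= s ^+ X](subnK (ltn_ord i : i <= n)%N) exprD.
by rewrite ler_wpM2l ?exprn_ge0// lerXn2r.
Qed.

(** The bound for trigonometric series is applied to the difference [g] of the coefficients at [s]
    and [r]. Its twisted coefficients are at most [(A + 1) (s - r) coef k.+1 s ^ k], whose squares
    sum to at most a constant times [(s - r) ^ 2 / (H s ^ 2 (1 - s))]. The hypothesis
    [s - r <= L (1 - s)] turns this into the required multiple of [1 - s]. *)
Lemma ker_int_step : exists2 E, 0 < E & forall L r s, 0 < L -> 0 <= r -> r <= s -> s < 1 ->
  s - r <= L * (1 - s) -> (ker_int s <= ker_int r + (E * L / H s)%:E)%E.
Proof.
have [A A0 hA] := coef_diff rw Dw; have [B B0 hB] := coef_decay rw Dw.
pose E := 10 * pi * ((A + 1) * Num.sqrt B); have sB0 : 0 < Num.sqrt B by rewrite sqrtr_gt0.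
have E0 : 0 < E by rewrite !mulr_gt0 ?pi_gt0 ?addr_gt0.
exists E => // L r s L0 r0 rs s1 srL.
have s0 := le_trans r0 rs; have s01 : 0 <= s < 1 by rewrite s0.
have r01 : 0 <= r < 1 by rewrite r0 (le_lt_trans rs).
have Hs := omega_hat_gt0 rw s01; have s1' : 0 < 1 - s by rewrite subr_gt0.
have [D1 [x1 hb1]] := kcoef_bounded s01; have [D2 [x2 hb2]] := kcoef_bounded r01.
have hb := geom_boundedB hb1 hb2; set g := fun k => _ - _ in hb.
pose c := (A + 1) * Num.sqrt B * L / H s.
have c0 : 0 < c by rewrite divr_gt0// !mulr_gt0// addr_gt0.
have htw n : \sum_(k < n) twist s g k ^+ 2 <= c ^+ 2 * (1 - s).
  (* The constant coefficients of the two kernels coincide; for a single kernel this term would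
     carry no small factor. *)
  have tw0 : twist s g 0 = 0 by rewrite /twist /g /kcoef !expr0 subrr.
  have twS k : twist s g k.+1 ^+ 2 <=
      ((A + 1) * (s - r)) ^+ 2 * (B / H s ^+ 2) * s ^+ k.
    have [a0 a1] := (coef_gt0 rw k, coef_gt0 rw k.+1).
    have a01 := le_coefS rw Dw k; have /andP[d0 dA] := hA k.
    have sk : 0 <= s ^+ k by rewrite exprn_ge0.
    have rk : 0 <= r ^+ k <= s ^+ k by rewrite exprn_ge0//= lerXn2r.
    have dX := subrX_le k r0 rs.
    have dX0 : 0 <= s ^+ k.+1 - r ^+ k.+1 by rewrite subr_ge0 lerXn2r.
    have sr0 : 0 <= s - r by rewrite subr_ge0.
    (* One term for the variation of the coefficients, controlled by [coef_diff], where the factor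
       [k.+1] from the difference of powers is absorbed, and one for the variation of the radius. *)
    have -> : twist s g k.+1 = (coef w k.+1 - coef w k) * (s ^+ k.+1 - r ^+ k.+1) +
        coef w k * r ^+ k * (s - r).
      by rewrite /twist /g /kcoef !exprS; ring.
    set a := coef w k in a0 a01 d0 dA *; set b := coef w k.+1 in a1 a01 d0 dA *.
    have t0 : 0 <= (b - a) * (s ^+ k.+1 - r ^+ k.+1) + a * r ^+ k * (s - r).
      by case/andP: rk => ? _; rewrite addr_ge0// !mulr_ge0// ?subr_ge0// ltW.
    have t1 : (b - a) * (s ^+ k.+1 - r ^+ k.+1) + a * r ^+ k * (s - r) <=
        (A + 1) * (s - r) * (b * s ^+ k).
      have h1 : (b - a) * (s ^+ k.+1 - r ^+ k.+1) <= A * b * (s ^+ k * (s - r)).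
        apply: (@le_trans _ _ ((b - a) * (k.+1%:R * s ^+ k * (s - r)))).
          by rewrite ler_wpM2l// subr_ge0.
        rewrite (_ : _ * _ = k.+1%:R * (b - a) * (s ^+ k * (s - r))); last by ring.
        by rewrite ler_wpM2r// mulr_ge0.
      have h2 : a * r ^+ k * (s - r) <= b * s ^+ k * (s - r).
        by case/andP: rk => ? ?; rewrite ler_wpM2r// ler_pM// ltW.
      rewrite (_ : (A + 1) * (s - r) * (b * s ^+ k) = A * b * (s ^+ k * (s - r)) +
        b * s ^+ k * (s - r)); last by ring.
      exact: lerD.
    apply: (@le_trans _ _ (((A + 1) * (s - r) * (b * s ^+ k)) ^+ 2)).
      by rewrite lerXn2r ?nnegrE// (le_trans t0).
    have -> : ((A + 1) * (s - r) * (b * s ^+ k)) ^+ 2 =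
      ((A + 1) * (s - r)) ^+ 2 * (b ^+ 2 * s ^+ k) * s ^+ k by ring.
    by rewrite ler_wpM2r// ler_wpM2l ?sqr_ge0// hB.
  have Q0 : 0 <= ((A + 1) * (s - r)) ^+ 2 * (B / H s ^+ 2).
    by rewrite mulr_ge0 ?sqr_ge0// divr_ge0 ?sqr_ge0// ltW.
  case: n => [|n]; first by rewrite big_ord0 mulr_ge0 ?sqr_ge0// ltW.
  rewrite big_ord_recl tw0 expr0n add0r.
  apply: (@le_trans _ _ (\sum_(k < n) ((A + 1) * (s - r)) ^+ 2 * (B / H s ^+ 2) * s ^+ k)).
    by apply: ler_sum => k _; exact: twS.
  rewrite -mulr_sumr.
  apply: (le_trans (ler_wpM2l Q0 (sum_geometric_le n s01))).
  rewrite ler_pdivrMr// /c.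
  have -> : ((A + 1) * Num.sqrt B * L / H s) ^+ 2 * (1 - s) * (1 - s) =
      ((A + 1) * (L * (1 - s))) ^+ 2 * (Num.sqrt B ^+ 2 / H s ^+ 2).
    by field; rewrite gt_eqF.
  rewrite sqr_sqrtr ?(ltW B0)// ler_wpM2r ?divr_ge0 ?sqr_ge0 ?(ltW B0)//.
  have A1 : 0 <= A + 1 by rewrite addr_ge0// ltW.
  rewrite lerXn2r ?nnegrE ?mulr_ge0 ?subr_ge0 ?(ltW L0) ?(ltW s1)//.
  by rewrite ler_wpM2l.
have := trigser_L1_le hb s01 c0 htw.
have mS k : 0 <= k < 1 -> measurable_fun (`[0%R, (2 * pi)%R]%classic : set R)
    (fun t => (normc (trigser (kcoef k) t))%:E).
  by move=> k01; apply/measurable_EFinP; apply: measurable_funTS; exact: measurable_ker.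
have mg : measurable_fun (`[0%R, (2 * pi)%R]%classic : set R)
    (fun t => (normc (trigser g t))%:E).
  by apply/measurable_EFinP; apply: measurable_funTS; exact: measurable_normc_trigser hb.
have -> : 10 * pi * c = E * L / H s by rewrite /c /E !mulrA.
move=> gle; apply: (le_trans _ (leeD2l (ker_int r) gle)).
rewrite /ker_int -ge0_integralD//; last 3 first.
- by move=> t _; rewrite lee_fin ker_ge0.
- exact: mS.
- by move=> t _; rewrite lee_fin normc_ge0.
apply: ge0_le_integral => //.
- by move=> t _; rewrite lee_fin ker_ge0.
- exact: mS.
- by apply: emeasurable_funD => //; exact: mS.
- move=> t _; rewrite -EFinD lee_fin /ker (trigserB t hb1 hb2).
  have {1}-> : trigser (kcoef s) t = trigser (kcoef r) t + (trigser (kcoef s) t - trigser (kcoef r) t).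
    by rewrite addrC subrK.
  exact: ler_normcD.
Qed.

Lemma ker_int0_le : (ker_int 0 <= (2 * pi * coef w 0)%:E)%E.
Proof.
have pi0 := pi_gt0 R.
have hb : geom_bounded (kcoef 0) (coef w 0) 0.
  split => //; first exact/ltW/coef_gt0.
    by rewrite lexx ltr01.
  move=> n; rewrite /kcoef expr0n; case: n => [|n]; last by rewrite !mulr0 normr0.
  by rewrite mulr1 ger0_norm// ltW// coef_gt0.
rewrite /ker_int.
apply: (@le_trans _ _ (\int[mu]_(t in `[0%R, (2 * pi)%R]) (cst (coef w 0) t)%:E)%E).
  apply: ge0_le_integral => //.
  - by move=> t _; rewrite lee_fin ker_ge0.
  - apply/measurable_EFinP; apply: measurable_funTS; apply: measurable_ker.
    by rewrite lexx ltr01.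
  - by apply/measurable_EFinP; exact: measurable_cst.
  - by move=> t _; rewrite lee_fin; have := trigser_le t hb; rewrite subr0 divr1.
rewrite integral_cst_EFin// lebesgue_measure_itv/= lte_fin mulr_gt0//.
by rewrite -EFinB subr0 -EFinM mulrC.
Qed.

(** Induction on the number of steps of ratio [K] needed to come from [1 - r] back to at least
    [1 / K]. A step multiplies [1 / H] by at least [c > 1], so the bound at the previous radius
    shrinks by [1 / c] relative to the new one and leaves room for the increment. *)
Lemma ker_int_le : Dcheck w -> exists2 D, 0 < D &
  forall r, 0 <= r < 1 -> (ker_int r <= (D / H r)%:E)%E.
Proof.
move=> [K [c [K1 [c1 hc]]]]; have [E E0 step] := ker_int_step.
have K0 : 0 < K by apply: lt_trans K1.
have c0 : 0 < c by apply: lt_trans c1.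
have pi0 := pi_gt0 R; have a0 := coef_gt0 rw 0.
have H0 : 0 < H 0 by rewrite omega_hat_gt0// lexx ltr01.
have c1' : 0 < c - 1 by rewrite subr_gt0.
have EK : 0 <= E * K by rewrite mulr_ge0 ?ltW.
(* The first summand covers the constant kernel at radius 0. The second solves the fixed-point
   condition [D / c + E K <= D] of the induction, and [c / (c - 1)] is the sum of the geometric
   series of ratio [1 / c]. *)
pose D := 2 * pi * coef w 0 * H 0 + E * K * (c / (c - 1)).
have T0 : 0 < 2 * pi * coef w 0 * H 0 by rewrite !mulr_gt0.
have T1 : 0 < E * K * (c / (c - 1)) by rewrite mulr_gt0 ?divr_gt0// mulr_gt0.
have D0 : 0 < D by exact: addr_gt0.
have cc : 1 <= c / (c - 1) by rewrite ler_pdivlMr// mul1r; lra.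
have DE : D / c + E * K <= D.
  have e1 : E * K = E * K * (c / (c - 1)) * ((c - 1) / c) by field; rewrite !gt_eqF.
  have e2 : D * ((c - 1) / c) = D - D / c by field; rewrite gt_eqF.
  have : E * K <= D * ((c - 1) / c).
    by rewrite {1}e1 ler_wpM2r ?divr_ge0 ?(ltW c0) ?(ltW c1')// /D; lra.
  by rewrite e2; lra.
have small r : 0 <= r < 1 -> K^-1 <= 1 - r -> (ker_int r <= (D / H r)%:E)%E.
  move=> r01 Kr; have /andP[r0 r1] := r01; have Hr := omega_hat_gt0 rw r01.
  apply: (le_trans (step K 0 r K0 _ r0 r1 _)) => //.
    rewrite subr0; apply: (le_trans (ltW r1)).
    by rewrite mulrC -ler_pdivrMr// mul1r.
  apply: (le_trans (leeD2r _ ker_int0_le)); rewrite -EFinD lee_fin.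
  rewrite ler_pdivlMr// mulrDl divfK ?gt_eqF// /D; apply: lerD.
    by rewrite ler_wpM2l ?le_omega_hat// !mulr_ge0 ?ltW.
  by rewrite ler_peMr.
exists D => // r r01; have [n rn] : exists n, K^-1 ^+ n <= 1 - r.
  have r1' : 0 < 1 - r by rewrite subr_gt0; case/andP: r01.
  have : 1 * K^-1 ^+ n @[n --> \oo] --> (0 : R).
    by apply: cvg_geometric; rewrite ger0_norm ?invf_lt1// invr_ge0 ltW.
  move=> /cvgr0Pnorm_le/(_ _ r1')[N _ /(_ N (leqnn N))] hN; exists N.
  by apply: le_trans hN; rewrite mul1r ler_norm.
elim: n r r01 rn => [|n IH] r r01 rn; have /andP[r0 r1] := r01.
  apply: small => //; apply: le_trans rn; rewrite expr0 invf_le1//; exact: ltW.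
have [Kr|Kr] := leP K^-1 (1 - r); first exact: small.
have Kr1 : K * (1 - r) < 1.
  by rewrite mulrC -ltr_pdivlMr// mul1r.
(* The previous radius: reverse doubling at [t] compares [H t] with [H r]. *)
pose t := 1 - K * (1 - r).
have r1' : 0 < 1 - r by rewrite subr_gt0.
have tr : t <= r by rewrite /t; nra.
have t0 : 0 <= t by rewrite /t; lra.
have t01 : 0 <= t < 1 by rewrite t0 (le_lt_trans tr).
have Hr := omega_hat_gt0 rw r01; have Ht := omega_hat_gt0 rw t01.
have tn : K^-1 ^+ n <= 1 - t.
  by rewrite /t opprB addrC subrK -ler_pdivrMl// mulrC -exprSr.
have rt : r - t <= K * (1 - r) by rewrite /t; nra.
apply: (le_trans (step K t r K0 t0 tr r1 rt)).
apply: (le_trans (leeD2r _ (IH t t01 tn))); rewrite -EFinD lee_fin.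
have hH : c * H r <= H t.
  have := hc t t01; have -> // : 1 - (1 - t) / K = r.
  by rewrite /t; field; rewrite gt_eqF.
apply: (@le_trans _ _ (D / (c * H r) + E * K / H r)).
  by rewrite lerD2r ler_wpM2l ?(ltW D0)// lef_pV2 ?posrE// mulr_gt0.
rewrite (_ : D / (c * H r) = D / c / H r); last by field; rewrite !gt_eqF.
by rewrite -mulrDl ler_wpM2r// invr_ge0 ltW.
Qed.
End kernel.

(** * Schur tests *)

Section jensen.
Context d (T : measurableType d) (R : realType) (mu : {measure set T -> \bar R}).
Local Open Scope ereal_scope.

(** Jensen's inequality for the measure with density [h], whose total mass enters with the power
    [p - 1]. It is Hoelder's inequality for [g h^{1/p}] and [h^{1/p'}]. *)
Lemma integral_powR_le (p : R) (g h : T -> R) : (1 < p)%R ->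
    measurable_fun setT g -> measurable_fun setT h ->
    (forall x, 0 <= g x)%R -> (forall x, 0 <= h x)%R ->
  (\int[mu]_x (g x * h x)%:E) `^ p <=
  \int[mu]_x (g x `^ p * h x)%:E * (\int[mu]_x (h x)%:E) `^ (p - 1).
Proof.
move=> p1 mg mh g0 h0; have p0 : (0 < p)%R by apply: lt_trans p1.
have p10 : (0 < p - 1)%R by rewrite subr_gt0.
pose p' := (p / (p - 1))%R; have p'0 : (0 < p')%R by rewrite divr_gt0.
have pp' : (p^-1 + p'^-1 = 1)%R by rewrite /p'; field; rewrite !gt_eqF.
pose F x := (g x * h x `^ p^-1)%R; pose G x := (h x `^ p'^-1)%R.
have mpow (f : T -> R) (a : R) : measurable_fun setT f -> measurable_fun setT (fun x => f x `^ a)%R.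
  by move=> mf; apply: (measurableT_comp (measurable_powR a)).
have mF : measurable_fun setT F by apply: measurable_funM => //; exact: mpow.
have mG : measurable_fun setT G by exact: mpow.
have := @hoelder _ _ _ mu F G p p' mF mG p0 p'0 pp'.
rewrite Lnorm1 => hold.
have FG x : (F x * G x = g x * h x)%R.
  rewrite /F /G -mulrA -powRD ?pp' ?powRr1//.
  by rewrite oner_eq0.
have {}hold : \int[mu]_x (g x * h x)%:E <= 'N[mu]_p%:E[EFin \o F] * 'N[mu]_p'%:E[EFin \o G].
  apply: le_trans hold; rewrite le_eqVlt; apply/orP; left; apply/eqP.
  by apply: eq_integral => x _; rewrite /= FG ger0_norm// mulr_ge0.
have i0 : 0 <= \int[mu]_x (g x * h x)%:E.
  by apply: integral_ge0 => x _; rewrite lee_fin mulr_ge0.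
apply: (@le_trans _ _ (('N[mu]_p%:E[EFin \o F] * 'N[mu]_p'%:E[EFin \o G]) `^ p)).
  by apply: gt0_ler_poweR => //; rewrite ?in_itv/= ?leey ?andbT ?mule_ge0 ?Lnorm_ge0 ?(ltW p0).
rewrite poweRM ?Lnorm_ge0// poweR_Lnorm ?gt_eqF//.
rewrite le_eqVlt; apply/orP; left; apply/eqP; congr (_ * _).
  apply: eq_integral => x _; rewrite /=; congr (_%:E).
  rewrite ger0_norm ?mulr_ge0 ?powR_ge0// powRM ?powR_ge0// -powRrM mulVf ?gt_eqF//.
  by rewrite powRr1.
rewrite unlock -poweRrM (_ : p'^-1 * p = p - 1)%R; last first.
  by rewrite /p'; field; rewrite !gt_eqF.
congr (_ `^ _); apply: eq_integral => x _; rewrite /=; congr (_%:E).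
by rewrite ger0_norm ?powR_ge0// -powRrM mulVf ?gt_eqF// powRr1.
Qed.
End jensen.

Section schur.
Context {R : realType}.
Local Notation mu := (@lebesgue_measure R).
Variable w : R -> R.
Hypotheses (rw : radial_weight w).
Implicit Types (r s t u : R).
Local Notation H := (omega_hat w).
Local Notation J := (`[0%R, 1%R[%classic : set R).

Lemma measurable_level u :
  measurable_fun J (fun s => (if H s <= u then w s else 0)%:E).
Proof.
apply/measurable_EFinP; apply: measurable_fun_if => //.
- by apply: measurable_fun_ler => //; exact: measurable_omega_hat.
- by apply: measurable_funS (measurable_weight rw) => //; exact: subIsetl.
Qed.

(** Formally [w ds = - dH], so the values of [H] are distributed under the weight like Lebesgue
    measure. As [H] is monotone, the level set lies in [[t, 1[] with [t] its infimum. *)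
Lemma level_mass u : 0 <= u ->
  (\int[mu]_(s in J) (if H s <= u then w s else 0)%:E <= u%:E)%E.
Proof.
move=> u0; pose E := J `&` [set s | H s <= u].
have [[e Ee]|E0] := pselect (exists e, E e); last first.
  rewrite integral0_eq ?lee_fin// => s sJ; case: ifPn => // Hs.
  by exfalso; apply: E0; exists s.
have hiE : has_inf E.
  split; first by exists e.
  by exists 0 => x [+ _]; rewrite /= in_itv/= => /andP[].
pose t := inf E.
have t0 : 0 <= t.
  apply: lb_le_inf; first by exists e.
  by move=> x [+ _]; rewrite /= in_itv/= => /andP[].
have t1 : t < 1.
  apply: le_lt_trans (ge_inf hiE.2 Ee) _.
  by case: Ee => + _; rewrite /= in_itv/= => /andP[].
have mw := measurable_weight_itv rw t0.
have sub : `]t, 1%R[ `<=` `[t, 1%R[ by apply: subset_itvr; rewrite bnd_simp.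
have w0 s : `[t, 1%R[%classic s -> (0 <= (w s)%:E)%E.
  by move=> /(itv_sub_unit t0); rewrite lee_fin; exact: weight_ge0.
apply: (@le_trans _ _ (\int[mu]_(s in `]t, 1%R[) (w s)%:E)%E).
  rewrite integral_itv_obnd_cbnd; last by apply: measurable_funS mw.
  rewrite integral_mkcond [leRHS]integral_mkcond; apply: ge0_le_integral => //.
  - move=> s _; rewrite patchE; case: ifPn => // /set_mem sJ.
    by rewrite lee_fin; case: ifP => // _; exact: weight_ge0 sJ.
  - apply/(measurable_restrictT _ _).1 => //; exact: measurable_level.
  - by apply/(measurable_restrictT _ _).1.
  - move=> s _; rewrite !patchE; case: ifPn => sJ; last first.
      by case: ifPn => // /set_mem; exact: w0.
    case: ifPn => Hs; last first.
      by case: ifPn => // /set_mem; exact: w0.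
    rewrite ifT// inE/= in_itv/=; move: (sJ); rewrite inE/= in_itv/= => /andP[_ ->].
    rewrite andbT; apply: (ge_inf hiE.2); split => //; exact: set_mem sJ.
(* The infimum need not belong to the level set, so the mass beyond [t] is approached from the
   right; the offset [n.+2] keeps the left end below 1. *)
pose F n := `[(t + (1 - t) / n.+2%:R)%R, 1%R[%classic : set R.
have F_t n : t < t + (1 - t) / n.+2%:R by rewrite ltrDl divr_gt0// subr_gt0.
have tF n : t + (1 - t) / n.+2%:R < 1.
  by rewrite -ltrBrDl ltr_pdivrMr// ltr_pMr ?subr_gt0// ltr1n.
have FE : \bigcup_n F n = `]t, 1%R[%classic.
  apply/seteqP; split => [s [n _]|s]; rewrite /F/= !in_itv/=.
    by move=> /andP[Fs ->]; rewrite (lt_le_trans (F_t n) Fs).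
  move=> /andP[ts s1]; have st0 : 0 < s - t by rewrite subr_gt0.
  exists (Num.truncn ((1 - t) / (s - t))) => //=; rewrite /F/= in_itv/= s1 andbT.
  rewrite -lerBrDl ler_pdivrMr// mulrC -ler_pdivrMr//.
  by apply: ltW; apply: lt_trans (truncnS_gt _) _; rewrite ltr_nat.
have nd : nondecreasing_seq F.
  move=> m n mn; apply/subsetPset; apply: subset_itvr; rewrite bnd_simp lerD2l.
  by rewrite ler_wpM2l ?subr_ge0 ?(ltW t1)// lef_pV2 ?posrE// ler_nat.
have Fsub n : F n `<=` `[t, 1%R[%classic.
  by apply: subset_itvr; rewrite bnd_simp ltW.
have cF : (\int[mu]_(x in F i) (w x)%:E)%E @[i --> \oo] -->
    (\int[mu]_(x in \bigcup_i F i) (w x)%:E)%E.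
  apply: ge0_nondecreasing_set_cvg_integral => //.
  - by move=> n; exact: measurable_itv.
  - by move=> n; apply: measurable_funS mw => //; exact: Fsub.
  - by move=> n x /Fsub; exact: w0.
rewrite -FE -(cvg_lim _ cF)//; apply: lime_le; first by apply: cvgP; exact: cF.
apply: nearW => n; rewrite -omega_hatE ?(le_trans t0 (ltW (F_t n)))// lee_fin.
(* To the left of this end, which exceeds the infimum, there is a point of [E], and [H] is at most
   [u] from that point on. *)
have : ~ (lbound E (t + (1 - t) / n.+2%:R)).
  by move=> /(lb_le_inf (ex_intro _ _ Ee)); rewrite leNgt F_t.
move=> /existsNP[x /not_implyP[Ex /negP]]; rewrite -ltNge => xF.
case: Ex => + Hx; rewrite /= in_itv/= => /andP[x0 _].
by apply: le_trans Hx; apply: le_omega_hat => //; exact: ltW.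
Qed.

Lemma exists_dyadic (x : R) : 1 <= x -> exists k, 2 ^+ k <= x < 2 ^+ k.+1.
Proof.
move=> x1; have x0 : 0 <= x by apply: le_trans x1.
have n0 : (0 < Num.truncn x)%N by rewrite truncn_gt0.
have /andP[h1 h2] := trunc_log_bounds (isT : (1 < 2)%N) n0.
exists (trunc_log 2 (Num.truncn x)); apply/andP; split.
  by rewrite -natrX; apply: (@le_trans _ _ (Num.truncn x)%:R); rewrite ?ler_nat ?truncn_le.
by apply: (lt_le_trans (truncnS_gt x)); rewrite -natrX ler_nat.
Qed.

Lemma le_powRN (al x y : R) : 0 <= al -> 0 < x -> x <= y -> y `^ (- al) <= x `^ (- al).
Proof.
move=> al0 x0 xy; have y0 := lt_le_trans x0 xy.
rewrite !powRN lef_pV2 ?posrE; [|exact: powR_gt0..].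
by apply: ge0_ler_powR; rewrite // nnegrE ltW.
Qed.

(* The weight is decomposed along the dyadic levels of [H], which have mass
   comparable with their height. *)
Lemma schur_integral (al : R) : 0 < al < 1 -> exists2 C, 0 < C &
  forall r, 0 <= r < 1 ->
    (\int[mu]_(s in J) (H s `^ (- al) / Num.max (H r) (H s) * w s)%:E <=
     (C * H r `^ (- al))%:E)%E.
Proof.
move=> /andP[al0 al1]; pose a := 2 `^ al.
have ln2 : 0 < ln 2 :> R by rewrite ln_gt0// ltr1n.
have aE : a = expR (al * ln 2) by rewrite /a /powR pnatr_eq0.
have a1 : 1 < a by rewrite aE expR_gt1 mulr_gt0.
have a2 : a < 2 by rewrite aE -[ltRHS]lnK ?posrE// ltr_expR gtr_pMl.
have a0 : 0 < a by apply: lt_trans a1.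
have q1 : 0 <= a / 2 < 1 by rewrite divr_ge0 ?(ltW a0)//= ltr_pdivrMr// mul1r.
have q2 : 0 <= a^-1 < 1 by rewrite invr_ge0 (ltW a0)/= invf_lt1.
pose C := a * (1 - a / 2)^-1 + 2 * (1 - a^-1)^-1.
have C0 : 0 < C.
  by rewrite addr_gt0// mulr_gt0// invr_gt0 subr_gt0; [case/andP: q1|case/andP: q2].
exists C => // r r01; have R0 := omega_hat_gt0 rw r01; set b := _ `^ _; set Q := H r in b R0 *.
have b0 : 0 < b by exact: powR_gt0.
have pow2 k : (2 ^+ k : R) `^ al = a ^+ k.
  by rewrite -powR_mulrn// -powRrM mulrC powRrM powR_mulrn// ltW.
(* [T1 k] bounds the factor of [w] where [H] lies between [Q / 2 ^ k.+1] and [Q / 2 ^ k], and [T2 k]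
   where it lies between [2 ^ k * Q] and [2 ^ k.+1 * Q]. Times the masses of the levels they give
   geometric series of ratios [a / 2] and [1 / a]; this is where [al < 1] and [al > 0] enter. *)
pose T1 k := b / Q * a ^+ k.+1; pose T2 k := b / Q * (a^-1 / 2) ^+ k.
have T10 k : 0 <= T1 k by rewrite !mulr_ge0 ?exprn_ge0 ?invr_ge0 ?(ltW a0) ?(ltW b0) ?(ltW R0).
have T20 k : 0 <= T2 k.
  by rewrite mulr_ge0 ?exprn_ge0 ?divr_ge0 ?invr_ge0 ?(ltW a0) ?(ltW b0) ?(ltW R0).
pose f u s := (if H s <= u then w s else 0).
pose T k s := ((T1 k)%:E * (f (Q / 2 ^+ k) s)%:E + (T2 k)%:E * (f (2 ^+ k.+1 * Q) s)%:E)%E.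
have f0 u s : J s -> (0 <= (f u s)%:E)%E.
  by move=> sJ; rewrite /f lee_fin; case: ifP => // _; exact: weight_ge0 sJ.
have fc c u s : 0 <= c -> J s -> (0 <= c%:E * (f u s)%:E)%E.
  by move=> c0 sJ; apply: mule_ge0; [rewrite lee_fin|exact: f0].
have T0 k s : J s -> (0 <= T k s)%E.
  by move=> sJ; apply: adde_ge0; exact: fc.
have mf u : measurable_fun J (fun s => (f u s)%:E) by exact: measurable_level.
have mT k : measurable_fun J (T k) by apply: emeasurable_funD; exact: measurable_funeM.
have Zl c u : 0 <= c ->
    (\int[mu]_(s in J) (c%:E * (f u s)%:E) = c%:E * \int[mu]_(s in J) (f u s)%:E)%E.
  move=> c0; apply: ge0_integralZl => //; [exact: mf|by move=> s; exact: f0].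
have ptw s : J s -> ((H s `^ (- al) / Num.max Q (H s) * w s)%:E <= \sum_(k <oo) T k s)%E.
  move=> sJ; have ws := weight_ge0 rw sJ.
  have u0 : 0 < H s by apply: omega_hat_gt0 => //; move: sJ; rewrite /= in_itv.
  suff [k hk] : exists k, ((H s `^ (- al) / Num.max Q (H s) * w s)%:E <= T k s)%E.
    apply: (le_trans hk); apply: le_trans (nneseries_lim_ge k.+1 _); last first.
      by move=> n _ _; exact: T0.
    rewrite big_nat_recr//= leeDr// sume_ge0// => n _; exact: T0.
  have mono x : 0 < x -> x <= H s -> H s `^ (- al) <= x `^ (- al).
    by move=> x0; apply: le_powRN => //; exact: ltW.
  have [uQ|uQ] := leP (H s) Q.
    have [|k /andP[k1 k2]] := @exists_dyadic (Q / H s); first by rewrite ler_pdivlMr// mul1r.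
    exists k; rewrite /T; apply: (@le_trans _ _ ((T1 k)%:E * (f (Q / 2 ^+ k) s)%:E)%E); last first.
      by rewrite leeDl// fc.
    have Hk : H s <= Q / 2 ^+ k.
      by rewrite ler_pdivlMr ?exprn_gt0// mulrC -ler_pdivlMr.
    rewrite /f Hk -EFinM lee_fin ler_wpM2r// /T1 mulrAC ler_wpM2r ?invr_ge0 ?(ltW R0)//.
    have Hk2 : Q / 2 ^+ k.+1 <= H s.
      by rewrite ler_pdivrMr ?exprn_gt0// mulrC -ler_pdivrMr// ltW.
    apply: (le_trans (mono _ _ Hk2)); first by rewrite divr_gt0// exprn_gt0.
    rewrite powRM ?invr_ge0 ?exprn_ge0 ?(ltW R0)// -/b ler_wpM2l ?(ltW b0)//.
    by rewrite -powR_inv1 ?exprn_ge0// -powRrM mulN1r opprK pow2.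
  have [|k /andP[k1 k2]] := @exists_dyadic (H s / Q); first by rewrite ler_pdivlMr// mul1r ltW.
  exists k; rewrite /T; apply: (@le_trans _ _ ((T2 k)%:E * (f (2 ^+ k.+1 * Q) s)%:E)%E); last first.
    by rewrite leeDr// fc.
  have Hk : H s <= 2 ^+ k.+1 * Q by rewrite -ler_pdivrMr// ltW.
  have Hk2 : 2 ^+ k * Q <= H s by rewrite -ler_pdivlMr.
  have kQ : 0 < 2 ^+ k * Q by rewrite mulr_gt0// exprn_gt0.
  rewrite /f Hk -EFinM lee_fin ler_wpM2r// /T2.
  rewrite (_ : b / Q * (a^-1 / 2) ^+ k = (a ^- k * b) * (2 ^+ k * Q)^-1); last first.
    by rewrite exprMn !exprVn; field; rewrite ?gt_eqF ?exprn_gt0.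
  apply: ler_pM; rewrite ?powR_ge0 ?invr_ge0 ?(ltW u0)//.
    apply: (le_trans (mono _ kQ Hk2)); rewrite powRM ?exprn_ge0 ?(ltW R0)// -/b.
    by rewrite powRN pow2.
  by rewrite lef_pV2 ?posrE.
apply: (@le_trans _ _ (\int[mu]_(s in J) (\sum_(k <oo) T k s))%E).
  apply: ge0_le_integral => //.
  - move=> s sJ; have ws := weight_ge0 rw sJ.
    by rewrite lee_fin mulr_ge0// divr_ge0 ?powR_ge0// le_max (ltW R0).
  - apply/measurable_EFinP; apply: measurable_funM; last exact: measurable_weight.
    have mH := measurable_omega_hat rw.
    apply: measurable_funM; first exact: (measurableT_comp (measurable_powR _)).
    apply: (eq_measurable_fun (fun s => Num.max Q (H s) `^ (-1))).
      by move=> s _; rewrite powR_inv1// le_max (ltW R0).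
    by apply: (measurableT_comp (measurable_powR _)); exact: measurable_maxr.
  - apply: (@ge0_emeasurable_sum _ _ _ _ T xpredT) => // k s sJ _.
    exact: T0.
rewrite integral_nneseries//; apply: lime_le.
  by apply: is_cvg_nneseries => n _ _; apply: integral_ge0 => s sJ; exact: T0.
apply: nearW => n; apply: (@le_trans _ _ (\sum_(0 <= k < n) (b * (a * (a / 2) ^+ k + 2 * a^-1 ^+ k))%:E)%E).
  apply: lee_sum => k _.
  rewrite ge0_integralD//; last 4 first.
  - by move=> s sJ; exact: fc.
  - by apply: measurable_funeM; exact: mf.
  - by move=> s sJ; exact: fc.
  - by apply: measurable_funeM; exact: mf.
  rewrite !Zl//.
  apply: (@le_trans _ _ ((T1 k)%:E * (Q / 2 ^+ k)%:E + (T2 k)%:E * (2 ^+ k.+1 * Q)%:E)%E).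
    apply: leeD; apply: lee_wpmul2l; rewrite ?lee_fin//; apply: level_mass => //.
      by rewrite divr_ge0 ?exprn_ge0 ?(ltW R0).
    by rewrite mulr_ge0 ?exprn_ge0 ?(ltW R0).
  rewrite -!EFinM -EFinD lee_fin /T1 /T2 !exprMn !exprVn !exprS le_eqVlt; apply/orP; left.
  by apply/eqP; field; rewrite ?gt_eqF ?exprn_gt0.
rewrite sumEFin lee_fin -mulr_sumr mulrC ler_wpM2r ?(ltW b0)// big_split/=.
rewrite -!mulr_sumr !big_mkord /C; apply: lerD.
  by rewrite ler_wpM2l ?(ltW a0)// sum_geometric_le.
by rewrite ler_wpM2l// sum_geometric_le.
Qed.
End schur.

(** * Polar coordinates in the unit disc *)

Section polar_form.
Context {R : realType}.
Local Notation mu := (@lebesgue_measure R).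
Local Notation normc := (@ComplexField.Normc.normc R).
Local Notation J := (`[0%R, 1%R[%classic : set R).
Local Notation I2pi := (`[0%R, (2 * pi)%R]%classic : set R).

Definition polar (rt : R * R) : R * R := (rt.1 * cos rt.2, rt.1 * sin rt.2).

Lemma unit_circle (x y : R) : x ^+ 2 + y ^+ 2 = 1 ->
  exists2 t, 0 <= t <= 2 * pi & (x = cos t) /\ (y = sin t).
Proof.
move=> xy; have x1 : -1 <= x <= 1 by apply/andP; split; nra.
have xin : x \in `[-1, 1] by rewrite in_itv.
have a0 : 0 <= acos x <= pi by rewrite acos_ge0// acos_lepi.
have sa : sin (acos x) = `|y|.
  by rewrite sin_acos// (_ : 1 - x ^+ 2 = y ^+ 2) ?sqrtr_sqr//; lra.
have [y0|y0] := leP 0 y.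
  exists (acos x); last by rewrite acosK// sa ger0_norm.
  by have := pi_gt0 R; lra.
exists (2 * pi - acos x); first by have := pi_gt0 R; lra.
rewrite addrC mulr_natl cosD2pi sinD2pi cosN sinN acosK// sa ltr0_norm//.
by rewrite opprK.
Qed.

Lemma polar_form (z : R[i]) : exists2 t, 0 <= t <= 2 * pi &
  z = (normc z)%:C%C * expi t.
Proof.
have [z0|z0] := eqVneq (normc z) 0.
  exists 0; first by rewrite lexx mulr_ge0// pi_ge0.
  by rewrite (ComplexField.Normc.eq0_normc z0) ComplexField.Normc.normc0 mul0r.
have [|t t2 [hx hy]] := @unit_circle (complex.Re z / normc z) (complex.Im z / normc z).
  rewrite !expr_div_n -mulrDl -normcE divff// expf_neq0//.
exists t => //; apply/eqP; rewrite /expi -hx -hy eq_complex/= !mul0r subr0 addr0.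
by rewrite ![normc z * _]mulrC !divfK// !eqxx.
Qed.

Lemma toC_polar r t : toC (polar (r, t)) = r%:C%C * expi t.
Proof. by rewrite /toC /polar /expi/=; apply/eqP; rewrite eq_complex/= !mul0r subr0 addr0 !eqxx. Qed.

Lemma normc_toC (z : R * R) : normc (toC z) = Num.sqrt (z.1 ^+ 2 + z.2 ^+ 2).
Proof. by []. Qed.

Lemma normc_polar r t : normc (toC (polar (r, t))) = `|r|.
Proof. by rewrite toC_polar ComplexField.Normc.normcM normc_expi mulr1 normcR. Qed.

Lemma disc_polar r t : 0 <= r -> disc (polar (r, t)) <-> r < 1.
Proof.
move=> r0; rewrite /disc/= /polar/= !exprMn -mulrDr cos2Dsin2 mulr1.
by rewrite -[X in _ < X](expr1n _ 2) ltr_pXn2r ?nnegrE.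
Qed.

Lemma disc_normc (z : R * R) : disc z <-> normc (toC z) < 1.
Proof.
rewrite normc_toC /disc/=; set x := _ + _.
have x0 : 0 <= x by rewrite addr_ge0 ?sqr_ge0.
by rewrite -[X in _ <-> is_true (_ < X)]sqrtr1 ltr_sqrt.
Qed.

Lemma measurable_polar : measurable_fun setT polar.
Proof.
apply: measurable_fun_pair; apply: measurable_funM => //; apply: measurableT_comp => //.
  by apply: continuous_measurable_fun; exact: continuous_cos.
by apply: continuous_measurable_fun; exact: continuous_sin.
Qed.

Lemma measurable_disc : measurable (@disc R).
Proof.
rewrite -[disc]setTI; apply: measurable_fun_ltr => //.
by apply: measurable_funD; apply: measurable_funX.
Qed.

Lemma ge0_integral_disc (g : R * R -> \bar R) :
    measurable_fun disc g -> (forall z, disc z -> 0 <= g z)%E ->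
  (\int[leb2]_(z in disc) g z =
   \int[mu]_(s in J) \int[mu]_(t in I2pi) (g (polar (s, t)) * s%:E))%E.
Proof.
move=> mg g0; have mg' := (measurable_restrictT g measurable_disc).1 mg.
have g'0 z : (0 <= (g \_ disc) z)%E.
  by rewrite patchE; case: ifPn => // /set_mem; exact: g0.
rewrite integral_mkcond (ge0_polar mg' g'0) integral_mkcond [RHS]integral_mkcond.
apply: eq_integral => s _; rewrite !patchE mem_setE/= in_itv/= andbT.
rewrite mem_setE/= in_itv/= le_eqVlt.
(* The radius 0, excluded by the general formula and included in [J], contributes nothing because
   the Jacobian vanishes. *)
case: ifPn => [s0|]; last first.
  rewrite orbF => _; case: ifPn => // /andP[/eqP <- _].
  by rewrite integral0_eq// => t _; rewrite mule0.
rewrite orbT/=.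
have dE t : ((polar (s, t)) \in @disc R) = (s < 1).
  by apply/idP/idP => [/set_mem/(disc_polar t (ltW s0))//|s1]; apply/mem_set/disc_polar => //; exact: ltW.
have gE t : (g \_ disc) (s * cos t, s * sin t) = if s < 1 then g (polar (s, t)) else 0%E.
  by rewrite patchE -[(_, _)]/(polar (s, t)) dE.
under eq_integral do rewrite gE.
case: ifPn => s1; last by rewrite integral0_eq// => t _; rewrite mul0e.
apply: integral_itv_bndo_bndc.
have mp : measurable_fun (setT : set R) (fun t => polar (s, t)).
  exact: (measurableT_comp measurable_polar (pair1_measurable s)).
have : measurable_fun (setT : set R) (fun t => (g \_ disc) (polar (s, t)) * s%:E)%E.
  by apply: emeasurable_funM => //; exact: (measurableT_comp mg' mp).
rewrite (_ : (fun t => _) = fun t => g (polar (s, t)) * s%:E)%E.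
  by apply: measurable_funS.
by apply/funext => t; rewrite gE s1.
Qed.
End polar_form.

Section schur_test.
Context d1 d2 (X : measurableType d1) (Y : measurableType d2) (R : realType).
Variables (mu : {sigma_finite_measure set X -> \bar R}) (nu : {sigma_finite_measure set Y -> \bar R}).
Local Open Scope ereal_scope.

(** For fixed [x], Jensen's inequality for the measure with density [phi y * k (x, y)], applied to
    [u / phi]; then Tonelli. The usual second hypothesis is left as an inner integral, since the two
    applications treat it differently. [rho] is a density in [x], and the first hypothesis concerns
    only the points it charges. *)
Lemma schur_test (p C : R) (k : X * Y -> R) (u phi : Y -> R) (rho psi : X -> R) :
    (1 < p)%R -> (0 <= C)%R ->
    measurable_fun setT k -> (forall z, 0 <= k z)%R ->
    measurable_fun setT u -> (forall y, 0 <= u y)%R ->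
    measurable_fun setT phi -> (forall y, 0 < phi y)%R ->
    measurable_fun setT rho -> (forall x, 0 <= rho x)%R ->
    measurable_fun setT psi -> (forall x, 0 <= psi x)%R ->
    (forall x, rho x != 0%R -> \int[nu]_y (phi y * k (x, y))%:E <= (C * psi x)%:E) ->
  \int[mu]_x ((rho x)%:E * (\int[nu]_y (u y * k (x, y))%:E) `^ p) <=
  (C `^ (p - 1))%:E * \int[nu]_y ((u y `^ p * phi y `^ (1 - p))%:E *
     \int[mu]_x (rho x * psi x `^ (p - 1) * k (x, y))%:E).
Proof.
move=> p1 C0 mk k0 mU u0 mphi phi0 mrho rho0 mpsi psi0 hC.
have p0 : (0 < p)%R by apply: lt_trans p1.
have p10 : (0 < p - 1)%R by rewrite subr_gt0.
have mpow d (T : measurableType d) (f : T -> R) (a : R) :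
    measurable_fun setT f -> measurable_fun setT (fun x => f x `^ a)%R.
  by move=> mf; apply: (measurableT_comp (measurable_powR a)).
pose v y := (u y `^ p * phi y `^ (1 - p))%R.
have v0 y : (0 <= v y)%R by rewrite mulr_ge0 ?powR_ge0.
have mv : measurable_fun setT v by apply: measurable_funM; exact: mpow.
pose c x := (rho x * psi x `^ (p - 1))%R.
have c0 x : (0 <= c x)%R by rewrite mulr_ge0 ?powR_ge0.
have mc : measurable_fun setT c by apply: measurable_funM => //; exact: mpow.
have mk1 x : measurable_fun setT (fun y => k (x, y)).
  exact: (measurableT_comp mk (pair1_measurable x)).
pose F (z : X * Y) := (v z.2 * (c z.1 * k z))%:E.
have mF : measurable_fun setT F.
  apply/measurable_EFinP; apply: measurable_funM; first exact: measurableT_comp.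
  by apply: measurable_funM => //; exact: measurableT_comp.
have F0 z : 0 <= F z by rewrite lee_fin; apply: mulr_ge0 => //; exact: mulr_ge0.
have step x : (rho x)%:E * (\int[nu]_y (u y * k (x, y))%:E) `^ p <=
    (C `^ (p - 1))%:E * \int[nu]_y F (x, y).
  have [rx|rx] := eqVneq (rho x) 0%R.
    by rewrite rx mul0e mule_ge0 ?lee_fin ?powR_ge0//; exact: integral_ge0.
  have := @integral_powR_le _ _ _ nu p (fun y => u y / phi y)%R (fun y => phi y * k (x, y))%R p1.
  have mg : measurable_fun setT (fun y => u y / phi y)%R.
    by apply: measurable_funM => //; exact: measurable_fun_invr.
  have mh : measurable_fun setT (fun y => phi y * k (x, y))%R by exact: measurable_funM.
  have h0 y : (0 <= phi y * k (x, y))%R by rewrite mulr_ge0// ltW.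
  have g0 y : (0 <= u y / phi y)%R by rewrite divr_ge0// ltW.
  move=> /(_ mg mh g0 h0).
  under eq_integral do rewrite mulrA divfK ?gt_eqF//.
  have gE y : (((u y / phi y) `^ p * (phi y * k (x, y)))%:E = (v y * k (x, y))%:E).
    have phi0' := ltW (phi0 y); congr EFin.
    rewrite /v powRM ?invr_ge0// -powR_inv1// -powRrM mulN1r mulrA; congr (_ * _)%R.
    have {2}-> : phi y = (phi y `^ 1)%R by rewrite powRr1.
    by rewrite -mulrA -powRD ?(gt_eqF (phi0 y)) ?implybT// addrC.
  rewrite (_ : \int[nu]_y ((u y / phi y) `^ p * (phi y * k (x, y)))%:E =
    \int[nu]_y (v y * k (x, y))%:E); last by apply: eq_integral => y _; exact: gE.
  move=> le1; apply: (le_trans (lee_wpmul2l _ le1)); first by rewrite lee_fin.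
  have i0 : 0 <= \int[nu]_y (phi y * k (x, y))%:E.
    by apply: integral_ge0 => y _; rewrite lee_fin.
  have le2 : (\int[nu]_y (phi y * k (x, y))%:E) `^ (p - 1) <= ((C * psi x) `^ (p - 1))%:E.
    rewrite -poweR_EFin; apply: gt0_ler_poweR => //; rewrite ?in_itv/= ?leey ?andbT ?(ltW p10)//.
      by rewrite lee_fin mulr_ge0.
    exact: hC.
  have j0 : 0 <= \int[nu]_y (v y * k (x, y))%:E.
    by apply: integral_ge0 => y _; rewrite lee_fin mulr_ge0.
  apply: (le_trans (lee_wpmul2l _ (lee_wpmul2l _ le2))); rewrite ?lee_fin//.
  rewrite (_ : \int[nu]_y F (x, y) = (c x)%:E * \int[nu]_y (v y * k (x, y))%:E); last first.
    have mvk : measurable_fun setT (fun y => (v y * k (x, y))%:E).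
      by apply/measurable_EFinP; exact: measurable_funM.
    rewrite -(ge0_integralZl_EFin nu measurableT _ mvk (c0 x)).
      by apply: eq_integral => y _; rewrite /F/= -EFinM; congr EFin; ring.
    by move=> y _; rewrite lee_fin mulr_ge0.
  rewrite muleA [X in _ <= X]muleC -!muleA muleCA [X in _ <= X]muleCA.
  rewrite le_eqVlt; apply/orP; left; apply/eqP; congr (_ * _).
  by rewrite -!EFinM; congr EFin; rewrite /c powRM//; ring.
have mFx : measurable_fun setT (fun x => \int[nu]_y F (x, y)).
  exact: (measurable_fun_fubini_tonelli_F (m2 := nu)).
have Fx0 x : 0 <= \int[nu]_y F (x, y) by exact: integral_ge0.
apply: (@le_trans _ _ (\int[mu]_x ((C `^ (p - 1))%:E * \int[nu]_y F (x, y)))).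
  apply: ge0_le_integral => //.
  - by move=> x _; rewrite mule_ge0 ?lee_fin// poweR_ge0.
  - apply: emeasurable_funM; first by apply/measurable_EFinP.
    apply: (measurableT_comp (measurable_poweR p)).
    apply: (measurable_fun_fubini_tonelli_F (m2 := nu) (fun z => (u z.2 * k z)%:E)).
      by apply/measurable_EFinP; apply: measurable_funM => //; exact: measurableT_comp.
    by move=> z; rewrite lee_fin mulr_ge0.
  - by apply: measurable_funeM.
rewrite (ge0_integralZl_EFin mu measurableT _ mFx (powR_ge0 C (p - 1)))//.
apply: lee_wpmul2l; first by rewrite lee_fin powR_ge0.
have -> : \int[mu]_x \int[nu]_y F (x, y) = \int[nu]_y \int[mu]_x F (x, y).
  by rewrite -(fubini_tonelli1 (m1 := mu) (m2 := nu) _ mF F0) (fubini_tonelli2 (m1 := mu) (m2 := nu) _ mF F0).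
rewrite le_eqVlt; apply/orP; left; apply/eqP; apply: eq_integral => y _.
have mky : measurable_fun setT (fun x => (rho x * psi x `^ (p - 1) * k (x, y))%:E).
  apply/measurable_EFinP; apply: measurable_funM => //.
  exact: (measurableT_comp mk (pair2_measurable y)).
rewrite -(ge0_integralZl_EFin mu measurableT _ mky (v0 y))//.
by move=> x _; rewrite lee_fin; apply: mulr_ge0 => //; exact: c0.
Qed.
End schur_test.

(** * The modulus of the kernel as a measurable function on the plane *)

Section kernel_plane.
Context {R : realType}.
Local Notation mu := (@lebesgue_measure R).
Local Notation normc := (@ComplexField.Normc.normc R).
Local Notation I2pi := (`[0%R, (2 * pi)%R]%classic : set R).
Variable w : R -> R.
Hypotheses (rw : radial_weight w) (Dw : Dhat w).
Implicit Types (r s t : R) (v z : R * R).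
Local Notation H := (omega_hat w).

(* [|B_z(zeta)|] depends on [conj z * zeta] only; [Bmod] is this function of the product, set to 0 off the disc. *)
Definition Bmod v : R := if v.1 ^+ 2 + v.2 ^+ 2 < 1 then normc (Bker w 1 (toC v)) else 0.

Lemma normc_sqrt (a : R[i]) : normc a = Num.sqrt (complex.Re a ^+ 2 + complex.Im a ^+ 2).
Proof. by case: a. Qed.

Lemma measurable_normc (f : R * R -> R[i]) (D : set (R * R)) :
    measurable_fun D (fun v => complex.Re (f v)) -> measurable_fun D (fun v => complex.Im (f v)) ->
  measurable_fun D (fun v => normc (f v)).
Proof.
move=> mr mi; under eq_fun do rewrite normc_sqrt.
apply: (measurableT_comp (f := @Num.sqrt R)).
  by apply: continuous_measurable_fun; exact: sqrt_continuous.
by apply: measurable_funD; apply: measurable_funX.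
Qed.

Definition cmul z v : R * R := (z.1 * v.1 + z.2 * v.2, z.1 * v.2 - z.2 * v.1).

Lemma toC_cmul z v : toC (cmul z v) = conjc (toC z) * toC v.
Proof. by apply/eqP; rewrite /toC /cmul eq_complex/=; apply/andP; split; apply/eqP; ring. Qed.

Lemma cmul_polar r s t x : cmul (polar (r, t)) (polar (s, x)) = polar (r * s, x - t).
Proof. by rewrite /cmul /polar/= cosB sinB; congr pair; ring. Qed.

Lemma Bmod_ge0 v : 0 <= Bmod v.
Proof. by rewrite /Bmod; case: ifP => // _; exact: normc_ge0. Qed.

Lemma Bmod_polar r t : 0 <= r < 1 -> Bmod (polar (r, t)) = ker w r t.
Proof.
move=> r01; rewrite /Bmod ifT; last by apply/disc_polar; case/andP: r01.
by apply: (normc_Bker rw Dw) => //; rewrite toC_polar conjc1 mul1r.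
Qed.

Lemma normc_Bker_cmul z v : disc z -> disc v ->
  normc (Bker w (toC z) (toC v)) = Bmod (cmul z v).
Proof.
move=> /disc_normc z1 /disc_normc v1; rewrite /Bmod ifT.
  by rewrite /Bker toC_cmul conjc1 mul1r.
apply/disc_normc; rewrite toC_cmul ComplexField.Normc.normcM.
have -> : normc (conjc (toC z)) = normc (toC z) by rewrite /= sqrrN.
by rewrite mulr_ilt1// normc_ge0.
Qed.

(** The partial sums have polynomial real and imaginary parts, and their moduli converge to that of
    the kernel at each point of the disc. *)
Lemma measurable_Bmod : measurable_fun setT Bmod.
Proof.
pose f n v := normc (\sum_(k < n) (coef w k)%:C%C * toC v ^+ k).
have mf n : measurable_fun (@disc R) (f n).
  have mX k : measurable_fun setT (fun v => complex.Re (toC v ^+ k)) /\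
              measurable_fun setT (fun v => complex.Im (toC v ^+ k)).
    elim: k => [|k [IHr IHi]].
      by split; under eq_fun do rewrite expr0; exact: measurable_cst.
    split.
      rewrite (_ : (fun v => _) = fun v =>
        v.1 * complex.Re (toC v ^+ k) - v.2 * complex.Im (toC v ^+ k)).
        by apply: measurable_funB; exact: measurable_funM.
      by apply/funext => v; rewrite exprS; case: (toC v ^+ k).
    rewrite (_ : (fun v => _) = fun v =>
      v.1 * complex.Im (toC v ^+ k) + v.2 * complex.Re (toC v ^+ k)).
      by apply: measurable_funD; exact: measurable_funM.
    by apply/funext => v; rewrite exprS; case: (toC v ^+ k).
  have mS : measurable_fun setT (fun v => complex.Re (\sum_(k < n) (coef w k)%:C%C * toC v ^+ k)) /\
            measurable_fun setT (fun v => complex.Im (\sum_(k < n) (coef w k)%:C%C * toC v ^+ k)).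
    elim: n => [|n [IHr IHi]].
      by split; under eq_fun do rewrite big_ord0; exact: measurable_cst.
    have [mr mi] := mX n; split.
      rewrite (_ : (fun v => _) = fun v =>
        complex.Re (\sum_(k < n) (coef w k)%:C%C * toC v ^+ k) + coef w n * complex.Re (toC v ^+ n)).
        by apply: measurable_funD => //; exact: measurable_funM.
      by apply/funext => v; rewrite big_ord_recr/=; case: (bigop _ _ _) => a b; case: (toC v ^+ n) => c d; rewrite /= mul0r subr0.
    rewrite (_ : (fun v => _) = fun v =>
      complex.Im (\sum_(k < n) (coef w k)%:C%C * toC v ^+ k) + coef w n * complex.Im (toC v ^+ n)).
      by apply: measurable_funD => //; exact: measurable_funM.
    by apply/funext => v; rewrite big_ord_recr/=; case: (bigop _ _ _) => a b; case: (toC v ^+ n) => c d; rewrite /= mul0r addr0.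
  by apply: measurable_funTS; apply: measurable_normc; [exact: mS.1|exact: mS.2].
have mB : measurable_fun (@disc R) (fun v => normc (Bker w 1 (toC v))).
  apply: (measurable_fun_cvg mf) => v /disc_normc v1.
  have [t _ vE] := polar_form (toC v); have v01 : 0 <= normc (toC v) < 1 by rewrite normc_ge0.
  rewrite (normc_Bker rw Dw (t := t) v01); last by rewrite conjc1 mul1r.
  have [D [x hb]] := kcoef_bounded rw Dw v01; rewrite /ker.
  rewrite (_ : (fun n => f n v) = fun n => normc (trigpoly (kcoef w (normc (toC v))) n t)).
    exact: cvg_trigpoly hb.
  apply/funext => n; rewrite /f /trigpoly; congr normc; apply: eq_bigr => k _.
  by rewrite {1}vE exprMn -rmorphXn/= mulrA -rmorphM.
rewrite (_ : Bmod = (fun v => normc (Bker w 1 (toC v))) \_ (@disc R)).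
  by apply/(measurable_restrictT _ _).1 => //; exact: measurable_disc.
apply/funext => v; rewrite patchE /Bmod.
by have -> : (v \in @disc R) = (v.1 ^+ 2 + v.2 ^+ 2 < 1) by apply/idP/idP => [/set_mem|/mem_set].
Qed.

(** The coefficients are real, so the partial sums at [t] and [- t] are conjugate. *)
Lemma ker_opp r t : 0 <= r < 1 -> ker w r (- t) = ker w r t.
Proof.
move=> r01; have [D [x hb]] := kcoef_bounded rw Dw r01.
rewrite /ker; apply: cvg_unique (cvg_trigpoly (t := t) hb); first exact: norm_hausdorff.
apply: cvg_trans (cvg_trigpoly (t := - t) hb); apply: near_eq_cvg; near=> n.
rewrite !normc_sqrt !trigpolyE/=; congr Num.sqrt; congr (_ ^+ 2 + _).
  by apply: eq_bigr => k _; rewrite mulrN cosN.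
rewrite -[RHS]sqrrN -sumrN; congr (_ ^+ 2).
by apply: eq_bigr => k _; rewrite mulrN sinN mulrN.
Unshelve. all: by end_near. Qed.

Lemma ker_int_sub r a : 0 <= r < 1 -> 0 <= a <= 2 * pi ->
  (\int[mu]_(t in I2pi) (ker w r (t - a))%:E = ker_int w r)%E.
Proof.
move=> r01 a2; rewrite -(ker_int_shift rw Dw (a := 2 * pi - a) r01); last by lra.
by apply: eq_integral => t _; rewrite addrCA [_ + (t - a)]addrC ker_periodic.
Qed.

Lemma ker_int_subr r a : 0 <= r < 1 -> 0 <= a <= 2 * pi ->
  (\int[mu]_(t in I2pi) (ker w r (a - t))%:E = ker_int w r)%E.
Proof.
move=> r01 a2; rewrite -(ker_int_sub r01 a2).
by apply: eq_integral => t _; rewrite -opprB ker_opp.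
Qed.

Lemma ker_bounded r : 0 <= r < 1 -> exists2 M, 0 <= M & forall s t, 0 <= s <= r -> ker w s t <= M.
Proof.
move=> r01; have [D [x [D0 x01 h]]] := coef_geometric rw Dw r01.
exists (D / (1 - x)).
  by rewrite divr_ge0// subr_ge0 ltW//; case/andP: x01.
move=> s t /andP[s0 sr]; apply: trigser_le; split => // n.
rewrite ger0_norm ?kcoef_ge0//; apply: le_trans (h n).
by rewrite /kcoef ler_wpM2l ?(ltW (coef_gt0 rw n))// lerXn2r// nnegrE (le_trans s0).
Qed.
End kernel_plane.

(** * Sufficiency *)

(* In the library [\x] has no sigma-finite instance for sigma-finite factors. *)
Section plane_measure.
Context {R : realType}.
Local Notation mu := (@lebesgue_measure R).

Definition plane_measure := (mu \x mu)%E.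

HB.instance Definition _ := Measure.on plane_measure.

Lemma plane_measure_sigma_finite : sigma_finite setT plane_measure.
Proof.
have /sigma_finiteP[F [TF ndF Foo]] := @sigma_finiteT _ _ _ mu.
exists (fun n => F n `*` F n).
  apply/seteqP; split => // -[x y] _; have : setT x /\ setT y by [].
  rewrite TF => -[[n _ Fn] [m _ Fm]]; exists (maxn n m) => //; split => /=.
    by move: x Fn; apply/subsetPset/ndF; exact: leq_maxl.
  by move: y Fm; apply/subsetPset/ndF; exact: leq_maxr.
move=> n; have [mF Fn] := Foo n; split; first exact: measurableX.
by rewrite /plane_measure product_measure1E// lte_mul_pinfty// ge0_fin_numE.
Qed.

HB.instance Definition _ := Measure_isSigmaFinite.Build _ _ _ plane_measure
  plane_measure_sigma_finite.
End plane_measure.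

(** * The two Schur tests for the mixed norm *)

Section mixed_norm.
Context {R : realType}.
Local Notation mu := (@lebesgue_measure R).
Local Notation mu2 := (@plane_measure R).
Local Notation J := (`[0%R, 1%R[%classic : set R).
Local Notation I2pi := (`[0%R, (2 * pi)%R]%classic : set R).
Variable w : R -> R.
Hypotheses (rw : radial_weight w) (Dw : Dhat w).
Implicit Types (r s t : R) (z : R * R).
Local Notation H := (omega_hat w).

(** The factor [s] is the Jacobian in the projection and the factor [r] of the norm. Extension by 0
    allows all radial integrals to run over the whole line. *)
Definition area_weight s : R := if 0 <= s < 1 then s * w s else 0.
Local Notation sw := area_weight.

(* The value [1] off the unit square only serves to keep [hat_max] positive. *)
Definition hat_max r s : R := if (0 <= r < 1) && (0 <= s < 1) then Num.max (H r) (H s) else 1.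

Lemma area_weight_ge0 s : 0 <= sw s.
Proof.
rewrite /area_weight; case: ifPn => // /andP[s0 s1].
by rewrite mulr_ge0// (weight_ge0 rw)//= in_itv/= s0.
Qed.

Lemma measurable_unit_itv : measurable_fun setT (fun s : R => 0 <= s < 1).
Proof.
by apply: (measurable_fun_bool true); rewrite setTI (_ : _ @^-1` _ = J).
Qed.

Lemma measurable_unit_if (g : R -> R) c : measurable_fun J g ->
  measurable_fun setT (fun s => if 0 <= s < 1 then g s else c).
Proof.
move=> mg; apply: measurable_fun_if => //; first exact: measurable_unit_itv.
by rewrite setTI (_ : _ @^-1` _ = J).
Qed.

Lemma measurable_area_weight : measurable_fun setT sw.
Proof.
by apply: measurable_unit_if; apply: measurable_funM => //; exact: measurable_weight.
Qed.

Lemma hat_max_gt0 r s : 0 < hat_max r s.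
Proof.
rewrite /hat_max; case: ifPn => // /andP[r01 s01].
by rewrite lt_max omega_hat_gt0.
Qed.

Lemma measurable_hat_max : measurable_fun setT (fun z => hat_max z.1 z.2).
Proof.
have m1 : measurable_fun setT (fun z : R * R => 0 <= z.1 < 1).
  exact: (measurableT_comp measurable_unit_itv).
have m2 : measurable_fun setT (fun z : R * R => 0 <= z.2 < 1).
  exact: (measurableT_comp measurable_unit_itv).
pose Ht s := if 0 <= s < 1 then H s else 1.
have mHt : measurable_fun setT Ht by apply: measurable_unit_if; exact: measurable_omega_hat.
rewrite (_ : (fun z => _) = fun z => if (0 <= z.1 < 1) && (0 <= z.2 < 1)
    then Num.max (Ht z.1) (Ht z.2) else 1); last first.
  apply/funext => z; rewrite /hat_max /Ht; case: ifPn => // /andP[-> ->] //.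
apply: measurable_fun_ifT => //; first exact: measurable_and.
by apply: measurable_maxr; exact: measurableT_comp.
Qed.

(** The product [r * s] is at most [r] and at most [s], so [H] there dominates both [H r] and
    [H s]. *)
Lemma ker_int_max : Dcheck w -> exists2 D, 0 < D & forall r s, 0 <= r < 1 -> 0 <= s < 1 ->
  (ker_int w (r * s) <= (D / hat_max r s)%:E)%E.
Proof.
move=> /(ker_int_le rw Dw)[D D0 hD]; exists D => // r s r01 s01.
have /andP[r0 r1] := r01; have /andP[s0 s1] := s01.
have rs : 0 <= r * s < 1 by rewrite mulr_ge0//= mulr_ilt1.
apply: (le_trans (hD _ rs)); rewrite lee_fin ler_wpM2l ?(ltW D0)//.
rewrite lef_pV2 ?posrE ?hat_max_gt0 ?omega_hat_gt0// /hat_max r01 s01/=.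
have /andP[rs0 rs1] := rs.
by rewrite ge_max !le_omega_hat// ?ler_piMr ?ler_piMl// ltW.
Qed.

(* With [z = (s, theta)], this is [|B_{r e^{it}}(s e^{i theta})| w(s)] times the Jacobian [s]. *)
Definition sector_kernel r t z : R :=
  Bmod w (polar (r * z.1, z.2 - t)) * (sw z.1 * \1_I2pi z.2).

Lemma sector_kernel_ge0 r t z : 0 <= sector_kernel r t z.
Proof. by rewrite mulr_ge0 ?Bmod_ge0// mulr_ge0 ?area_weight_ge0. Qed.

Lemma measurable_sector_kernel r :
  measurable_fun setT (fun x : R * (R * R) => sector_kernel r x.1 x.2).
Proof.
apply: measurable_funM.
  apply: (measurableT_comp (measurable_Bmod rw Dw)).
  apply: (measurableT_comp measurable_polar (g := fun x : R * (R * R) => (r * x.2.1, x.2.2 - x.1))).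
  apply: measurable_fun_pair; first by apply: measurable_funM => //; exact: measurableT_comp.
  by apply: measurable_funB => //; exact: measurableT_comp.
apply: measurable_funM.
  by apply: (measurableT_comp measurable_area_weight); exact: measurableT_comp.
have m1 : measurable_fun setT (\1_I2pi : R -> R) by exact: measurable_indic.
by apply: (measurableT_comp m1 (g := fun x : R * (R * R) => x.2.2)); exact: measurableT_comp.
Qed.

(** The operator on radial functions that is left once the angle has been integrated out. *)
Definition hat_average r (phi : R -> R) : \bar R :=
  (\int[mu]_s (phi s * (sw s / hat_max r s))%:E)%E.

(** For [U] given in polar coordinates, this is [pi] times the maximal projection of [U] at
    [r e^{it}]: the normalisation of the area measure is left out. *)
Definition ker_average (U : R * R -> R) r t : \bar R :=
  (\int[mu2]_z (U z * sector_kernel r t z)%:E)%E.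

(** Here the angle of the base point runs over a period; in [integral_sector_kernel_angle] it is the
    angle of integration. The latter serves the hypothesis of the Schur test, the former its inner
    integral after Tonelli. *)
Lemma integral_sector_kernel r t z : 0 <= r < 1 ->
  (\int[mu]_(t in I2pi) (sector_kernel r t z)%:E = (sw z.1 * \1_I2pi z.2)%:E * ker_int w (r * z.1))%E.
Proof.
move=> r01.
rewrite /sector_kernel.
have [zI|zI] := boolP (z.2 \in I2pi); last first.
  rewrite indicE (negbTE zI) mulr0 mul0e integral0_eq// => x _.
  by rewrite mulr0.
have [z01|z01] := boolP (0 <= z.1 < 1); last first.
  rewrite /area_weight (negbTE z01) mul0r mul0e integral0_eq// => x _.
  by rewrite mulr0.
have rz : 0 <= r * z.1 < 1.
  by case/andP: r01 => r0 r1; case/andP: z01 => z0 z1; rewrite mulr_ge0//= mulr_ilt1.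
move: (zI); rewrite mem_setE/= in_itv/= => z2.
rewrite -(ker_int_subr rw Dw rz z2).
rewrite -ge0_integralZl_EFin//; last 3 first.
- by move=> x _; rewrite lee_fin ker_ge0.
- apply/measurable_EFinP; apply: measurable_funTS.
  by apply: (measurableT_comp (measurable_ker rw Dw rz)); exact: measurable_funB.
- by rewrite mulr_ge0 ?area_weight_ge0.
by apply: eq_integral => x _; rewrite Bmod_polar// -EFinM mulrC.
Qed.

Lemma integral_sector_kernel_angle r s t : 0 <= r < 1 -> 0 <= t <= 2 * pi ->
  (\int[mu]_x (sector_kernel r t (s, x))%:E = (sw s)%:E * ker_int w (r * s))%E.
Proof.
move=> r01 t2; have [s01|s01] := boolP (0 <= s < 1); last first.
  rewrite /area_weight (negbTE s01) mul0e integral0_eq// => x _.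
  by rewrite /sector_kernel /area_weight (negbTE s01) mul0r mulr0.
have rs : 0 <= r * s < 1.
  by case/andP: r01 => r0 r1; case/andP: s01 => s0 s1; rewrite mulr_ge0//= mulr_ilt1.
rewrite -(ker_int_sub rw Dw rs t2) -ge0_integralZl_EFin//; last 3 first.
- by move=> x _; rewrite lee_fin ker_ge0.
- apply/measurable_EFinP; apply: measurable_funTS.
  by apply: (measurableT_comp (measurable_ker rw Dw rs)); exact: measurable_funB.
- exact: area_weight_ge0.
rewrite [RHS]integral_mkcond; apply: eq_integral => x _.
rewrite patchE /sector_kernel indicE; case: ifPn => xI; last by rewrite /= !mulr0.
by rewrite Bmod_polar// -EFinM/= mulr1 mulrC.
Qed.

Lemma measurable_hat_max1 r : measurable_fun setT (hat_max r).
Proof. exact: (measurableT_comp measurable_hat_max (pair1_measurable r)). Qed.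

Lemma ker_average_radial_le D r t (phi : R -> R) : 0 <= D ->
    (forall s, 0 <= s < 1 -> (ker_int w (r * s) <= (D / hat_max r s)%:E)%E) ->
    0 <= r < 1 -> 0 <= t <= 2 * pi ->
    measurable_fun setT phi -> (forall s, 0 <= phi s) ->
  (ker_average (fun z => phi z.1) r t <= D%:E * hat_average r phi)%E.
Proof.
move=> D0 hD r01 t2 mphi phi0; rewrite /ker_average.
have mm := measurable_fun_invr (measurable_hat_max1 r) (hat_max_gt0 r).
have msw := measurable_area_weight; have sw0 := area_weight_ge0.
have hx0 s : 0 <= phi s * (sw s / hat_max r s).
  by rewrite mulr_ge0// divr_ge0// ltW// hat_max_gt0.
have mhx : measurable_fun setT (fun s => phi s * (sw s / hat_max r s)).
  by apply: measurable_funM => //; exact: measurable_funM.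
have mF : measurable_fun setT (fun z => (phi z.1 * sector_kernel r t z)%:E).
  apply/measurable_EFinP; apply: measurable_funM; first exact: measurableT_comp.
  exact: (measurableT_comp (measurable_sector_kernel r) (pair1_measurable t)).
have F0 z : (0 <= (phi z.1 * sector_kernel r t z)%:E)%E.
  by rewrite lee_fin mulr_ge0// sector_kernel_ge0.
rewrite /plane_measure (fubini_tonelli1 (m1 := mu) (m2 := mu) _ mF F0).
rewrite /hat_average -ge0_integralZl_EFin//; last 2 first.
- by move=> s _; rewrite lee_fin.
- exact/measurable_EFinP.
apply: ge0_le_integral => //.
- by move=> s _; exact: integral_ge0.
- exact: (measurable_fun_fubini_tonelli_F (m2 := mu)).
- by apply: measurable_funeM; exact/measurable_EFinP.
move=> s _; rewrite /fubini_F/=.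
have [s01|s01] := boolP (0 <= s < 1); last first.
  rewrite /area_weight (negbTE s01) mul0r mulr0 mule0 integral0_eq// => x _.
  by rewrite /sector_kernel /area_weight (negbTE s01) mul0r !mulr0.
have -> : (\int[mu]_x (phi s * sector_kernel r t (s, x))%:E = (phi s * sw s)%:E * ker_int w (r * s))%E.
  rewrite EFinM -muleA -(integral_sector_kernel_angle s r01 t2) -ge0_integralZl_EFin//.
  - by move=> x _; rewrite lee_fin sector_kernel_ge0.
  - apply/measurable_EFinP.
    exact: (measurableT_comp (measurable_sector_kernel r) (measurableT_comp (pair1_measurable t) (pair1_measurable s))).
apply: (le_trans (lee_wpmul2l _ (hD _ s01))); first by rewrite lee_fin mulr_ge0.
by rewrite -!EFinM lee_fin le_eqVlt; apply/orP; left; apply/eqP; ring.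
Qed.

(** A Minkowski-type estimate: if the [p]-th means of [U] are dominated by [phi], those of its
    average are dominated by [D * hat_average r phi]. The Schur test is applied at fixed [r] with
    the radial test function [phi] and with [D * hat_average r phi] itself as its constant. In the
    inner integral [phi ^ (1 - p)] meets [phi ^ p], so that one more factor [hat_average r phi]
    appears. *)
Lemma ker_average_le : Dcheck w -> exists2 D, 0 < D &
  forall p (U : R * R -> R) (phi : R -> R), 1 < p ->
    measurable_fun setT U -> (forall z, 0 <= U z) ->
    measurable_fun setT phi -> (forall s, 0 < phi s) ->
    {ae mu, forall s, (\int[mu]_(t in I2pi) (U (s, t) `^ p)%:E * (sw s)%:E <=
                       (2 * pi * phi s `^ p * sw s)%:E)%E} ->
  forall r, 0 <= r < 1 ->
  (\int[mu]_(t in I2pi) (ker_average U r t `^ p) <=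
   (2 * pi)%:E * (D%:E * hat_average r phi) `^ p)%E.
Proof.
move=> Dc; have [D D0 hD] := ker_int_max Dc; exists D => //.
move=> p U phi p1 mU U0 mphi phi0 hU r r01; have pi0 := pi_gt0 R.
have p0 : 0 < p by apply: lt_trans p1.
have mm := measurable_fun_invr (measurable_hat_max1 r) (hat_max_gt0 r).
have msw := measurable_area_weight; have sw0 := area_weight_ge0.
have hx0 s : 0 <= phi s * (sw s / hat_max r s).
  by rewrite mulr_ge0 ?(ltW (phi0 s))// divr_ge0// ltW// hat_max_gt0.
have mhx : measurable_fun setT (fun s => phi s * (sw s / hat_max r s)).
  by apply: measurable_funM => //; exact: measurable_funM.
have X0 : (0 <= hat_average r phi)%E by apply: integral_ge0 => s _; rewrite lee_fin.
(* The Schur constant must be a real number; if the average is infinite, so is the right-hand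
   side. *)
have [Xoo|Xfin] := eqVneq (hat_average r phi) +oo%E.
  by rewrite Xoo gt0_muley ?lte_fin// poweRyr ?gt_eqF// gt0_muley ?lte_fin ?mulr_gt0// leey.
have XE : hat_average r phi = (fine (hat_average r phi))%:E.
  by rewrite fineK// ge0_fin_numE// lt_neqAle Xfin leey.
set X := fine _ in XE; have X0' : 0 <= X by rewrite fine_ge0.
have DX : 0 <= D * X by rewrite mulr_ge0// ltW.
have kle s : 0 <= s < 1 -> (ker_int w (r * s) <= (D / hat_max r s)%:E)%E by exact: hD.
pose psi (t : R) : R := 1.
have := @schur_test _ _ _ _ R mu mu2 p (D * X)
  (fun x : R * (R * R) => sector_kernel r x.1 x.2) U (phi \o fst) (\1_I2pi) psi p1 DX
  (measurable_sector_kernel r) (fun x => sector_kernel_ge0 r x.1 x.2) mU U0.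
have mphi1 : measurable_fun setT (phi \o fst : R * R -> R) by exact: measurableT_comp.
have m1 : measurable_fun setT (\1_I2pi : R -> R) by exact: measurable_indic.
have hyp x : \1_I2pi x != 0 :> R ->
    (\int[mu2]_z ((phi \o fst) z * sector_kernel r x z)%:E <= (D * X * psi x)%:E)%E.
  rewrite indicE; case: (boolP (x \in I2pi)) => [xI _|]; last by rewrite eqxx.
  move: xI; rewrite mem_setE/= in_itv/= => xI.
  rewrite mulr1 EFinM -XE; apply: (ker_average_radial_le (ltW D0)) => // s.
  exact: ltW.
move=> /(_ mphi1 (fun z => phi0 z.1) m1 _ _ _ hyp) main.
have {main} := main _ _ _.
have -> : (\int[mu]_x ((\1_I2pi x)%:E * (\int[mu2]_y (U y * sector_kernel r x y)%:E) `^ p) =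
  \int[mu]_(t in I2pi) (ker_average U r t `^ p))%E.
  rewrite [RHS]integral_mkcond; apply: eq_integral => x _.
  by rewrite patchE indicE; case: ifPn => _; rewrite ?mul1e ?mul0e.
move=> main; apply: (le_trans (main _ _ _)).
- by move=> x; rewrite indicE.
- exact: measurable_cst.
- by move=> x; exact: ler01.
rewrite XE; have -> : (D%:E * X%:E = (D * X)%:E)%E by [].
rewrite poweR_EFin.
have -> : ((2 * pi)%:E * ((D * X) `^ p)%:E = ((D * X) `^ (p - 1))%:E * (2 * pi * (D * X))%:E)%E.
  rewrite -!EFinM; congr EFin; rewrite -(mulr_powRB1 DX p0); ring.
apply: lee_wpmul2l; first by rewrite lee_fin powR_ge0.
pose c s := phi s `^ (1 - p) * (D / hat_max r s).
have c0 s : 0 <= c s by rewrite mulr_ge0 ?powR_ge0// divr_ge0 ?(ltW D0)// ltW// hat_max_gt0.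
have mc : measurable_fun setT c.
  by apply: measurable_funM; [exact: (measurableT_comp (measurable_powR _))|exact: measurable_funM].
pose G z := (c z.1 * sw z.1 * (U z `^ p * \1_I2pi z.2))%:E.
have mG : measurable_fun setT G.
  apply/measurable_EFinP; apply: measurable_funM.
    by apply: measurable_funM; exact: measurableT_comp.
  apply: measurable_funM; first exact: (measurableT_comp (measurable_powR _)).
  by apply: (measurableT_comp m1 (g := snd)).
have G0 z : (0 <= G z)%E.
  by rewrite lee_fin; apply: mulr_ge0; apply: mulr_ge0 => //; exact: powR_ge0.
apply: (@le_trans _ _ (\int[mu2]_z G z)%E).
  apply: ge0_le_integral => //.
  - move=> z _; apply: mule_ge0; first by rewrite lee_fin mulr_ge0 ?powR_ge0.
    by apply: integral_ge0 => x _; rewrite lee_fin /psi powR1 mulr1 mulr_ge0// sector_kernel_ge0.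
  - apply: emeasurable_funM.
      by apply/measurable_EFinP; apply: measurable_funM; exact: (measurableT_comp (measurable_powR _)).
    apply: (measurable_fun_fubini_tonelli_G (m1 := mu)
      (fun x => (\1_I2pi x.1 * psi x.1 `^ (p - 1) * sector_kernel r x.1 x.2)%:E)).
      apply/measurable_EFinP; apply: measurable_funM; last exact: measurable_sector_kernel.
      rewrite /psi; under eq_fun do rewrite powR1 mulr1.
      exact: (measurableT_comp m1).
    by move=> x; rewrite lee_fin /psi powR1 mulr1 mulr_ge0// sector_kernel_ge0.
  move=> z _.
  rewrite (_ : \int[mu]_x _ = \int[mu]_(x in I2pi) (sector_kernel r x z)%:E)%E; last first.
    rewrite [RHS]integral_mkcond; apply: eq_integral => x _.
    by rewrite patchE indicE /psi powR1; case: ifPn => _; rewrite ?mul1r ?mul0r.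
  rewrite integral_sector_kernel// /G.
  have [z01|z01] := boolP (0 <= z.1 < 1); last first.
    by rewrite /area_weight (negbTE z01) mul0r mul0e mule0 mulr0 mul0r.
  have sI : 0 <= sw z.1 * \1_I2pi z.2 by rewrite mulr_ge0.
  apply: (@le_trans _ _ ((U z `^ p * (phi \o fst) z `^ (1 - p))%:E *
      ((sw z.1 * \1_I2pi z.2)%:E * (D / hat_max r z.1)%:E))%E).
    apply: lee_wpmul2l; first by rewrite lee_fin mulr_ge0 ?powR_ge0.
    by apply: lee_wpmul2l; [rewrite lee_fin|exact: kle].
  by rewrite -!EFinM lee_fin le_eqVlt; apply/orP; left; apply/eqP; rewrite /c/=; ring.
rewrite (fubini_tonelli1 (m1 := mu) (m2 := mu) _ mG G0).
(* The hypothesis on the means holds for almost every radius only, so the comparison of the radial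
   integrands is an almost-everywhere one. *)
apply: (@le_trans _ _ (\int[mu]_s (2 * pi * D * (phi s * (sw s / hat_max r s)))%:E)%E).
  apply: ae_ge0_le_integral => //.
  - by move=> s _; exact: integral_ge0.
  - exact: (measurable_fun_fubini_tonelli_F (m2 := mu)).
  - by move=> s _; rewrite lee_fin mulr_ge0// !mulr_ge0// ltW.
  - by apply/measurable_EFinP; exact: measurable_funM.
  apply: (@filterS _ _ (ae_filter_ringOfSetsType mu) _ _ _ hU) => s hs _; rewrite /fubini_F/=.
  have -> : (\int[mu]_y G (s, y) = (c s)%:E * (\int[mu]_(t in I2pi) (U (s, t) `^ p)%:E * (sw s)%:E))%E.
    have mUp : measurable_fun setT (fun t => (U (s, t) `^ p)%:E).
      apply/measurable_EFinP; apply: (measurableT_comp (measurable_powR _)).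
      exact: (measurableT_comp mU (pair1_measurable s)).
    rewrite muleCA -EFinM.
    rewrite -ge0_integralZr//; last 3 first.
    - exact: measurable_funTS.
    - by move=> t _; rewrite lee_fin powR_ge0.
    - by rewrite lee_fin mulr_ge0.
    rewrite [RHS]integral_mkcond; apply: eq_integral => t _.
    rewrite patchE /G indicE/=; case: ifPn => _; last by rewrite !mulr0.
    by rewrite mulr1 -EFinM; congr EFin; ring.
  apply: (le_trans (lee_wpmul2l _ hs)); first by rewrite lee_fin.
  rewrite -EFinM lee_fin le_eqVlt; apply/orP; left; apply/eqP.
  have -> : phi s `^ p = phi s * phi s `^ (p - 1) by rewrite mulr_powRB1// ltW.
  have e1 : phi s `^ (1 - p) * phi s `^ (p - 1) = 1.
    rewrite -powRD ?(gt_eqF (phi0 s)) ?implybT//.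
    by rewrite -opprB addNr powRr0.
  rewrite /c; transitivity (phi s `^ (1 - p) * phi s `^ (p - 1) * (2 * pi * D * (phi s * (sw s / hat_max r s)))).
    by ring.
  by rewrite e1 mul1r.
rewrite [in leRHS]mulrA EFinM -XE /hat_average -ge0_integralZl_EFin//; last 3 first.
- by move=> s _; rewrite lee_fin.
- exact/measurable_EFinP.
- by rewrite !mulr_ge0// ltW.
Qed.

(** Schur test with the test function [H^{-a}], [a = 1/q]. In the inner integral it appears with the
    exponent [- a (q - 1) = - b], [b = 1 - 1/q], so both estimates are instances of
    [schur_integral]; the powers [b] and [- b] cancel at the end. *)
Lemma hat_average_le q : 1 < q -> exists2 C, 0 < C &
  forall phi : R -> R, measurable_fun setT phi -> (forall s, 0 <= phi s) ->
  (\int[mu]_r ((sw r)%:E * hat_average r phi `^ q) <= C%:E * \int[mu]_s (phi s `^ q * sw s)%:E)%E.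
Proof.
move=> q1; have q0 : 0 < q by apply: lt_trans q1.
have q10 : 0 < q - 1 by rewrite subr_gt0.
pose a := q^-1; pose b := (q - 1) / q.
have a01 : 0 < a < 1 by rewrite invr_gt0 q0 invf_lt1.
have b01 : 0 < b < 1 by rewrite divr_gt0//= ltr_pdivrMr// mul1r gtrBl.
have [A A0 hA] := schur_integral rw a01; have [B B0 hB] := schur_integral rw b01.
exists (A `^ (q - 1) * B) => [|phi mphi phi0]; first by rewrite mulr_gt0// powR_gt0.
(* This is [H] on [[0, 1[] continued by 1, hence positive and measurable on the whole line. *)
pose h s := hat_max s s; have h0 s : 0 < h s by exact: hat_max_gt0.
have hE s : 0 <= s < 1 -> h s = H s by move=> s01; rewrite /h /hat_max s01 maxxx.
have mh : measurable_fun setT h.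
  have /= := measurableT_comp measurable_hat_max
    (@measurable_fun_pair _ _ _ _ _ _ id id (@measurable_id _ _ setT) (@measurable_id _ _ setT)).
  exact.
have mpow (f : R -> R) c : measurable_fun setT f -> measurable_fun setT (fun s => f s `^ c).
  by move=> mf; exact: (measurableT_comp (measurable_powR c)).
have msw := measurable_area_weight; have sw0 := area_weight_ge0.
pose k z := sw z.2 / hat_max z.1 z.2.
have k0 z : 0 <= k z by rewrite divr_ge0// ltW// hat_max_gt0.
have mk : measurable_fun setT k.
  apply: measurable_funM; first exact: measurableT_comp.
  by apply: measurable_fun_invr => [|z]; [exact: measurable_hat_max|exact: hat_max_gt0].
have hsym r s : hat_max r s = hat_max s r by rewrite /hat_max andbC maxC.
have bnd c C r : 0 <= C -> (forall r, 0 <= r < 1 ->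
    (\int[mu]_(s in J) (H s `^ (- c) / Num.max (H r) (H s) * w s)%:E <= (C * H r `^ (- c))%:E)%E) ->
    0 <= r < 1 ->
  (\int[mu]_s (h s `^ (- c) * (sw s / hat_max r s))%:E <= (C * h r `^ (- c))%:E)%E.
  move=> C0 hC r01; rewrite (hE r r01); apply: le_trans (hC r r01).
  rewrite [leRHS]integral_mkcond; apply: ge0_le_integral => //.
  - by move=> s _; rewrite lee_fin mulr_ge0 ?powR_ge0// (k0 (r, s)).
  - apply/measurable_EFinP; apply: measurable_funM; first exact: mpow.
    exact: (measurableT_comp mk (pair1_measurable r)).
  - apply/(measurable_restrictT _ _).1 => //; apply/measurable_EFinP.
    have mHJ := measurable_omega_hat rw.
    apply: measurable_funM; last exact: measurable_weight.
    apply: measurable_funM; first exact: (measurableT_comp (measurable_powR _)).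
    apply: (eq_measurable_fun (fun s => Num.max (H r) (H s) `^ (-1))).
      by move=> s _; rewrite powR_inv1// le_max (ltW (omega_hat_gt0 rw r01)).
    by apply: (measurableT_comp (measurable_powR _)); exact: measurable_maxr.
  move=> s _; rewrite patchE; have [sJ|sJ] := boolP (s \in J); last first.
    rewrite /area_weight ifF ?mul0r ?mulr0//.
    by apply: contraNF sJ => s01; rewrite mem_setE/= in_itv.
  move: (sJ); rewrite mem_setE/= in_itv/= => s01; rewrite (hE s s01) /area_weight s01.
  have ws : 0 <= w s by apply: (weight_ge0 rw); rewrite /= in_itv.
  have max0 : 0 < Num.max (H r) (H s) by rewrite lt_max omega_hat_gt0.
  rewrite lee_fin /hat_max r01 s01/= -[leRHS]mulrA ler_wpM2l ?powR_ge0// [leRHS]mulrC.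
  rewrite ler_wpM2r ?invr_ge0 ?(ltW max0)// ler_piMl// ltW//.
  by case/andP: s01.
have := @schur_test _ _ _ _ R mu mu q A k phi (fun s => h s `^ (- a)) sw (fun s => h s `^ (- a))
  q1 (ltW A0) mk k0 mphi phi0.
move=> /(_ (mpow _ _ mh) (fun s => powR_gt0 _ (h0 s)) msw sw0 (mpow _ _ mh) (fun s => powR_ge0 _ _)).
have hyp x : sw x != 0 -> (\int[mu]_y (h y `^ (- a) * k (x, y))%:E <= (A * h x `^ (- a))%:E)%E.
  move=> swx; apply: bnd => //; first exact: ltW.
  by apply: contraNT swx => x01; rewrite /area_weight (negbTE x01).
move=> /(_ hyp) main; apply: (le_trans main).
rewrite EFinM -muleA; apply: lee_wpmul2l; first by rewrite lee_fin powR_ge0.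
rewrite -ge0_integralZl_EFin//; last 3 first.
- by move=> s _; rewrite lee_fin mulr_ge0 ?powR_ge0.
- by apply/measurable_EFinP; apply: measurable_funM => //; exact: mpow.
- exact: ltW.
have inner0 y : (0 <= \int[mu]_x (sw x * (h x `^ (- a)) `^ (q - 1) * k (x, y))%:E)%E.
  by apply: integral_ge0 => x _; rewrite lee_fin; apply: mulr_ge0 => //; rewrite mulr_ge0 ?powR_ge0.
apply: ge0_le_integral => //.
- by move=> y _; apply: mule_ge0 => //; rewrite lee_fin mulr_ge0 ?powR_ge0.
- apply: emeasurable_funM.
    by apply/measurable_EFinP; apply: measurable_funM; [exact: mpow|exact: (mpow _ _ (mpow _ _ mh))].
  apply: (measurable_fun_fubini_tonelli_G (m1 := mu)
    (fun x => (sw x.1 * (h x.1 `^ (- a)) `^ (q - 1) * k x)%:E)).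
    apply/measurable_EFinP; apply: measurable_funM => //.
    apply: (measurableT_comp (f := fun s => sw s * (h s `^ (- a)) `^ (q - 1))) => //.
    by apply: measurable_funM => //; exact: (mpow _ _ (mpow _ _ mh)).
  by move=> x; rewrite lee_fin; apply: mulr_ge0 => //; rewrite mulr_ge0 ?powR_ge0.
- by apply: measurable_funeM; apply/measurable_EFinP; apply: measurable_funM => //; exact: mpow.
move=> y _.
have [y01|y01] := boolP (0 <= y < 1); last first.
  rewrite [in leLHS]integral0_eq ?mule0 ?mule_ge0 ?lee_fin ?mulr_ge0 ?powR_ge0 ?(ltW B0)//.
  by move=> x _; rewrite /k /area_weight/= (negbTE y01) mul0r mulr0.
have abE : - a * (q - 1) = - b by rewrite /a /b mulNr mulrC.
have -> : (\int[mu]_x (sw x * (h x `^ (- a)) `^ (q - 1) * k (x, y))%:E =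
    (sw y)%:E * \int[mu]_x (h x `^ (- b) * (sw x / hat_max y x))%:E)%E.
  rewrite -ge0_integralZl_EFin//.
  - apply: eq_integral => x _; rewrite -EFinM -powRrM abE /k/= hsym; congr EFin.
    by ring.
  - by move=> x _; rewrite lee_fin mulr_ge0 ?powR_ge0// (k0 (y, x)).
  - apply/measurable_EFinP; apply: measurable_funM; first exact: mpow.
    exact: (measurableT_comp mk (pair1_measurable y)).
apply: (le_trans (lee_wpmul2l _ (lee_wpmul2l _ (bnd b B y (ltW B0) hB y01)))).
- by rewrite lee_fin mulr_ge0 ?powR_ge0.
- by rewrite lee_fin.
rewrite -!EFinM lee_fin le_eqVlt; apply/orP; left; apply/eqP.
rewrite -powRrM (_ : - a * (1 - q) = b); last by rewrite -[RHS]opprK -abE; ring.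
have e1 : h y `^ b * h y `^ (- b) = 1.
  by rewrite -powRD ?(gt_eqF (h0 y)) ?implybT// subrr powRr0.
transitivity (h y `^ b * h y `^ (- b) * (B * (phi y `^ q * sw y))); first by ring.
by rewrite e1 mul1r.
Qed.

Lemma measurable_sector_kernel2 :
  measurable_fun setT (fun x : (R * R) * (R * R) => sector_kernel x.1.1 x.1.2 x.2).
Proof.
apply: measurable_funM.
  apply: (measurableT_comp (measurable_Bmod rw Dw)).
  apply: (measurableT_comp measurable_polar (g := fun x : (R * R) * (R * R) => (x.1.1 * x.2.1, x.2.2 - x.1.2))).
  apply: measurable_fun_pair.
    by apply: measurable_funM; exact: measurableT_comp.
  by apply: measurable_funB; exact: measurableT_comp.
apply: measurable_funM.
  by apply: (measurableT_comp measurable_area_weight); exact: measurableT_comp.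
have m1 : measurable_fun setT (\1_I2pi : R -> R) by exact: measurable_indic.
by apply: (measurableT_comp m1 (g := fun x : (R * R) * (R * R) => x.2.2)); exact: measurableT_comp.
Qed.

Lemma measurable_ker_average (U : R * R -> R) : measurable_fun setT U -> (forall z, 0 <= U z) ->
  measurable_fun setT (fun x => ker_average U x.1 x.2).
Proof.
move=> mU U0.
apply: (measurable_fun_fubini_tonelli_F (m2 := mu2)
  (fun x : (R * R) * (R * R) => (U x.2 * sector_kernel x.1.1 x.1.2 x.2)%:E)).
  apply/measurable_EFinP; apply: measurable_funM; first exact: measurableT_comp.
  exact: measurable_sector_kernel2.
by move=> x; rewrite lee_fin mulr_ge0// sector_kernel_ge0.
Qed.

Lemma ker_average_ge0 (U : R * R -> R) r t : (forall z, 0 <= U z) -> (0 <= ker_average U r t)%E.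
Proof. by move=> U0; apply: integral_ge0 => z _; rewrite lee_fin mulr_ge0// sector_kernel_ge0. Qed.

Lemma integral_area_weight_fin : exists2 S, 0 <= S & (\int[mu]_s (sw s)%:E <= S%:E)%E.
Proof.
exists (H 0); first by rewrite ltW// omega_hat_gt0// lexx ltr01.
rewrite omega_hatE// [leRHS]integral_mkcond; apply: ge0_le_integral => //.
- by move=> s _; rewrite lee_fin area_weight_ge0.
- by apply/measurable_EFinP; exact: measurable_area_weight.
- apply/(measurable_restrictT _ _).1 => //; apply/measurable_EFinP; exact: measurable_weight.
move=> s _; rewrite patchE /area_weight mem_setE/= in_itv/=; case: ifPn => // s01.
rewrite lee_fin ler_piMl//; last by case/andP: s01 => _ /ltW.
by apply: (weight_ge0 rw); rewrite /= in_itv.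
Qed.

Definition mean_pow p (U : R * R -> R) s : \bar R :=
  ((2 * pi)^-1%:E * \int[mu]_(t in I2pi) (U (s, t) `^ p)%:E)%E.

Lemma measurable_mean_pow p U : measurable_fun setT U -> measurable_fun setT (mean_pow p U).
Proof.
move=> mU; apply: measurable_funeM.
apply: (@measurable_int_section _ I2pi (fun z => (U z `^ p)%:E)) => //.
- by apply/measurable_EFinP; exact: (measurableT_comp (measurable_powR _)).
- by move=> z; rewrite lee_fin powR_ge0.
Qed.

Lemma mean_pow_ge0 p U s : (0 <= mean_pow p U s)%E.
Proof.
rewrite mule_ge0 ?lee_fin ?invr_ge0 ?mulr_ge0 ?pi_ge0//.
by apply: integral_ge0 => t _; rewrite lee_fin powR_ge0.
Qed.

(* [phi] is the [p]-th mean of [U] plus [e], which keeps it positive where the mean vanishes. *)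
Lemma exists_mean_majorant p q (U : R * R -> R) e : 1 < p -> 1 < q -> 0 < e ->
    measurable_fun setT U -> (forall z, 0 <= U z) ->
    (\int[mu]_s (mean_pow p U s `^ (q / p) * (sw s)%:E) < +oo)%E ->
  exists phi : R -> R, [/\ measurable_fun setT phi, (forall s, 0 < phi s),
   {ae mu, forall s, (\int[mu]_(t in I2pi) (U (s, t) `^ p)%:E * (sw s)%:E <=
                       (2 * pi * phi s `^ p * sw s)%:E)%E} &
   (\int[mu]_s (phi s `^ q * sw s)%:E <= (2 `^ q)%:E *
     (\int[mu]_s (mean_pow p U s `^ (q / p) * (sw s)%:E) + (e `^ q)%:E * \int[mu]_s (sw s)%:E))%E].
Proof.
move=> p1 q1 e0 mU U0 fin; have pi0 := pi_gt0 R.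
have p0 : 0 < p by apply: lt_trans p1.
have q0 : 0 < q by apply: lt_trans q1.
have pq0 : 0 < q / p by exact: divr_gt0.
have msw := measurable_area_weight; have sw0 := area_weight_ge0.
have mm := measurable_mean_pow p mU; have m0 := mean_pow_ge0 p U.
have mf : measurable_fun setT (fun s => fine (mean_pow p U s)) by exact: measurableT_comp.
have f0 s : 0 <= fine (mean_pow p U s) by exact: fine_ge0.
pose g s := fine (mean_pow p U s) `^ p^-1.
have g0 s : 0 <= g s by exact: powR_ge0.
have mg : measurable_fun setT g by exact: (measurableT_comp (measurable_powR _)).
have mpow (f : R -> R) c : measurable_fun setT f -> measurable_fun setT (fun s => f s `^ c).
  by move=> ?; exact: (measurableT_comp (measurable_powR c)).
have mF : measurable_fun setT (fun s => mean_pow p U s `^ (q / p) * (sw s)%:E)%E.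
  apply: emeasurable_funM; first exact: (measurableT_comp (measurable_poweR _)).
  exact/measurable_EFinP.
have F0 s : (0 <= mean_pow p U s `^ (q / p) * (sw s)%:E)%E.
  by rewrite mule_ge0 ?poweR_ge0// lee_fin.
exists (fun s => g s + e); split.
- exact: measurable_funD.
- by move=> s; rewrite ltr_wpDl.
- have iF : mu.-integrable setT (fun s => mean_pow p U s `^ (q / p) * (sw s)%:E)%E.
    apply/integrableP; split => //.
    by under eq_integral do rewrite gee0_abs//.
  have := integrable_ae measurableT iF.
  apply: (@filterS _ _ (ae_filter_ringOfSetsType mu)) => s /(_ I) fs.
  have [->|sws] := eqVneq (sw s) 0; first by rewrite mule0 mulr0.
  have sws0 : 0 < sw s by rewrite lt_neqAle eq_sym sws sw0.
  have mfin : mean_pow p U s \is a fin_num.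
    rewrite ge0_fin_numE// lt_neqAle leey andbT; apply/negP => /eqP mE.
    by move: fs; rewrite mE poweRyr ?gt_eqF// gt0_mulye.
  have -> : (\int[mu]_(t in I2pi) (U (s, t) `^ p)%:E = (2 * pi)%:E * mean_pow p U s)%E.
    by rewrite muleA -EFinM divff ?mul1e// gt_eqF// mulr_gt0.
  rewrite -(fineK mfin) -!EFinM lee_fin ler_wpM2r// ler_wpM2l ?mulr_ge0 ?(ltW pi0)//.
  have {1}-> : fine (mean_pow p U s) = g s `^ p.
    by rewrite -powRrM mulVf ?gt_eqF// powRr1.
  by rewrite ge0_ler_powR ?nnegrE ?(ltW p0)// ?addr_ge0 ?lerDl// ltW.
- have key s : ((g s + e) `^ q * sw s <= 2 `^ q * (g s `^ q * sw s + e `^ q * sw s)).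
    rewrite -mulrDl mulrA ler_wpM2r//.
    apply: (@le_trans _ _ ((2 * Num.max (g s) e) `^ q)).
      have ge : 0 <= Num.max (g s) e by rewrite le_max g0.
      rewrite ge0_ler_powR ?nnegrE ?(ltW q0)// ?addr_ge0 ?mulr_ge0// ?(ltW e0)//.
      by rewrite mulr_natl mulr2n lerD// le_max lexx ?orbT.
    rewrite powRM// ?le_max ?g0// ler_wpM2l ?powR_ge0//.
    by case: (leP (g s) e) => _; rewrite ?lerDl ?lerDr powR_ge0.
  have gF s : ((g s `^ q * sw s)%:E <= mean_pow p U s `^ (q / p) * (sw s)%:E)%E.
    rewrite EFinM; apply: lee_wpmul2r; first by rewrite lee_fin.
    rewrite /g -powRrM mulrC -poweR_EFin; apply: gt0_ler_poweR; rewrite ?in_itv/= ?leey ?andbT ?lee_fin ?(ltW pq0)//.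
    by case: (mean_pow p U s) (m0 s).
  have msE : measurable_fun setT (fun s => (sw s)%:E) by exact/measurable_EFinP.
  have mes : measurable_fun setT (fun s => (e `^ q)%:E * (sw s)%:E)%E by exact: measurable_funeM.
  rewrite -ge0_integralZl_EFin ?powR_ge0//; last by move=> s _; rewrite lee_fin.
  rewrite -ge0_integralD//; last by move=> s _; rewrite -EFinM lee_fin mulr_ge0 ?powR_ge0.
  have G0 s : (0 <= mean_pow p U s `^ (q / p) * (sw s)%:E + (e `^ q)%:E * (sw s)%:E)%E.
    by apply: adde_ge0 => //; rewrite -EFinM lee_fin mulr_ge0 ?powR_ge0.
  have mG := emeasurable_funD mF mes.
  rewrite -(ge0_integralZl_EFin mu measurableT (fun s _ => G0 s) mG (powR_ge0 2 q)).
  apply: ge0_le_integral => //.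
  - by move=> s _; rewrite lee_fin mulr_ge0 ?powR_ge0.
  - apply/measurable_EFinP; apply: measurable_funM => //.
    by apply: mpow; exact: measurable_funD.
  - by apply: measurable_funeM; exact: emeasurable_funD.
  move=> s _; apply: (@le_trans _ _ ((2 `^ q)%:E * ((g s `^ q * sw s)%:E + (e `^ q)%:E * (sw s)%:E))%E).
    by have -> : ((e `^ q)%:E * (sw s)%:E = (e `^ q * sw s)%:E)%E by []; rewrite -EFinD -EFinM lee_fin.
  by apply: lee_wpmul2l; [rewrite lee_fin powR_ge0|apply: leeD].
Qed.

(** At [r = 0] the denominator is the constant [H 0] on [[0, 1[], and [phi <= phi ^ q + 1] while the
    weight has finite mass. *)
Lemma hat_average_fin (phi : R -> R) q : 1 < q ->
    measurable_fun setT phi -> (forall s, 0 < phi s) ->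
    (\int[mu]_s (phi s `^ q * sw s)%:E < +oo)%E ->
  (hat_average 0 phi < +oo)%E.
Proof.
move=> q1 mphi phi0 fin; have q0 : 0 < q by apply: lt_trans q1.
have [S S0 hS] := integral_area_weight_fin.
have msw := measurable_area_weight; have sw0 := area_weight_ge0.
have h0 := hat_max_gt0 0.
have H0 : 0 < H 0 by rewrite omega_hat_gt0// lexx ltr01.
have mq : measurable_fun setT (fun s => phi s `^ q * sw s).
  by apply: measurable_funM => //; exact: (measurableT_comp (measurable_powR _)).
apply: (@le_lt_trans _ _ ((H 0)^-1%:E * \int[mu]_s ((phi s `^ q * sw s)%:E + (sw s)%:E))%E).
  rewrite -ge0_integralZl_EFin//; last 3 first.
  - by move=> s _; rewrite lee_fin addr_ge0// mulr_ge0 ?powR_ge0.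
  - by apply: emeasurable_funD; exact/measurable_EFinP.
  - by rewrite invr_ge0 ltW.
  apply: ge0_le_integral => //.
  - by move=> s _; rewrite lee_fin mulr_ge0 ?(ltW (phi0 s))// divr_ge0// ltW.
  - apply/measurable_EFinP; apply: measurable_funM => //; apply: measurable_funM => //.
    by apply: measurable_fun_invr => //; exact: measurable_hat_max1.
  - by apply: measurable_funeM; apply: emeasurable_funD; exact/measurable_EFinP.
  move=> s _; rewrite -EFinD -EFinM lee_fin.
  have [s01|s01] := boolP (0 <= s < 1); last first.
    by rewrite /area_weight (negbTE s01) !mul0r !mulr0 addr0 mulr0.
  have -> : hat_max 0 s = H 0.
    rewrite /hat_max lexx ltr01 s01/=; apply/max_idPl; apply: le_omega_hat => //.
    by case/andP: s01.
  rewrite mulrA [leRHS]mulrC ler_wpM2r ?invr_ge0 ?(ltW H0)//.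
  rewrite -{3}[sw s]mul1r -mulrDl ler_wpM2r//.
  have [ph|ph] := leP (phi s) 1; first by rewrite (le_trans ph)// lerDr powR_ge0.
  rewrite (@le_trans _ _ (phi s `^ q))// ?lerDl//.
  by rewrite -{1}[phi s]powRr1 ?(ltW (phi0 s))// ler_powR// ltW.
rewrite ge0_integralD//; last 4 first.
- by move=> s _; rewrite lee_fin mulr_ge0 ?powR_ge0.
- exact/measurable_EFinP.
- by move=> s _; rewrite lee_fin.
- exact/measurable_EFinP.
rewrite lte_mul_pinfty ?lee_fin ?invr_ge0 ?(ltW H0)//.
by rewrite lte_add_pinfty// (le_lt_trans hS)// ltry.
Qed.

Lemma ker0 t : ker w 0 t = coef w 0.
Proof.
have r01 : 0 <= (0 : R) < 1 by rewrite lexx ltr01.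
have [D [x hb]] := kcoef_bounded rw Dw r01.
apply: cvg_unique (cvg_trigpoly (t := t) hb) _; first exact: norm_hausdorff.
apply: cvg_near_cst; near=> n; have n0 : (0 < n)%N by near: n; exists 1%N.
rewrite /trigpoly -(prednK n0) big_ord_recl big1 ?addr0; last first.
  by move=> k _; rewrite /kcoef expr0n mulr0 mul0r.
by rewrite /kcoef !expr0 !mulr1 normcR ger0_norm// ltW// coef_gt0.
Unshelve. all: by end_near. Qed.

(* For [r = 0] the kernel is constant, so [ker_average_le] at [r = 0] controls the weighted
   [L^1] norm of [U]; for fixed [r] the kernel is bounded. *)
Lemma ker_average_fin p q (U : R * R -> R) r t : Dcheck w -> 1 < p -> 1 < q ->
    measurable_fun setT U -> (forall z, 0 <= U z) ->
    (\int[mu]_s (mean_pow p U s `^ (q / p) * (sw s)%:E) < +oo)%E ->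
  0 <= r < 1 -> (ker_average U r t < +oo)%E.
Proof.
move=> Dc p1 q1 mU U0 fin r01; have pi0 := pi_gt0 R.
have p0 : 0 < p by apply: lt_trans p1.
have r00 : 0 <= (0 : R) < 1 by rewrite lexx ltr01.
have [D D0 hD] := ker_average_le Dc.
have [phi [mphi phi0 hU hphi]] := exists_mean_majorant p1 q1 ltr01 mU U0 fin.
have [S S0 hS] := integral_area_weight_fin.
have {}hD := hD p U phi p1 mU U0 mphi phi0 hU 0 r00.
have X0 : (hat_average 0 phi < +oo)%E.
  apply: (hat_average_fin q1) => //; apply: (le_lt_trans hphi).
  rewrite lte_mul_pinfty ?lee_fin ?powR_ge0// lte_add_pinfty//.
  by rewrite lte_mul_pinfty ?lee_fin ?powR_ge0// (le_lt_trans hS)// ltry.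
pose Y := (\int[mu2]_z (U z * (sw z.1 * \1_I2pi z.2))%:E)%E.
have sw0 := area_weight_ge0.
have sI z : 0 <= U z * (sw z.1 * \1_I2pi z.2) by rewrite !mulr_ge0.
have Y0 : (0 <= Y)%E by apply: integral_ge0 => z _; rewrite lee_fin.
have m1 : measurable_fun setT (\1_I2pi : R -> R) by exact: measurable_indic.
have mY : measurable_fun setT (fun z => U z * (sw z.1 * \1_I2pi z.2)).
  apply: measurable_funM => //; apply: measurable_funM.
    exact: (measurableT_comp measurable_area_weight).
  exact: (measurableT_comp m1 (g := snd)).
have Yfin : (Y < +oo)%E.
  (* Were the weighted integral infinite, the average at [r = 0] would be infinite at every angle,
     against the finite bound [hD] for its [p]-th power. *)
  rewrite ltNge leye_eq; apply/negP => /eqP YE.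
  have kE x : ker_average U 0 x = +oo%E.
    rewrite -[RHS](@gt0_muley _ (coef w 0)%:E) ?lte_fin ?coef_gt0// -YE.
    rewrite -ge0_integralZl_EFin ?(ltW (coef_gt0 rw 0))//; last 2 first.
    - by move=> z _; rewrite lee_fin.
    - exact/measurable_EFinP.
    apply: eq_integral => z _; rewrite /sector_kernel mul0r Bmod_polar// ker0 -EFinM.
    by congr EFin; ring.
  have pw : (+oo `^ p = +oo :> \bar R)%E by rewrite poweRyr// gt_eqF.
  move: hD; rewrite (eq_integral (cst +oo%E)); last by move=> x _; rewrite kE.
  have muI : mu I2pi = (2 * pi)%:E.
    by rewrite lebesgue_measure_itv/= lte_fin mulr_gt0// -EFinB subr0.
  rewrite (_ : (\int[mu]_(x in I2pi) cst +oo x)%E = +oo%E); last first.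
    transitivity (+oo * mu I2pi)%E; first exact: (integral_cst mu (measurable_itv _)).
    by rewrite muI gt0_mulye// lte_fin mulr_gt0.
  rewrite leye_eq => /eqP e.
  have : ((2 * pi)%:E * (D%:E * hat_average 0 phi) `^ p < +oo)%E.
    rewrite lte_mul_pinfty ?lee_fin ?mulr_ge0 ?(ltW pi0)//.
    by rewrite poweR_lty// lte_mul_pinfty ?lee_fin ?(ltW D0).
  by rewrite e.
have [M M0 hM] := ker_bounded rw Dw r01.
apply: (@le_lt_trans _ _ (M%:E * Y)%E); last by rewrite lte_mul_pinfty ?lee_fin.
rewrite -ge0_integralZl_EFin//; last 2 first.
- by move=> z _; rewrite lee_fin.
- exact/measurable_EFinP.
apply: ge0_le_integral => //.
- by move=> z _; rewrite lee_fin mulr_ge0// sector_kernel_ge0.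
- apply/measurable_EFinP; apply: measurable_funM => //.
  exact: (measurableT_comp (measurable_sector_kernel r) (pair1_measurable t)).
- by apply: measurable_funeM; exact/measurable_EFinP.
move=> z _; rewrite -EFinM lee_fin /sector_kernel mulrCA.
have [z01|z01] := boolP (0 <= z.1 < 1); last first.
  by rewrite /area_weight (negbTE z01) mul0r !mulr0.
have /andP[z0 z1] := z01; have /andP[r0 r1] := r01.
rewrite ler_wpM2r// Bmod_polar ?hM// mulr_ge0//=; last by rewrite mulr_ilt1.
by rewrite ler_piMr// ltW.
Qed.

(** The two Schur tests are chained through the majorant [phi], whose excess [e] over the mean adds
    a term of order [e ^ q]. The constant does not depend on [e], so [e] can be sent to 0. *)
Lemma ker_average_bounded p q : Dcheck w -> 1 < p -> 1 < q -> exists2 C, 0 < C &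
  forall U : R * R -> R, measurable_fun setT U -> (forall z, 0 <= U z) ->
    (\int[mu]_s (mean_pow p U s `^ (q / p) * (sw s)%:E) < +oo)%E ->
  (\int[mu]_r ((\int[mu]_(t in I2pi) (ker_average U r t `^ p)) `^ (q / p) * (sw r)%:E) <=
   C%:E * \int[mu]_s (mean_pow p U s `^ (q / p) * (sw s)%:E))%E.
Proof.
move=> Dc p1 q1; have pi0 := pi_gt0 R.
have p0 : 0 < p by apply: lt_trans p1.
have q0 : 0 < q by apply: lt_trans q1.
have pq0 : 0 < q / p by exact: divr_gt0.
have [D D0 hD] := ker_average_le Dc; have [A A0 hA] := hat_average_le q1.
have [S S0 hS] := integral_area_weight_fin.
have sw0 := area_weight_ge0; have msw := measurable_area_weight.
(* What the first test contributes after being raised to the power [q / p]. *)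
pose K := (2 * pi) `^ (q / p) * D `^ q.
have K0 : 0 < K by rewrite mulr_gt0 ?powR_gt0 ?mulr_gt0.
pose C := K * A * 2 `^ q; have C0 : 0 < C.
  by apply: mulr_gt0; [exact: mulr_gt0|exact: powR_gt0].
exists C => // U mU U0 fin; set N := (\int[mu]_s _)%E in fin *.
have N0 : (0 <= N)%E by apply: integral_ge0 => s _; rewrite mule_ge0 ?poweR_ge0// lee_fin.
have step e : 0 < e -> (\int[mu]_r ((\int[mu]_(t in I2pi) (ker_average U r t `^ p)) `^ (q / p) * (sw r)%:E) <=
    C%:E * (N + (e `^ q * S)%:E))%E.
  move=> e0; have [phi [mphi phi0 hU hphi]] := exists_mean_majorant p1 q1 e0 mU U0 fin.
  have mhat : measurable_fun setT (fun r => hat_average r phi).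
    apply: (measurable_fun_fubini_tonelli_F (m2 := mu)
      (fun z => (phi z.2 * (sw z.2 / hat_max z.1 z.2))%:E)).
      apply/measurable_EFinP; apply: measurable_funM; first exact: measurableT_comp.
      apply: measurable_funM; first exact: measurableT_comp.
      by apply: measurable_fun_invr => [|z]; [exact: measurable_hat_max|exact: hat_max_gt0].
    by move=> z; rewrite lee_fin mulr_ge0 ?(ltW (phi0 _))// divr_ge0// ltW// hat_max_gt0.
  have X0 r : (0 <= hat_average r phi)%E.
    apply: integral_ge0 => s _.
    by rewrite lee_fin mulr_ge0 ?(ltW (phi0 _))// divr_ge0// ltW// hat_max_gt0.
  have I0 r : (0 <= \int[mu]_(t in I2pi) (ker_average U r t `^ p))%E.
    by apply: integral_ge0 => t _; rewrite poweR_ge0.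
  have mX : measurable_fun setT (fun r => (sw r)%:E * hat_average r phi `^ q)%E.
    apply: emeasurable_funM; first exact/measurable_EFinP.
    exact: (measurableT_comp (measurable_poweR _)).
  apply: (@le_trans _ _ (\int[mu]_r (K%:E * ((sw r)%:E * hat_average r phi `^ q)))%E).
    apply: ge0_le_integral => //.
    - by move=> r _; rewrite mule_ge0 ?poweR_ge0// lee_fin.
    - apply: emeasurable_funM; last exact/measurable_EFinP.
      apply: (measurableT_comp (measurable_poweR _)).
      apply: (@measurable_int_section _ I2pi (fun z => ker_average U z.1 z.2 `^ p)%E) => //.
        by apply: (measurableT_comp (measurable_poweR _)); exact: measurable_ker_average.
      by move=> z; exact: poweR_ge0.
    - exact: measurable_funeM.
    move=> r _; have [r01|r01] := boolP (0 <= r < 1); last first.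
      by rewrite /area_weight (negbTE r01) mule0 mul0e mule0.
    rewrite muleCA [leLHS]muleC; apply: lee_wpmul2l; first by rewrite lee_fin.
    have := hD p U phi p1 mU U0 mphi phi0 hU r r01 => hr.
    apply: (le_trans (gt0_ler_poweR (ltW pq0) _ _ hr)); rewrite ?in_itv/= ?leey ?andbT//.
      by rewrite mule_ge0 ?poweR_ge0// lee_fin mulr_ge0 ?(ltW pi0).
    rewrite poweRM ?poweR_ge0 ?lee_fin ?mulr_ge0 ?(ltW pi0)//.
    rewrite -poweRrM (_ : p * (q / p) = q); last by field; rewrite gt_eqF.
    rewrite poweRM ?lee_fin ?(ltW D0)//.
    by rewrite muleA.
  rewrite (ge0_integralZl_EFin mu measurableT _ mX (ltW K0)); last first.
    by move=> r _; rewrite mule_ge0 ?poweR_ge0// lee_fin.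
  have phi0' s : 0 <= phi s by exact: ltW.
  apply: (@le_trans _ _ (K%:E * (A%:E * ((2 `^ q)%:E * (N + (e `^ q * S)%:E))))%E); last first.
    by rewrite !muleA -!EFinM.
  apply: lee_wpmul2l; first by rewrite lee_fin ltW.
  apply: (le_trans (hA phi mphi phi0')); apply: lee_wpmul2l; first by rewrite lee_fin ltW.
  apply: (le_trans hphi); apply: lee_wpmul2l; first by rewrite lee_fin powR_ge0.
  by apply: leeD => //; rewrite EFinM; apply: lee_wpmul2l; rewrite ?lee_fin ?powR_ge0.
apply/lee_addgt0Pr => d d0.
(* Makes [C * e ^ q * S] at most [d]; [S + 1] stands in for [S], which may be 0. *)
pose e := (d / (C * (S + 1))) `^ q^-1.
have CS : 0 < C * (S + 1) by rewrite mulr_gt0// ltr_wpDl.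
have e0 : 0 < e by rewrite powR_gt0// divr_gt0.
apply: (le_trans (step e e0)); rewrite muleDr ?ge0_adde_def ?inE ?lee_fin ?mulr_ge0 ?powR_ge0//.
apply: leeD => //; rewrite -EFinM lee_fin.
have -> : e `^ q = d / (C * (S + 1)).
  by rewrite /e -powRrM mulVf ?gt_eqF// powRr1// divr_ge0// ltW.
rewrite mulrA mulrA -mulrA [C * d]mulrC -mulrA ler_piMr ?(ltW d0)//.
rewrite (_ : _ * _ = S / (S + 1)); last by field; rewrite !gt_eqF// ltr_wpDl.
by rewrite ler_pdivrMr ?ltr_wpDl// mul1r lerDl.
Qed.
End mixed_norm.

(** * From nonnegative averages to the projection of complex functions *)

Section sufficiency.
Context {R : realType}.
Local Notation mu := (@lebesgue_measure R).
Local Notation mu2 := (@plane_measure R).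
Local Notation normc := (@ComplexField.Normc.normc R).
Local Notation J := (`[0%R, 1%R[%classic : set R).
Local Notation I2pi := (`[0%R, (2 * pi)%R]%classic : set R).
Variable w : R -> R.
Hypotheses (rw : radial_weight w) (Dw : Dhat w).
Implicit Types (r s t : R) (z v : R * R) (f : R[i] -> R[i]).
Local Notation sw := (area_weight w).

Definition modulus f z : R := if z.1 ^+ 2 + z.2 ^+ 2 < 1 then normc (f (toC z)) else 0.

Lemma modulus_ge0 f z : 0 <= modulus f z.
Proof. by rewrite /modulus; case: ifP => // _; exact: normc_ge0. Qed.

Lemma modulus_disc f z : disc z -> modulus f z = normc (f (toC z)).
Proof. by rewrite /disc/= /modulus => ->. Qed.

Lemma in_disc z : (z \in @disc R) = (z.1 ^+ 2 + z.2 ^+ 2 < 1).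
Proof. by apply/idP/idP => [/set_mem|/mem_set]. Qed.

Lemma measurable_modulus f : cmeasurable_disc f -> measurable_fun setT (modulus f).
Proof.
move=> [mr mi]; rewrite (_ : modulus f = (fun z => normc (f (toC z))) \_ (@disc R)).
  apply/(measurable_restrictT _ _).1; first exact: measurable_disc.
  exact: measurable_normc.
by apply/funext => z; rewrite patchE /modulus in_disc.
Qed.

Lemma norm_pqE p q f : norm_pq w p q f =
  ((\int[mu]_s (mean_pow p (modulus f \o polar) s `^ (q / p) * (sw s)%:E)) `^ q^-1)%E.
Proof.
rewrite /norm_pq; congr (_ `^ _)%E; rewrite integral_mkcond; apply: eq_integral => s _.
rewrite patchE /area_weight mem_setE/= in_itv/=; case: ifPn => [s01|_]; last by rewrite mule0.
have /andP[s0 s1] := s01.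
suff -> : Mp_pow p f s = mean_pow p (modulus f \o polar) s by [].
rewrite /Mp_pow /mean_pow; suff -> : (\int[mu]_(t in I2pi) ((modulus f \o polar) (s, t) `^ p)%:E =
  \int[mu]_(t in I2pi) (normc (f ((s * cos t) +i* (s * sin t))%C) `^ p)%:E)%E by [].
by apply: eq_integral => t _; rewrite /= modulus_disc//; exact/disc_polar.
Qed.

Definition area_kernel z v : R := Bmod w (cmul z v) * (if normc (toC v) < 1 then w (normc (toC v)) else 0).

Lemma area_kernel_ge0 z v : 0 <= area_kernel z v.
Proof.
rewrite mulr_ge0 ?Bmod_ge0//; case: ifPn => // v1; apply: (weight_ge0 rw).
by rewrite /= in_itv/= v1 andbT sqrtr_ge0.
Qed.

Lemma area_kernelE z v : disc z -> disc v ->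
  area_kernel z v = normc (Bker w (toC z) (toC v)) * w (normc (toC v)).
Proof. by move=> dz dv; rewrite /area_kernel (normc_Bker_cmul _ dz dv) ifT//; exact/disc_normc. Qed.

Lemma measurable_area_kernel : measurable_fun setT (fun x : (R * R) * (R * R) => area_kernel x.1 x.2).
Proof.
apply: measurable_funM.
  apply: (measurableT_comp (measurable_Bmod rw Dw)).
  apply: measurable_fun_pair.
    by apply: measurable_funD; apply: measurable_funM; exact: measurableT_comp.
  by apply: measurable_funB; apply: measurable_funM; exact: measurableT_comp.
have mw : measurable_fun setT (fun s => if 0 <= s < 1 then w s else 0).
  by apply: measurable_unit_if; exact: measurable_weight.
have mn : measurable_fun setT (fun v => normc (toC v)).
  apply: measurable_normc; [exact: measurable_fst|exact: measurable_snd].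
rewrite (_ : (fun x => _) = (fun s => if 0 <= s < 1 then w s else 0) \o (fun v => normc (toC v)) \o snd).
  by apply: measurableT_comp => //; exact: measurableT_comp.
by apply/funext => x; rewrite /=; congr (if _ then _ else _); rewrite sqrtr_ge0.
Qed.

Lemma integral_modulus_kernel f r t : 0 <= r < 1 -> cmeasurable_disc f ->
  (\int[mu2]_(v in disc) (modulus f v * area_kernel (polar (r, t)) v)%:E =
   ker_average w (modulus f \o polar) r t)%E.
Proof.
move=> r01 /measurable_modulus mf.
have mk : measurable_fun setT (area_kernel (polar (r, t))).
  exact: (measurableT_comp measurable_area_kernel (pair1_measurable (polar (r, t)))).
rewrite ge0_integral_disc; last 2 first.
- by apply/measurable_EFinP; apply: measurable_funTS; exact: measurable_funM.
- by move=> v _; rewrite lee_fin mulr_ge0 ?modulus_ge0 ?area_kernel_ge0.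
rewrite /ker_average /plane_measure (fubini_tonelli1 (m1 := mu) (m2 := mu)); last 2 first.
- apply/measurable_EFinP; apply: measurable_funM.
    exact: (measurableT_comp mf measurable_polar).
  exact: (measurableT_comp (measurable_sector_kernel rw Dw r) (pair1_measurable t)).
- by move=> z; rewrite lee_fin mulr_ge0 ?modulus_ge0// sector_kernel_ge0.
rewrite integral_mkcond; apply: eq_integral => s _.
rewrite patchE mem_setE/= in_itv/= /fubini_F; case: ifPn => s01; last first.
  rewrite integral0_eq// => x _; rewrite /sector_kernel/= /area_weight (negbTE s01).
  by rewrite mul0r !mulr0.
have /andP[s0 s1] := s01.
rewrite [LHS]integral_mkcond; apply: eq_integral => x _.
rewrite patchE /sector_kernel indicE/=; case: ifPn => xI; last by rewrite /= !mulr0.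
rewrite /area_kernel normc_polar ger0_norm// s1 cmul_polar /area_weight s01 mulr1.
by rewrite -EFinM; congr EFin; ring.
Qed.

Section real_part.
Variables (f : R[i] -> R[i]) (g : R * R -> R).
Hypotheses (mf : cmeasurable_disc f) (mg : measurable_fun (@disc R) g).
Hypothesis gf : forall v, disc v -> `|g v| <= normc (f (toC v)).

(** Used with [g] the real and then the imaginary part of [f], since [Pplus] is built from the
    separate integrals of the two. *)
Let integrand z v := g v * normc (Bker w (toC z) (toC v)) * w (normc (toC v)).

Lemma integrandE z v : disc z -> disc v -> integrand z v = g v * area_kernel z v.
Proof. by move=> dz dv; rewrite area_kernelE// mulrA. Qed.

Lemma measurable_integrand z : disc z -> measurable_fun (@disc R) (integrand z).
Proof.
move=> dz; apply: (eq_measurable_fun (fun v => g v * area_kernel z v)).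
  by move=> v /set_mem dv; rewrite integrandE.
apply: measurable_funM => //; apply: measurable_funTS.
exact: (measurableT_comp measurable_area_kernel (pair1_measurable z)).
Qed.

Lemma integral_abs_integrand_le r t : 0 <= r < 1 ->
  (\int[mu2]_(v in disc) `|(integrand (polar (r, t)) v)%:E| <=
    ker_average w (modulus f \o polar) r t)%E.
Proof.
move=> r01; have dz : disc (polar (r, t)) by apply/disc_polar; case/andP: r01.
rewrite -integral_modulus_kernel//; apply: ge0_le_integral => //.
- exact: measurable_disc.
- by apply: measurableT_comp => //; apply/measurable_EFinP; exact: measurable_integrand.
- apply/measurable_EFinP; apply: measurable_funTS; apply: measurable_funM.
    exact: measurable_modulus.
  exact: (measurableT_comp measurable_area_kernel (pair1_measurable _)).
move=> v dv; rewrite integrandE//= lee_fin normrM modulus_disc//.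
by rewrite (ger0_norm (area_kernel_ge0 _ _)) ler_wpM2r ?area_kernel_ge0// gf.
Qed.

Lemma integrable_integrand r t : 0 <= r < 1 -> (ker_average w (modulus f \o polar) r t < +oo)%E ->
  mu2.-integrable (@disc R) (fun v => (integrand (polar (r, t)) v)%:E).
Proof.
move=> r01 fin; have dz : disc (polar (r, t)) by apply/disc_polar; case/andP: r01.
apply/integrableP; split; first by apply/measurable_EFinP; exact: measurable_integrand.
by apply: le_lt_trans fin; exact: integral_abs_integrand_le.
Qed.

Lemma dA_int_integrand_le r t : 0 <= r < 1 -> (ker_average w (modulus f \o polar) r t < +oo)%E ->
  `|dA_int (integrand (polar (r, t)))| <= pi^-1 * fine (ker_average w (modulus f \o polar) r t).
Proof.
move=> r01 fin; have ig := integrable_integrand r01 fin; have pi0 := pi_gt0 R.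
have k0 : (0 <= ker_average w (modulus f \o polar) r t)%E.
  by apply: ker_average_ge0 => // z; exact: modulus_ge0.
rewrite /dA_int normrM ger0_norm ?invr_ge0 ?(ltW pi0)// ler_wpM2l ?invr_ge0 ?(ltW pi0)//.
have le1 := @le_normr_Rintegral _ _ _ mu2 (@disc R) (integrand (polar (r, t))) measurable_disc ig.
apply: (@le_trans _ _ (\int[mu2]_(v in disc) `|integrand (polar (r, t)) v|)); first exact: le1.
rewrite /Rintegral fine_le//.
- rewrite ge0_fin_numE; first exact: le_lt_trans (integral_abs_integrand_le t r01) fin.
  by apply: integral_ge0 => v _; rewrite lee_fin.
- by rewrite ge0_fin_numE.
- exact: integral_abs_integrand_le.
Qed.

(** The integrand is signed, so measurability in the parameter comes from Tonelli applied to its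
    positive and negative parts. *)
Lemma measurable_dA_int_integrand : measurable_fun (@disc R) (fun z => dA_int (integrand z)).
Proof.
pose G (x : (R * R) * (R * R)) := ((g \_ (@disc R)) x.2 * area_kernel x.1 x.2)%:E.
have mG : measurable_fun setT G.
  apply/measurable_EFinP; apply: measurable_funM; last exact: measurable_area_kernel.
  have : measurable_fun setT (g \_ (@disc R)).
    by apply/(measurable_restrictT _ _).1 => //; exact: measurable_disc.
  by move=> mg'; apply: (measurableT_comp mg').
have mI : measurable_fun setT (fun z => \int[mu2]_v G (z, v))%E.
  rewrite (_ : (fun z => _) = fun z => (\int[mu2]_v (G^\+ (z, v)) - \int[mu2]_v (G^\- (z, v)))%E).
    apply: emeasurable_funB.
      apply: (measurable_fun_fubini_tonelli_F (m2 := mu2)) => //.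
      exact: measurable_funepos.
    apply: (measurable_fun_fubini_tonelli_F (m2 := mu2)) => //.
    exact: measurable_funeneg.
  apply/funext => z; rewrite integralE; congr (_ - _)%E;
    by apply: eq_integral => v _; rewrite ?funeposE ?funenegE.
apply: (eq_measurable_fun (fun z => pi^-1 * fine (\int[mu2]_v G (z, v)))).
  move=> z /set_mem dz; rewrite /dA_int; congr (_ * _).
  rewrite /Rintegral; congr fine; rewrite [RHS]integral_mkcond; apply: eq_integral => v _.
  rewrite /G /= !patchE; case: ifPn => [/set_mem dv|_]; last by rewrite mul0r.
  by rewrite integrandE.
apply: measurable_funTS; apply: measurable_funM => //.
exact: measurableT_comp.
Qed.
End real_part.

Lemma normc_le_ReIm (a : R[i]) : normc a <= `|complex.Re a| + `|complex.Im a|.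
Proof.
case: a => x y /=; have n0 : 0 <= `|x| + `|y| by rewrite addr_ge0.
rewrite -(ger0_norm n0) -sqrtr_sqr ler_wsqrtr// -(real_normK (num_real x)) -(real_normK (num_real y)).
by have := mulr_ge0 (normr_ge0 x) (normr_ge0 y); nra.
Qed.

Lemma Re_mul_real (a : R[i]) (x y : R) : complex.Re (a * x%:C%C * y%:C%C) = complex.Re a * x * y.
Proof. by case: a => a b /=; ring. Qed.

Lemma Im_mul_real (a : R[i]) (x y : R) : complex.Im (a * x%:C%C * y%:C%C) = complex.Im a * x * y.
Proof. by case: a => a b /=; ring. Qed.

Lemma Re_Pplus f (a : R[i]) : complex.Re (Pplus w f a) = dA_int (fun v =>
  complex.Re (f (toC v)) * normc (Bker w a (toC v)) * w (normc (toC v))).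
Proof. by rewrite /Pplus /cint_disc/=; congr dA_int; apply/funext => v; rewrite Re_mul_real. Qed.

Lemma Im_Pplus f (a : R[i]) : complex.Im (Pplus w f a) = dA_int (fun v =>
  complex.Im (f (toC v)) * normc (Bker w a (toC v)) * w (normc (toC v))).
Proof. by rewrite /Pplus /cint_disc/=; congr dA_int; apply/funext => v; rewrite Im_mul_real. Qed.

Lemma Dcheck_Pplus_bounded p q : 1 < p -> 1 < q -> Dcheck w -> Pplus_bounded w p q.
Proof.
move=> p1 q1 Dc; have pi0 := pi_gt0 R.
have p0 : 0 < p by apply: lt_trans p1.
have q0 : 0 < q by apply: lt_trans q1.
have pq0 : 0 < q / p by exact: divr_gt0.
have [C C0 hC] := ker_average_bounded rw Dw Dc p1 q1.
(* The real and the imaginary part each contribute at most [pi^-1] times the average, whence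
   [2 / pi]; [(2 * pi)^-1] is the normalisation of the mean, absent from [ker_average_bounded]. *)
pose K := ((2 * pi)^-1 * (2 / pi) `^ p) `^ (q / p).
have c0 : 0 < 2 / pi :> R by rewrite divr_gt0.
have K0 : 0 < K by rewrite powR_gt0// mulr_gt0 ?powR_gt0// invr_gt0 mulr_gt0.
exists ((K * C) `^ q^-1) => f [mf]; rewrite norm_pqE; set U := modulus f \o polar.
have mU : measurable_fun setT U by exact: (measurableT_comp (measurable_modulus mf) measurable_polar).
have U0 z : 0 <= U z by exact: modulus_ge0.
have sw0 := area_weight_ge0 rw; have msw := measurable_area_weight rw.
set N := (\int[mu]_s _)%E => fN.
have N0 : (0 <= N)%E by apply: integral_ge0 => s _; rewrite mule_ge0 ?poweR_ge0// lee_fin.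
have fin : (N < +oo)%E.
  rewrite ltNge leye_eq; apply/negP => /eqP NE.
  by move: fN; rewrite NE poweRyr// gt_eqF// invr_gt0.
have kfin r t : 0 <= r < 1 -> (ker_average w U r t < +oo)%E.
  by move=> r01; apply: (ker_average_fin rw Dw t Dc p1 q1).
have k0 r t : (0 <= ker_average w U r t)%E by exact: ker_average_ge0.
have reP v : disc v -> `|complex.Re (f (toC v))| <= normc (f (toC v)).
  by move=> _; exact: normr_Re_le.
have imP v : disc v -> `|complex.Im (f (toC v))| <= normc (f (toC v)).
  by move=> _; exact: normr_Im_le.
have mP : cmeasurable_disc (Pplus w f).
  split.
    under eq_fun do rewrite Re_Pplus.
    exact: (measurable_dA_int_integrand mf.1).
  under eq_fun do rewrite Im_Pplus.
  exact: (measurable_dA_int_integrand mf.2).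
have Pbound r t : 0 <= r < 1 ->
    modulus (Pplus w f) (polar (r, t)) <= 2 / pi * fine (ker_average w U r t).
  move=> r01; rewrite modulus_disc; last by apply/disc_polar; case/andP: r01.
  apply: (le_trans (normc_le_ReIm _)); rewrite Re_Pplus Im_Pplus.
  rewrite (_ : 2 / pi * _ = pi^-1 * fine (ker_average w U r t) + pi^-1 * fine (ker_average w U r t)); last by ring.
  apply: lerD.
    exact: (dA_int_integrand_le mf mf.1 reP r01 (kfin r t r01)).
  exact: (dA_int_integrand_le mf mf.2 imP r01 (kfin r t r01)).
have mUP : measurable_fun setT (modulus (Pplus w f) \o polar).
  exact: (measurableT_comp (measurable_modulus mP) measurable_polar).
have main : (\int[mu]_s (mean_pow p (modulus (Pplus w f) \o polar) s `^ (q / p) * (sw s)%:E) <= (K * C)%:E * N)%E.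
  rewrite EFinM -muleA.
  apply: (le_trans _ (lee_wpmul2l _ (hC U mU U0 fin))); last by rewrite lee_fin ltW.
  have mA : measurable_fun setT (fun r => (\int[mu]_(t in I2pi) (ker_average w U r t `^ p))%E).
    apply: (@measurable_int_section _ I2pi (fun z => ker_average w U z.1 z.2 `^ p)%E) => //.
      by apply: (measurableT_comp (measurable_poweR _)); exact: measurable_ker_average.
    by move=> z; exact: poweR_ge0.
  have mB : measurable_fun setT (fun r => (\int[mu]_(t in I2pi) (ker_average w U r t `^ p)) `^ (q / p) * (sw r)%:E)%E.
    apply: emeasurable_funM; first exact: (measurableT_comp (measurable_poweR _)).
    exact/measurable_EFinP.
  rewrite -(ge0_integralZl_EFin mu measurableT _ mB (ltW K0)); last first.
    by move=> r _; rewrite mule_ge0 ?poweR_ge0// lee_fin.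
  apply: ge0_le_integral => //.
  - by move=> s _; rewrite mule_ge0 ?poweR_ge0// lee_fin.
  - apply: emeasurable_funM; last exact/measurable_EFinP.
    apply: (measurableT_comp (measurable_poweR _)); exact: measurable_mean_pow.
  - exact: measurable_funeM.
  move=> s _; have [s01|s01] := boolP (0 <= s < 1); last first.
    by rewrite /area_weight (negbTE s01) !mule0.
  rewrite muleA; apply: lee_wpmul2r; first by rewrite lee_fin.
  have -> : (K%:E = ((2 * pi)^-1 * (2 / pi) `^ p)%:E `^ (q / p))%E by rewrite poweR_EFin.
  have I0 : (0 <= \int[mu]_(t in I2pi) (ker_average w U s t `^ p))%E.
    by apply: integral_ge0 => t _; exact: poweR_ge0.
  have c1 : (0 <= ((2 * pi)^-1 * (2 / pi) `^ p)%:E)%E.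
    by rewrite lee_fin mulr_ge0 ?powR_ge0// invr_ge0 mulr_ge0// ltW.
  rewrite -poweRM//; apply: gt0_ler_poweR; rewrite ?in_itv/= ?leey ?andbT ?(ltW pq0) ?mean_pow_ge0 ?mule_ge0//.
  rewrite /mean_pow EFinM -muleA; apply: lee_wpmul2l.
    by rewrite lee_fin invr_ge0 mulr_ge0// ltW.
  have mk : measurable_fun setT (fun t => ker_average w U s t `^ p)%E.
    apply: (measurableT_comp (measurable_poweR _)).
    exact: (measurableT_comp (measurable_ker_average rw Dw mU U0) (pair1_measurable s)).
  rewrite -ge0_integralZl_EFin ?powR_ge0//; last 2 first.
  - by move=> t _; exact: poweR_ge0.
  - exact: measurable_funTS.
  apply: ge0_le_integral => //.
  - by move=> t _; rewrite lee_fin powR_ge0.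
  - apply/measurable_EFinP; apply: measurable_funTS; apply: (measurableT_comp (measurable_powR _)).
    exact: (measurableT_comp mUP (pair1_measurable s)).
  - by apply: measurable_funeM; exact: measurable_funTS.
  move=> t _; have kE : ker_average w U s t = (fine (ker_average w U s t))%:E.
    by rewrite fineK// ge0_fin_numE// kfin.
  rewrite [in leRHS]kE poweR_EFin -EFinM lee_fin -powRM ?(ltW c0) ?fine_ge0//.
  rewrite ge0_ler_powR ?nnegrE ?(ltW p0)// ?modulus_ge0// ?Pbound//.
  by rewrite mulr_ge0 ?(ltW c0)// fine_ge0.
have final : (norm_pq w p q (Pplus w f) <= ((K * C) `^ q^-1)%:E * N `^ q^-1)%E.
  have KC : 0 <= K * C by rewrite mulr_ge0 ?ltW.
  rewrite norm_pqE -poweR_EFin -poweRM ?lee_fin//.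
  have N0' : (0 <= \int[mu]_s (mean_pow p (modulus (Pplus w f) \o polar) s `^ (q / p) * (sw s)%:E))%E.
    by apply: integral_ge0 => s _; rewrite mule_ge0 ?poweR_ge0// lee_fin.
  have qi : 0 <= q^-1 by rewrite invr_ge0 ltW.
  have KN : (0 <= (K * C)%:E * N)%E by apply: mule_ge0; [rewrite lee_fin; exact: KC|exact: N0].
  by apply: (gt0_ler_poweR qi _ _ main); rewrite in_itv/= leey andbT.
split; last split => //.
- move=> z z1; have [t _ zE] := polar_form z.
  have r01 : 0 <= normc z < 1 by rewrite normc_ge0.
  have {}zE : z = toC (polar (normc z, t)) by rewrite toC_polar.
  split.
    have := integrable_integrand mf mf.1 reP r01 (kfin _ t r01).
    by rewrite -zE; congr (is_true (integrable _ _ _)); apply/funext => v; rewrite Re_mul_real.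
  have := integrable_integrand mf mf.2 imP r01 (kfin _ t r01).
  by rewrite -zE; congr (is_true (integrable _ _ _)); apply/funext => v; rewrite Im_mul_real.
- split => //; apply: (le_lt_trans final).
  by rewrite lte_mul_pinfty ?lee_fin ?powR_ge0.
Qed.
End sufficiency.

(** * Necessity *)

Section necessity.
Context {R : realType}.
Local Notation mu := (@lebesgue_measure R).
Local Notation mu2 := (@plane_measure R).
Local Notation normc := (@ComplexField.Normc.normc R).
Local Notation J := (`[0%R, 1%R[%classic : set R).
Local Notation I2pi := (`[0%R, (2 * pi)%R]%classic : set R).
Variable w : R -> R.
Hypotheses (rw : radial_weight w) (Dw : Dhat w).
Implicit Types (a r s t : R) (z v : R * R).
Local Notation sw := (area_weight w).
Local Notation H := (omega_hat w).

(** Each block [M <= k < 2 M] has [M] terms, all at least [1 / (2 M)]. *)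
Lemma harmonic_dyadic_ge N j : (0 < N)%N ->
  j%:R / 2 <= \sum_(N <= k < 2 ^ j * N) (k%:R^-1 : R).
Proof.
move=> N0; elim: j => [|j IH]; first by rewrite mul0r mul1n big_geq.
have NM : (N <= 2 ^ j * N)%N by rewrite leq_pmull// expn_gt0.
have M0 : (0 < 2 ^ j * N)%N by rewrite muln_gt0 expn_gt0.
rewrite expnS -mulnA mul2n -addnn; set M := (2 ^ j * N)%N in IH NM M0 *.
rewrite (big_cat_nat (n := M)) ?leq_addr//= -natr1 mulrDl; apply: lerD => //.
rewrite mul1r; apply: (@le_trans _ _ (\sum_(M <= k < M + M) ((M + M)%:R^-1 : R))).
  rewrite sumr_const_nat addnK -[leRHS]mulr_natr natrD.
  have M0' : 0 < M%:R :> R by rewrite ltr0n.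
  rewrite le_eqVlt; apply/orP; left; apply/eqP; field.
  by rewrite gt_eqF// addr_gt0.
apply: ler_sum_nat => k /andP[Mk kM].
have k0 : (0 < k)%N by exact: leq_trans Mk.
by rewrite lef_pV2 ?posrE ?ltr0n ?ler_nat ?(ltnW kM) ?(leq_trans k0 (ltnW kM)).
Qed.

Lemma bernoulli_subr s n : 0 <= s <= 1 -> 1 - n%:R * (1 - s) <= s ^+ n.
Proof.
move=> /andP[s0 s1]; elim: n => [|n IH]; first by rewrite mul0r subr0 expr0.
apply: (@le_trans _ _ (s * (1 - n%:R * (1 - s)))); last by rewrite exprS ler_wpM2l.
by have := mulr_ge0 (ler0n R n) (sqr_ge0 (1 - s)); rewrite -natr1; nra.
Qed.

Definition ring_fun a (z : R[i]) : R[i] := (if a <= normc z then 1 else 0)%:C%C.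

Definition ring_mass a : \bar R := (\int[mu]_s (if a <= s then sw s else 0)%:E)%E.

Lemma cmeasurable_ring_fun a : cmeasurable_disc (ring_fun a).
Proof.
have mn : measurable_fun setT (fun v => normc (toC v)).
  by apply: measurable_normc; [exact: measurable_fst|exact: measurable_snd].
split; last exact: measurable_cst.
apply: measurable_funTS; apply: measurable_fun_ifT => //.
exact: measurable_fun_ler.
Qed.

Lemma modulus_ring_fun a s t : 0 <= s < 1 ->
  modulus (ring_fun a) (polar (s, t)) = if a <= s then 1 else 0.
Proof.
move=> /andP[s0 s1]; rewrite modulus_disc; last exact/disc_polar.
by rewrite /ring_fun normc_polar (ger0_norm s0) normcR; case: ifP; rewrite ?normr1 ?normr0.
Qed.

Lemma measurable_ring_weight a : measurable_fun setT (fun s => if a <= s then sw s else 0).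
Proof.
apply: measurable_fun_ifT => //; last exact: measurable_area_weight.
exact: measurable_fun_ler.
Qed.

Lemma ring_weight_ge0 a s : 0 <= if a <= s then sw s else 0.
Proof. by case: ifP => // _; exact: area_weight_ge0. Qed.

Lemma mean_pow_ring_fun p a s : 0 < p -> 0 <= s < 1 ->
  mean_pow p (modulus (ring_fun a) \o polar) s = (if a <= s then 1 else 0)%:E.
Proof.
move=> p0 s01; have pi0 := pi_gt0 R; rewrite /mean_pow.
have -> : (\int[mu]_(t in I2pi) ((modulus (ring_fun a) \o polar) (s, t) `^ p)%:E =
    \int[mu]_(t in I2pi) (cst (if a <= s then 1 else 0 : R) t)%:E)%E.
  apply: eq_integral => t _; rewrite /= modulus_ring_fun//; case: ifP => _; first by rewrite powR1.
  by rewrite powR0// gt_eqF.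
rewrite integral_cst_EFin// lebesgue_measure_itv/= lte_fin mulr_gt0//.
by rewrite -EFinB subr0 -!EFinM mulrCA mulVf ?mulr1// gt_eqF// mulr_gt0//.
Qed.

Lemma norm_ring_fun p q a : 0 < p -> 0 < q ->
  norm_pq w p q (ring_fun a) = (ring_mass a `^ q^-1)%E.
Proof.
move=> p0 q0; rewrite norm_pqE; suff -> : (\int[mu]_s (mean_pow p (modulus (ring_fun a) \o polar) s `^ (q / p) * (sw s)%:E))%E = ring_mass a by [].
apply: eq_integral => s _.
have [s01|s01] := boolP (0 <= s < 1); last first.
  by rewrite /area_weight (negbTE s01) mule0; case: ifP.
rewrite mean_pow_ring_fun// poweR_EFin; case: ifP => _; first by rewrite powR1 mul1e.
by rewrite powR0 ?mul0e// gt_eqF// divr_gt0.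
Qed.

Lemma ring_mass_bounds a : 0 <= a < 1 ->
  exists2 W, ring_mass a = W%:E & a * H a <= W.
Proof.
move=> a01; have /andP[a0 a1] := a01.
have [S S0 hS] := integral_area_weight_fin rw.
have W0 : (0 <= ring_mass a)%E by apply: integral_ge0 => s _; rewrite lee_fin ring_weight_ge0.
have fin : (ring_mass a < +oo)%E.
  apply: (@le_lt_trans _ _ S%:E); last exact: ltry.
  apply: le_trans hS; apply: ge0_le_integral => //.
  - by move=> s _; rewrite lee_fin ring_weight_ge0.
  - by apply/measurable_EFinP; exact: measurable_ring_weight.
  - by apply/measurable_EFinP; exact: measurable_area_weight.
  - by move=> s _; rewrite lee_fin; case: ifP => // _; exact: area_weight_ge0.
exists (fine (ring_mass a)); first by rewrite fineK// ge0_fin_numE.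
rewrite -lee_fin fineK ?ge0_fin_numE// EFinM omega_hatE//.
have mw := measurable_weight_itv rw a0.
rewrite -ge0_integralZl_EFin//; last first.
  by move=> s /(itv_sub_unit a0) ?; rewrite lee_fin; exact: weight_ge0.
rewrite integral_mkcond; apply: ge0_le_integral => //.
- move=> s _; rewrite patchE; case: ifPn => // /set_mem /(itv_sub_unit a0) ?.
  by rewrite -EFinM lee_fin mulr_ge0// (weight_ge0 rw).
- by apply/(measurable_restrictT _ _).1 => //; exact: measurable_funeM.
- by apply/measurable_EFinP; exact: measurable_ring_weight.
move=> s _; rewrite patchE; case: ifPn => [/set_mem sa|_]; last by rewrite lee_fin ring_weight_ge0.
have ws : 0 <= w s by apply: (weight_ge0 rw); exact: (itv_sub_unit a0 sa).
move: sa; rewrite /= in_itv/= => /andP[as_ s1].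
rewrite as_ /area_weight (le_trans a0 as_) s1/= -EFinM lee_fin ler_wpM2r//.
Qed.

(** For [r] and [s] in the ring, [r * s >= a ^ 2]. The kernel coefficients are nonnegative, so
    Hardy's lower bound at [r * s] dominates the one at [a ^ 2], uniformly over the ring. *)
Lemma ker_average_ring_fun_ge a r t n : 0 <= a -> a <= r -> r < 1 -> 0 <= t <= 2 * pi ->
  ((2 * \sum_(k < n) kcoef w (a ^+ 2) k / k%:R)%:E * ring_mass a <=
   ker_average w (modulus (ring_fun a) \o polar) r t)%E.
Proof.
move=> a0 ar r1 t2; set L := 2 * _.
have r0 := le_trans a0 ar; have mf := measurable_modulus (cmeasurable_ring_fun a).
have L0 : 0 <= L.
  rewrite mulr_ge0// sumr_ge0// => k _; rewrite divr_ge0//.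
  by apply: kcoef_ge0 => //; exact: exprn_ge0.
rewrite -ge0_integralZl_EFin//; last 2 first.
- by move=> s _; rewrite lee_fin ring_weight_ge0.
- by apply/measurable_EFinP; exact: measurable_ring_weight.
have mF : measurable_fun setT (fun z => ((modulus (ring_fun a) \o polar) z * sector_kernel w r t z)%:E).
  apply/measurable_EFinP; apply: measurable_funM.
    exact: (measurableT_comp mf measurable_polar).
  exact: (measurableT_comp (measurable_sector_kernel rw Dw r) (pair1_measurable t)).
have F0 z : (0 <= ((modulus (ring_fun a) \o polar) z * sector_kernel w r t z)%:E)%E.
  by rewrite lee_fin mulr_ge0 ?modulus_ge0 ?sector_kernel_ge0.
rewrite /ker_average /plane_measure (fubini_tonelli1 (m1 := mu) (m2 := mu) _ mF F0).
apply: ge0_le_integral => //.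
- by move=> s _; rewrite -EFinM lee_fin mulr_ge0 ?ring_weight_ge0.
- by apply: measurable_funeM; apply/measurable_EFinP; exact: measurable_ring_weight.
- exact: (measurable_fun_fubini_tonelli_F (m2 := mu)).
move=> s _; rewrite /fubini_F; have I0 := integral_ge0 mu (fun x (_ : setT x) => F0 (s, x)).
have [s01|s01] := boolP (0 <= s < 1); last first.
  by rewrite /area_weight (negbTE s01) if_same mule0; exact: I0.
have [as_|as_] := leP a s; last by rewrite mule0; exact: I0.
have /andP[s0 s1] := s01.
have rs : 0 <= r * s < 1 by rewrite mulr_ge0//= mulr_ilt1.
rewrite (_ : (fun y => _) = fun y => (sector_kernel w r t (s, y))%:E); last first.
  by apply/funext => y; rewrite /= modulus_ring_fun// as_ mul1r.
rewrite integral_sector_kernel_angle ?r0//.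
rewrite muleC; apply: lee_wpmul2l; first by rewrite lee_fin area_weight_ge0.
apply: le_trans (ker_int_ge rw Dw n rs); rewrite lee_fin ler_wpM2l//.
apply: ler_sum => k _; rewrite ler_wpM2r ?invr_ge0//.
rewrite ler_wpM2l ?(ltW (coef_gt0 rw k))// lerXn2r ?nnegrE ?exprn_ge0 ?mulr_ge0//.
by rewrite expr2 ler_pM.
Qed.

(** On the ring the projection of the indicator is at least the constant [c], so its norm is at
    least [c] times the norm of the indicator, namely [W ^ (1/q)]. Dividing gives [c <= C]; a ring
    of mass 0 is treated apart. *)
Lemma bounded_ring_mass p q : 0 < p -> 0 < q -> Pplus_bounded w p q ->
  exists C, forall a n, 0 <= a < 1 ->
    (\sum_(k < n) kcoef w (a ^+ 2) k / k%:R) * (a * H a) <= C.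
Proof.
move=> p0 q0 [C hC]; have pi0 := pi_gt0 R.
exists (pi * `|C|) => a n a01; have /andP[a0 a1] := a01.
have [W WE aH] := ring_mass_bounds a01.
have W0 : 0 <= W by rewrite -lee_fin -WE; apply: integral_ge0 => s _; rewrite lee_fin ring_weight_ge0.
set L := \sum_(k < n) _.
have L0 : 0 <= L.
  rewrite sumr_ge0// => k _; rewrite divr_ge0//.
  by apply: kcoef_ge0 => //; exact: exprn_ge0.
apply: (le_trans (ler_wpM2l L0 aH)).
have [->|Wneq0] := eqVneq W 0; first by rewrite mulr0 mulr_ge0// ltW.
have Wpos : 0 < W by rewrite lt_neqAle eq_sym Wneq0.
have inL : in_Lpq w p q (ring_fun a).
  split; first exact: cmeasurable_ring_fun.
  by rewrite norm_ring_fun// WE poweR_EFin ltry.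
have [int [[mP _] leC]] := hC _ inL.
pose c := pi^-1 * (2 * L * W).
have c0 : 0 <= c by rewrite mulr_ge0 ?invr_ge0 ?(ltW pi0)// mulr_ge0// mulr_ge0.
have lower s t : a <= s -> s < 1 -> 0 <= t <= 2 * pi ->
    c <= modulus (Pplus w (ring_fun a)) (polar (s, t)).
  move=> as_ s1 t2; have s0 := le_trans a0 as_.
  have dz : disc (polar (s, t)) by exact/disc_polar.
  have s01 : 0 <= s < 1 by rewrite s0.
  have mf := cmeasurable_ring_fun a.
  have kE : (\int[mu2]_(v in disc) (complex.Re (ring_fun a (toC v)) *
      normc (Bker w (toC (polar (s, t))) (toC v)) * w (normc (toC v)))%:E =
      ker_average w (modulus (ring_fun a) \o polar) s t)%E.
    rewrite -(integral_modulus_kernel rw Dw t s01 mf).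
    apply: eq_integral => v /set_mem dv.
    rewrite area_kernelE// mulrA modulus_disc//; congr (_ * _ * _)%:E.
    by rewrite /ring_fun normcR; case: ifP; rewrite ?normr1 ?normr0.
  (* The integrability clause of boundedness is essential here: [Pplus] is defined through
     real-valued integrals, where an infinite integral would count as 0 and give no lower bound. *)
  have kfin : ker_average w (modulus (ring_fun a) \o polar) s t \is a fin_num.
    rewrite -kE; have [|+ _] := int (toC (polar (s, t))); first exact/disc_normc.
    rewrite (_ : (fun xy => _) = fun v => (complex.Re (ring_fun a (toC v)) *
      normc (Bker w (toC (polar (s, t))) (toC v)) * w (normc (toC v)))%:E).
      by move=> ih; exact: (@integrable_fin_num _ _ _ mu2 _ measurable_disc _ ih).
    by apply/funext => v; rewrite Re_mul_real.
  rewrite modulus_disc//; apply: (le_trans _ (normr_Re_le _)).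
  apply: (le_trans _ (ler_norm _)); rewrite Re_Pplus /dA_int ler_wpM2l ?invr_ge0 ?(ltW pi0)//.
  rewrite /Rintegral -lee_fin (_ : (\int[leb2]_(x in _) _)%E = ker_average w (modulus (ring_fun a) \o polar) s t) ?fineK//.
  by rewrite EFinM -WE; exact: ker_average_ring_fun_ge.
have mUP : measurable_fun setT (modulus (Pplus w (ring_fun a)) \o polar).
  exact: (measurableT_comp (measurable_modulus mP) measurable_polar).
have pq0 : 0 < q / p by exact: divr_gt0.
have lowmean s : a <= s -> s < 1 ->
    ((c `^ p)%:E <= mean_pow p (modulus (Pplus w (ring_fun a)) \o polar) s)%E.
  move=> as_ s1; rewrite /mean_pow.
  apply: (@le_trans _ _ ((2 * pi)^-1%:E * \int[mu]_(t in I2pi) (cst (c `^ p) t)%:E)%E).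
    rewrite integral_cst_EFin// lebesgue_measure_itv/= lte_fin mulr_gt0//.
    by rewrite -EFinB subr0 -!EFinM mulrCA mulVf ?mulr1// gt_eqF// mulr_gt0//.
  apply: lee_wpmul2l; first by rewrite lee_fin invr_ge0 mulr_ge0// ltW.
  apply: ge0_le_integral => //.
  - by move=> t _; rewrite lee_fin powR_ge0.
  - by apply/measurable_EFinP; exact: measurable_cst.
  - apply/measurable_EFinP; apply: measurable_funTS; apply: (measurableT_comp (measurable_powR _)).
    exact: (measurableT_comp mUP (pair1_measurable s)).
  move=> t; rewrite /= in_itv/= => t2; rewrite lee_fin ge0_ler_powR ?nnegrE ?(ltW p0)// ?modulus_ge0//.
  exact: lower.
have mass : ((c `^ q * W)%:E <=
    \int[mu]_s (mean_pow p (modulus (Pplus w (ring_fun a)) \o polar) s `^ (q / p) * (sw s)%:E))%E.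
  rewrite EFinM -WE -ge0_integralZl_EFin ?powR_ge0//; last 2 first.
  - by move=> s _; rewrite lee_fin ring_weight_ge0.
  - by apply/measurable_EFinP; exact: measurable_ring_weight.
  apply: ge0_le_integral => //.
  - by move=> s _; rewrite -EFinM lee_fin mulr_ge0 ?powR_ge0 ?ring_weight_ge0.
  - by apply: measurable_funeM; apply/measurable_EFinP; exact: measurable_ring_weight.
  - apply: emeasurable_funM; last by apply/measurable_EFinP; exact: measurable_area_weight.
    by apply: (measurableT_comp (measurable_poweR _)); exact: measurable_mean_pow.
  move=> s _; case: ifPn => as_; last first.
    by rewrite mule0 mule_ge0 ?poweR_ge0// lee_fin area_weight_ge0.
  have [s01|s01] := boolP (0 <= s < 1); last first.
    by rewrite /area_weight (negbTE s01) !mule0.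
  have /andP[_ s1] := s01.
  apply: lee_wpmul2r; first by rewrite lee_fin area_weight_ge0.
  have -> : (c `^ q)%:E = ((c `^ p)%:E `^ (q / p))%E.
    by rewrite poweR_EFin -powRrM; congr (_ `^ _)%:E; field; rewrite gt_eqF.
  by apply: (gt0_ler_poweR (ltW pq0) _ _ (lowmean s as_ s1)); rewrite in_itv/= leey andbT ?lee_fin ?powR_ge0 ?mean_pow_ge0.
have qi : 0 < q^-1 by rewrite invr_gt0.
have : (((c `^ q * W) `^ q^-1)%:E <= (C * W `^ q^-1)%:E)%E.
  rewrite EFinM -!poweR_EFin -WE -(norm_ring_fun a p0 q0); apply: le_trans leC; rewrite norm_pqE.
  apply: (gt0_ler_poweR (ltW qi) _ _ mass); rewrite in_itv/= leey andbT.
    by rewrite lee_fin mulr_ge0 ?powR_ge0.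
  by apply: integral_ge0 => s _; rewrite mule_ge0 ?poweR_ge0// lee_fin area_weight_ge0.
rewrite lee_fin powRM ?powR_ge0// -powRrM divff ?gt_eqF// powRr1// ler_pM2r ?powR_gt0// => cC.
have -> : L * W = pi * (c / 2) by rewrite /c !mulrA divff ?gt_eqF//; field.
rewrite ler_pM2l//; have := ler_norm C; lra.
Qed.

Lemma Pplus_bounded_Dcheck p q : 0 < p -> 0 < q -> Pplus_bounded w p q -> Dcheck w.
Proof.
move=> p0 q0 /(bounded_ring_mass p0 q0)[C hC].
have [A A0 hA] := moment_le_omega_hat rw Dw.
(* 32 collects the losses: [8 A] in the lower bound for [L], 2 from [a >= 1/2], and 2 for the target
   [2 * H a <= H r]. *)
have [j j0 jC] : exists2 j, (0 < j)%N & 32 * A * C < j%:R.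
  by exists (Num.truncn (32 * A * C)).+1 => //; exact: truncnS_gt.
(* The three extra halvings give [2 k (1 - a) <= N (1 - r) / 4 <= 1/2] for all [k <= 2 ^ j * N], so
   that [a ^ (2 k)] stays above 1/2 on the whole block. *)
pose K : R := 2 ^+ j.+3; have K0 : 0 < K by exact: exprn_gt0.
exists K, 2; split; first by rewrite exprn_egt1// ltr1n.
split => [|r r01]; first by rewrite ltr1n.
have /andP[r0 r1] := r01; have Hr := omega_hat_gt0 rw r01.
have r1' : 0 < 1 - r by rewrite subr_gt0.
set a := 1 - (1 - r) / K.
have aK : 1 - a = (1 - r) / K by rewrite /a; ring.
have K8 : 8 <= K.
  rewrite /K (_ : 2 ^+ j.+3 = 8 * 2 ^+ j); last by rewrite !exprS; ring.
  by rewrite ler_peMr// exprn_ege1// ler1n.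
have Kr : (1 - r) / K <= 8^-1.
  by rewrite ler_pdivrMr//; lra.
have a0 : 2^-1 <= a by rewrite /a; lra.
have a1 : a < 1 by rewrite /a gtrBl divr_gt0.
have a01 : 0 <= a < 1 by rewrite a1 andbT; lra.
have Ha := omega_hat_gt0 rw a01.
(* Both bounds on [N (1 - r)] matter: at least 1 to compare the moments with [H r], at most 2 to
   keep the powers of [a] large. *)
pose N := (Num.truncn (1 - r)^-1).+1.
have N1 : 1 <= N%:R * (1 - r).
  by rewrite -ler_pdivrMr// mul1r ltW// truncnS_gt.
have N2 : N%:R * (1 - r) <= 2.
  rewrite /N -natr1 mulrDl mul1r (_ : 2 = 1 + 1)//; apply: lerD; last by lra.
  rewrite -ler_pdivlMr// mul1r.
  by have := truncn_le (1 - r)^-1; rewrite invr_ge0 (ltW r1').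
pose M := (2 ^ j * N)%N.
have := hC a M a01; set L := \sum_(k < M) _.
have LE : j%:R / (8 * (A * H r)) <= L.
  have N0 : (0 < N)%N by [].
  have NM : (N <= M)%N by rewrite /M leq_pmull// expn_gt0.
  have AH : 0 < A * H r by rewrite mulr_gt0.
  have AHc c : 0 <= c -> 0 <= (c * (A * H r))^-1 by move=> ?; rewrite invr_ge0 mulr_ge0// ltW.
  rewrite /L -(big_mkord predT (fun k => kcoef w (a ^+ 2) k / k%:R)) (big_cat_nat (n := N))//=.
  rewrite -[leLHS]add0r; apply: lerD.
    by apply: sumr_ge0 => k _; rewrite divr_ge0// (kcoef_ge0 rw)// sqr_ge0.
  apply: (@le_trans _ _ ((4 * (A * H r))^-1 * \sum_(N <= k < M) k%:R^-1)).
    rewrite (_ : _ / _ = (4 * (A * H r))^-1 * (j%:R / 2)); last by field; rewrite !gt_eqF.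
    by apply: ler_wpM2l; [exact: AHc|exact: harmonic_dyadic_ge].
  rewrite mulr_sumr; apply: ler_sum_nat => k /andP[Nk kM]; rewrite ler_wpM2r ?invr_ge0//.
  (* From [k >= N] on, the moment defining the coefficient is at most [A * H r]. *)
  have ck : (2 * (A * H r))^-1 <= coef w k.
    rewrite /coef lef_pV2 ?posrE ?mulr_gt0 ?moment_gt0// ler_wpM2l// addn1.
    apply: hA => //; apply: (le_trans N1); rewrite ler_wpM2r ?(ltW r1')// ler_nat.
    by rewrite (leq_trans Nk)// leq_pmull.
  have ak : 2^-1 <= (a ^+ 2) ^+ k.
    rewrite -exprM; apply: (@le_trans _ _ (1 - (2 * k)%:R * (1 - a))).
      rewrite aK natrM; have kM' : k%:R <= 2 ^+ j * N%:R :> R.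
        by rewrite -natrX -natrM ler_nat ltnW.
      have : 2 * k%:R * ((1 - r) / K) <= 2 * (2 ^+ j * N%:R) * ((1 - r) / K).
        by rewrite ler_wpM2r ?divr_ge0 ?(ltW r1') ?(ltW K0)// ler_wpM2l.
      have -> : 2 * (2 ^+ j * N%:R) * ((1 - r) / K) = N%:R * (1 - r) / 4.
        by rewrite /K !exprS; field; rewrite gt_eqF// exprn_gt0.
      by move=> h; lra.
    by apply: bernoulli_subr; case/andP: a01 => -> /ltW.
  rewrite (_ : (4 * _)^-1 = (2 * (A * H r))^-1 * 2^-1); last by field; rewrite !gt_eqF.
  by rewrite ler_pM// AHc.
move=> hL.
have : j%:R / (8 * (A * H r)) * (2^-1 * H a) <= C.
  apply: le_trans hL; apply: ler_pM => //.
  - by rewrite divr_ge0// !mulr_ge0 ?ltW.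
  - by rewrite mulr_ge0// ltW.
  - by rewrite ler_wpM2r// ltW.
rewrite mulrAC ler_pdivrMr ?mulr_gt0// => h.
have : j%:R * (2 * H a) <= j%:R * H r.
  apply: (@le_trans _ _ (4 * (C * (8 * (A * H r))))).
    by apply: le_trans (ler_wpM2l _ h); lra.
  rewrite (_ : 4 * _ = 32 * A * C * H r); last by ring.
  by rewrite ler_wpM2r ?(ltW Hr)// ltW.
by rewrite ler_pM2l ?ltr0n.
Qed.
End necessity.

Theorem theorem1p3 (R : realType) (w : R -> R) (p q : R) :
  radial_weight w -> Dhat w -> 1 < p -> 1 < q ->
  (Pplus_bounded w p q <-> Dcheck w).
Proof.
move=> rw Dw p1 q1; split; last exact: Dcheck_Pplus_bounded.
by apply: (Pplus_bounded_Dcheck rw Dw); apply: lt_trans ltr01 _.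
Qed.
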